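(* Let $\mathrm{Re}(a+b)<\frac12$. Then $$\sum_{n=1}^\infty\frac{(2a)_n(2b)_n}{n!\left(a+b+1/2\right)_n}\frac{H_n}{n+1}=\frac{(2a+2b-1)\sin\pi a\,\sin\pi b}{(2a-1)(2b-1)\cos\pi(a+b)}\left(\psi\left(\tfrac12\right)+\psi\left(\tfrac32-a-b\right)-\psi(1-a)-\psi(1-b)\right).$$
   Context: $(x)_n=x(x+1)\cdots(x+n-1)$ is the Pochhammer symbol, $H_n=\sum_{k=1}^n\frac1k$ is the $n$-th harmonic number, and $\psi(x)=\Gamma'(x)/\Gamma(x)$ is the digamma function, where $\Gamma$ is the gamma function. *)

(* Defs.v *)
From Stdlib Require Import Reals Factorial.
From Coquelicot Require Import Coquelicot.

Open Scope C_scope.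

Definition Cexp (z : C) : C :=
  RtoC (exp (Re z)) * (RtoC (cos (Im z)) + Ci * RtoC (sin (Im z))).

Definition Csin (z : C) : C := (Cexp (Ci * z) - Cexp (- (Ci * z))) / (2 * Ci).

Definition Ccos (z : C) : C := (Cexp (Ci * z) + Cexp (- (Ci * z))) / 2.

Fixpoint pochhammer (x : C) (n : nat) : C :=
  match n with
  | O => 1
  | S k => pochhammer x k * (x + RtoC (INR k))
  end.

Definition harmonic (n : nat) : R := sum_n_m (fun k : nat => Rinv (INR k)) 1 n.

(* Gauss's formula  Gamma(z) = lim n! n^z / (z (z+1) ... (z+n)),  which holds
   on the whole domain of Gamma, i.e. off the poles z = 0, -1, -2, ...
   Here n^z is exp (z ln n); the meaningless term n = 0 does not affect the
   limit.  The complex limit is taken componentwise; the values at the poles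
   are junk. *)
Definition gamma_seq (z : C) (n : nat) : C :=
  RtoC (INR (fact n)) * Cexp (z * RtoC (ln (INR n))) / pochhammer z (S n).

Definition Gamma (z : C) : C :=
  (real (Lim_seq (fun n : nat => Re (gamma_seq z n))),
   real (Lim_seq (fun n : nat => Im (gamma_seq z n)))).

(* [C_derive f z] is computed along real increments; it is the complex
   derivative wherever f is holomorphic ([C_derive_correct]), so for [Gamma]
   everywhere off the poles. *)
Definition digamma (z : C) : C := C_derive Gamma z / Gamma z.

(* Main.v *)
(* With A = 2a - 1, B = 2b - 1, c = a + b - 1/2 = (A + B + 1)/2 and
   t_m = (A)_m (B)_m / (m! (c)_m), the n-th summand is c/(AB) t_(n+1) H_n.
   The sum of the t_(n+1) H_n is -2 times the derivative at k = 0 of Watson's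
   series W(k) = 3F2(A, B, k; c, 2k; 1).  A telescoping certificate gives
   W(k) = r(k) W(k+1) with
   r(k) = (k+1-a)(k+1-b) / ((k+1/2)(k+3/2-a-b)); differentiating it in k and
   iterating, W'(0) = W(0) sum_k r'(k)/r(k), since W'(n) = O(1/n).  The last
   series is the combination of digamma values.  Finally
   W(0) = (1 + 2F1(A, B; c; 1)) / 2, where Gauss's product for 2F1 is a ratio
   of two cosine products because c - A = 1/2 + (b - a), c - B = 1/2 - (b - a)
   and c - A - B = 1 - c. *)
Require Import Defs.
From Stdlib Require Import ZArith Reals Factorial Lra Lia Psatz.
From Coquelicot Require Import Coquelicot.

Open Scope C_scope.

(** * Convergence of complex sequences *)

(** The ratio r(k) is the one predicted by Watson's evaluation of W(k) as a quotient of Gamma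
    values; the certificate establishes just this ratio. Only integers k occur: W'(k) is taken as
    the termwise differentiated series, and its recursion comes from telescoping with the
    k-derivative of the certificate, so no limit in k is exchanged with the sum. At k = 0 the
    quotient (k)_m / (2k)_m is read by continuity: 1 for m = 0 and 1/2 for m >= 1, there with
    logarithmic derivative -H_(m-1). This is the origin of the half in W(0) and of the factor -2.
    The boundary terms of the certificates require n t_n H_n -> 0. Since Re (c - A - B) = 3/2 - Re
    (a + b) > 1, a Raabe estimate makes n^2 |t_n| (1 + H_n) bounded and the sum of n |t_n| finite.
    Gamma enters through its defining product, whose factors are expanded to second order in a real
    increment, uniformly in the index; this yields the digamma series. Gauss's value is likewise
    kept as an infinite product and compared factor by factor with the product for the cosine. *)

Fixpoint csum (f : nat -> C) (n : nat) : C :=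
  match n with O => 0 | S k => csum f k + f k end.

Fixpoint rsum (f : nat -> R) (n : nat) : R :=
  match n with O => 0%R | S k => (rsum f k + f k)%R end.

Fixpoint cprod (f : nat -> C) (n : nat) : C :=
  match n with O => 1 | S k => cprod f k * f k end.

(** Phrased through the modulus, so that every complex limit below reduces to a squeeze on real
    sequences. *)
Definition Ccv (u : nat -> C) (l : C) : Prop :=
  is_lim_seq (fun n => Cmod (u n - l)) 0%R.

Lemma div_le_of_le_mul (a b c : R) : (0 < c -> a <= b * c -> a / c <= b)%R.
Proof.
  intros Hc H. apply Rmult_le_reg_r with c; auto.
  replace (a / c * c)%R with a by (field; lra). exact H.
Qed.

Lemma le_mul_of_div_le (a b c : R) : (0 < c -> a / c <= b -> a <= b * c)%R.
Proof.
  intros Hc H. replace a with (a / c * c)%R by (field; lra).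
  apply Rmult_le_compat_r; lra.
Qed.

Lemma Cmod_sub_sym (x y : C) : Cmod (x - y) = Cmod (y - x).
Proof. rewrite <- Cmod_opp. f_equal. ring. Qed.

Lemma Cmod_sub_le (x y : C) : (Cmod x <= Cmod (x - y) + Cmod y)%R.
Proof.
  replace x with ((x - y) + y) at 1 by ring. apply Cmod_triangle.
Qed.

Lemma Cmod_minus_le (x y : C) : (Cmod (x - y) <= Cmod x + Cmod y)%R.
Proof. rewrite <- (Cmod_opp y). apply Cmod_triangle. Qed.

Lemma squeeze_0 (u v : nat -> R) :
  (forall n, (0 <= u n <= v n)%R) -> is_lim_seq v 0%R -> is_lim_seq u 0%R.
Proof.
  intros H Hv. apply (is_lim_seq_le_le (fun _ => 0%R) u v); auto.
  apply is_lim_seq_const.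
Qed.

Lemma Ccv_squeeze (u : nat -> C) (l : C) (v : nat -> R) :
  (forall n, (Cmod (u n - l) <= v n)%R) -> is_lim_seq v 0%R -> Ccv u l.
Proof.
  intros H Hv. apply (squeeze_0 _ v); auto. intros n. split; auto. apply Cmod_ge_0.
Qed.

Lemma Ccv_ext (u v : nat -> C) (l : C) :
  (forall n, u n = v n) -> Ccv u l -> Ccv v l.
Proof. intros H. apply is_lim_seq_ext. intros n. now rewrite H. Qed.

Lemma Ccv_const (c : C) : Ccv (fun _ => c) c.
Proof.
  apply is_lim_seq_ext with (fun _ => 0%R); [|apply is_lim_seq_const].
  intros n. replace (c - c) with (RtoC 0) by ring. now rewrite Cmod_0.
Qed.

Lemma is_lim_seq_plus_0 (u v : nat -> R) :
  is_lim_seq u 0%R -> is_lim_seq v 0%R -> is_lim_seq (fun n => u n + v n)%R 0%R.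
Proof.
  intros Hu Hv. replace 0%R with (0 + 0)%R by ring. now apply is_lim_seq_plus'.
Qed.

Lemma is_lim_seq_scal_0 (u : nat -> R) (k : R) :
  is_lim_seq u 0%R -> is_lim_seq (fun n => k * u n)%R 0%R.
Proof.
  intros Hu. replace 0%R with (k * 0)%R by ring. apply is_lim_seq_mult'; auto.
  apply is_lim_seq_const.
Qed.

Lemma Ccv_plus (u v : nat -> C) (l m : C) :
  Ccv u l -> Ccv v m -> Ccv (fun n => u n + v n) (l + m).
Proof.
  intros Hu Hv. eapply Ccv_squeeze; [|exact (is_lim_seq_plus_0 _ _ Hu Hv)].
  intros n. cbv beta. replace (u n + v n - (l + m)) with ((u n - l) + (v n - m)) by ring.
  apply Cmod_triangle.
Qed.

Lemma Ccv_bounded (u : nat -> C) (l : C) :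
  Ccv u l -> exists M, (0 < M)%R /\ forall n, (Cmod (u n) <= M)%R.
Proof.
  intros Hu.
  destruct (filterlim_bounded (V := R_NormedModule) (fun n => Cmod (u n - l))) as [M HM].
  { exists 0%R. exact Hu. }
  exists (Rabs M + Cmod l + 1)%R. split.
  { assert (H := Cmod_ge_0 l). assert (H0 := Rabs_pos M). lra. }
  intros n. assert (H := Cmod_sub_le (u n) l). specialize (HM n).
  change (Rabs (Cmod (u n - l)) <= M)%R in HM.
  assert (H1 := Rle_abs (Cmod (u n - l))). assert (H2 := Rle_abs M). lra.
Qed.

Lemma Ccv_mult (u v : nat -> C) (l m : C) :
  Ccv u l -> Ccv v m -> Ccv (fun n => u n * v n) (l * m).
Proof.
  intros Hu Hv. destruct (Ccv_bounded _ _ Hv) as [M [M0 HM]].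
  apply Ccv_squeeze with (fun n => M * Cmod (u n - l) + Cmod l * Cmod (v n - m))%R.
  - intros n. replace (u n * v n - l * m) with ((u n - l) * v n + l * (v n - m)) by ring.
    eapply Rle_trans; [apply Cmod_triangle|]. rewrite !Cmod_mult.
    specialize (HM n). assert (H := Cmod_ge_0 (u n - l)). nra.
  - apply is_lim_seq_plus_0; now apply is_lim_seq_scal_0.
Qed.

Lemma Ccv_scal (u : nat -> C) (c l : C) :
  Ccv u l -> Ccv (fun n => c * u n) (c * l).
Proof. intros Hu. apply Ccv_mult; auto. apply Ccv_const. Qed.

Lemma Ccv_minus (u v : nat -> C) (l m : C) :
  Ccv u l -> Ccv v m -> Ccv (fun n => u n - v n) (l - m).
Proof.
  intros Hu Hv. apply Ccv_ext with (fun n => u n + (- (1)) * v n).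
  { intros n. ring. }
  replace (l - m) with (l + (- (1)) * m) by ring.
  apply Ccv_plus; auto. now apply Ccv_scal.
Qed.

Lemma Ccv_unique (u : nat -> C) (l m : C) : Ccv u l -> Ccv u m -> l = m.
Proof.
  intros Hl Hm. assert (H := Ccv_minus _ _ _ _ Hl Hm).
  assert (H2 : Ccv (fun n => u n - u n) 0).
  { apply Ccv_ext with (fun _ => RtoC 0); [intros n; ring|apply Ccv_const]. }
  unfold Ccv in H, H2.
  assert (E : Cmod (l - m) = 0%R).
  { assert (Hc : is_lim_seq (fun n => Cmod (u n - u n - (l - m))) (Cmod (l - m))).
    { apply is_lim_seq_ext with (fun _ => Cmod (l - m)); [|apply is_lim_seq_const].
      intros n. rewrite <- Cmod_opp. f_equal. ring. }
    apply is_lim_seq_unique in H. apply is_lim_seq_unique in Hc.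
    rewrite H in Hc. now inversion Hc. }
  apply Cmod_eq_0 in E. replace l with ((l - m) + m) by ring. rewrite E. ring.
Qed.

Lemma Ccv_incr (u : nat -> C) (l : C) : Ccv (fun n => u (S n)) l <-> Ccv u l.
Proof.
  unfold Ccv. split; intros H.
  - now apply (is_lim_seq_incr_1 (fun n => Cmod (u n - l))).
  - now apply (is_lim_seq_incr_1 (fun n => Cmod (u n - l))) in H.
Qed.

Lemma Ccv_Cmod_le (u : nat -> C) (l : C) (M : R) :
  Ccv u l -> (forall n, (Cmod (u n) <= M)%R) -> (Cmod l <= M)%R.
Proof.
  intros Hu HM.
  apply (is_lim_seq_le (fun _ => (Cmod l))%R (fun n => M + Cmod (u n - l))%R (Cmod l) M).
  - intros n. assert (H := Cmod_sub_le l (u n)). rewrite Cmod_sub_sym in H.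
    specialize (HM n). lra.
  - apply is_lim_seq_const.
  - replace (Finite M) with (Finite (M + 0)%R) by (f_equal; ring).
    apply is_lim_seq_plus'; auto. apply is_lim_seq_const.
Qed.

Lemma im_le_Cmod (z : C) : (Rabs (Im z) <= Cmod z)%R.
Proof. eapply Rle_trans; [|apply Rmax_Cmod]. apply Rmax_r. Qed.

Lemma is_lim_seq_of_diff (u : nat -> R) (l : R) (v : nat -> R) :
  (forall n, (Rabs (u n - l) <= v n)%R) -> is_lim_seq v 0%R -> is_lim_seq u l.
Proof.
  intros H Hv. apply is_lim_seq_ext with (fun n => (u n - l) + l)%R.
  { intros n. ring. }
  replace (Finite l) with (Finite (0 + l)%R) by (f_equal; ring).
  apply is_lim_seq_plus'; [|apply is_lim_seq_const].
  apply is_lim_seq_abs_0. apply (squeeze_0 _ v); auto.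
  intros n; split; auto. apply Rabs_pos.
Qed.

Lemma Ccv_Re (u : nat -> C) (l : C) : Ccv u l -> is_lim_seq (fun n => Re (u n)) (Re l).
Proof.
  intros Hu. apply (is_lim_seq_of_diff _ _ _ (fun n => re_le_Cmod (u n - l)) Hu).
Qed.

Lemma Ccv_Im (u : nat -> C) (l : C) : Ccv u l -> is_lim_seq (fun n => Im (u n)) (Im l).
Proof.
  intros Hu. apply (is_lim_seq_of_diff _ _ _ (fun n => im_le_Cmod (u n - l)) Hu).
Qed.

Lemma Ccv_Cmod (u : nat -> C) (l : C) : Ccv u l -> is_lim_seq (fun n => Cmod (u n)) (Cmod l).
Proof.
  apply is_lim_seq_of_diff. intros n. apply Rabs_le.
  assert (H1 := Cmod_sub_le (u n) l). assert (H2 := Cmod_sub_le l (u n)).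
  rewrite (Cmod_sub_sym l) in H2. lra.
Qed.

(** Componentwise, in the same form as [Gamma], so that [Gamma z] is convertible to
    [Clim (gamma_seq z)]. Being total, it lets sums be named before their convergence is known. *)
Definition Clim (u : nat -> C) : C :=
  (real (Lim_seq (fun n => Re (u n))), real (Lim_seq (fun n => Im (u n)))).

Lemma Clim_unique (u : nat -> C) (l : C) : Ccv u l -> Clim u = l.
Proof.
  intros H. unfold Clim.
  rewrite (is_lim_seq_unique _ _ (Ccv_Re _ _ H)).
  rewrite (is_lim_seq_unique _ _ (Ccv_Im _ _ H)). now destruct l.
Qed.

Lemma Clim_correct (u : nat -> C) (l : C) : Ccv u l -> Ccv u (Clim u).
Proof. intros H. now rewrite (Clim_unique _ _ H). Qed.

Lemma sum_n_csum (f : nat -> C) (n : nat) : sum_n f n = csum f (S n).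
Proof.
  induction n as [|n IH].
  - rewrite sum_O. simpl. ring.
  - rewrite sum_Sn, IH. reflexivity.
Qed.

Lemma is_series_of_Ccv (f : nat -> C) (l : C) :
  Ccv (csum f) l -> @is_series C_AbsRing C_NormedModule f l.
Proof.
  intros H. apply Ccv_incr in H. unfold is_series.
  apply filterlim_ext with (fun n => csum f (S n)).
  { intros n. symmetry. apply sum_n_csum. }
  apply (filterlim_locally (F := eventually) (U := C_NormedModule)
    (fun n => csum f (S n)) l).
  intros eps. apply is_lim_seq_spec in H. destruct (H eps) as [N HN].
  exists N. intros n Hn. specialize (HN n Hn). apply C_NormedModule_mixin_compat1.
  rewrite Rminus_0_r in HN. apply Rle_lt_trans with (2 := HN). apply Rle_abs.
Qed.

Lemma rsum_sum_n (f : nat -> R) (n : nat) : sum_n f n = rsum f (S n).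
Proof.
  induction n as [|n IH].
  - rewrite sum_O. simpl. ring.
  - rewrite sum_Sn, IH. reflexivity.
Qed.

Lemma rsum_le (f g : nat -> R) (n : nat) :
  (forall k, (k < n)%nat -> (f k <= g k)%R) -> (rsum f n <= rsum g n)%R.
Proof.
  induction n as [|n IH]; simpl; intros H; [lra|].
  assert (H1 := H n (Nat.lt_succ_diag_r n)).
  assert (rsum f n <= rsum g n)%R by (apply IH; intros; apply H; lia). lra.
Qed.

Lemma rsum_scal (c : R) (f : nat -> R) (n : nat) :
  rsum (fun k => c * f k)%R n = (c * rsum f n)%R.
Proof. induction n as [|n IH]; simpl; [ring|rewrite IH; ring]. Qed.

Lemma csum_scal (c : C) (f : nat -> C) (n : nat) :
  csum (fun k => c * f k) n = c * csum f n.
Proof. induction n as [|n IH]; simpl; [ring|rewrite IH; ring]. Qed.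

Lemma csum_ext (f g : nat -> C) (n : nat) :
  (forall k, f k = g k) -> csum f n = csum g n.
Proof. intros H. induction n as [|n IH]; simpl; [easy|]. now rewrite IH, H. Qed.

Lemma csum_plus (f g : nat -> C) (n : nat) :
  csum (fun k => f k + g k) n = csum f n + csum g n.
Proof. induction n as [|n IH]; simpl; [ring|rewrite IH; ring]. Qed.

Lemma csum_minus (f g : nat -> C) (n : nat) :
  csum (fun k => f k - g k) n = csum f n - csum g n.
Proof. induction n as [|n IH]; simpl; [ring|rewrite IH; ring]. Qed.

Lemma csum_telescope (X : nat -> C) (n : nat) :
  csum (fun k => X (S k) - X k) n = X n - X O.
Proof. induction n as [|n IH]; simpl; [ring|rewrite IH; ring]. Qed.

Lemma csum_shift (f : nat -> C) (n : nat) :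
  csum f (S n) = f O + csum (fun k => f (S k)) n.
Proof.
  induction n as [|n IH]; simpl; [ring|]. simpl in IH. rewrite IH. ring.
Qed.

Lemma Cmod_csum_le (f : nat -> C) (n : nat) :
  (Cmod (csum f n) <= rsum (fun k => Cmod (f k)) n)%R.
Proof.
  induction n as [|n IH]; simpl; [rewrite Cmod_0; lra|].
  eapply Rle_trans; [apply Cmod_triangle|]. lra.
Qed.

Lemma ex_series_of_rsum_bounded (f : nat -> R) (M : R) :
  (forall n, (0 <= f n)%R) -> (forall n, (rsum f n <= M)%R) -> ex_series f.
Proof.
  intros Hf HM.
  destruct (ex_finite_lim_seq_incr (sum_n f) M) as [l Hl].
  - intros n. rewrite !rsum_sum_n. simpl. specialize (Hf (S n)). lra.
  - intros n. rewrite rsum_sum_n. apply HM.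
  - exists l. exact Hl.
Qed.

Lemma csum_abs_cv (f : nat -> C) (M : R) :
  (forall n, (rsum (fun k => Cmod (f k)) n <= M)%R) ->
  exists l, Ccv (csum f) l /\ (Cmod l <= M)%R.
Proof.
  intros HM.
  assert (Hex : @ex_series C_AbsRing C_NormedModule f).
  { apply (@ex_series_le C_AbsRing C_CompleteNormedModule f (fun k => Cmod (f k))).
    - intros n. apply Rle_refl.
    - apply ex_series_of_rsum_bounded with M; auto. intros n. apply Cmod_ge_0. }
  destruct Hex as [l Hl]. exists l.
  assert (Hcv : Ccv (csum f) l).
  { apply Ccv_incr. unfold Ccv.
    apply is_lim_seq_spec. intros eps.
    (* The balls of the normed module C are products of real balls, so radius r only guarantees a
       modulus below sqrt 2 times r. *)
    assert (He : (0 < eps / sqrt 2)%R).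
    { apply Rdiv_lt_0_compat; [apply cond_pos|apply sqrt_lt_R0; lra]. }
    assert (H := proj1 (filterlim_locally (F := eventually) (U := C_NormedModule) (sum_n f) l) Hl
      (mkposreal _ He)).
    destruct H as [N HN]. exists N. intros n Hn. specialize (HN n Hn).
    apply C_NormedModule_mixin_compat2 in HN. simpl in HN.
    rewrite Rminus_0_r. rewrite Rabs_pos_eq by apply Cmod_ge_0.
    rewrite sum_n_csum in HN. change (minus (csum f (S n)) l) with (csum f (S n) - l) in HN.
    replace (sqrt 2 * (eps / sqrt 2))%R with (pos eps) in HN; auto.
    field. apply Rgt_not_eq, sqrt_lt_R0. lra. }
  split; auto.
  apply (Ccv_Cmod_le _ _ _ Hcv). intros n. eapply Rle_trans; [apply Cmod_csum_le|apply HM].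
Qed.

(** Absolute convergence of the increments. The infinite products below converge by this
    criterion. *)
Lemma Ccv_of_bounded_variation (u : nat -> C) (M : R) :
  (forall n, (rsum (fun k => Cmod (u (S k) - u k)) n <= M)%R) ->
  exists l, Ccv u l.
Proof.
  intros HM. destruct (csum_abs_cv _ _ HM) as [l [Hl _]].
  exists (u O + l). apply Ccv_ext with (fun n => u O + csum (fun k => u (S k) - u k) n).
  - intros n. rewrite csum_telescope. ring.
  - apply Ccv_plus; auto. apply Ccv_const.
Qed.

(* The exceptional finitely many indices only enlarge the constant. *)
Lemma bound_of_eventual_bound (u e : nat -> R) (K : R) (N : nat) :
  (forall n, (0 < e n)%R) -> (forall n, (N <= n)%nat -> (u n <= K * e n)%R) ->
  exists K', (0 < K')%R /\ forall n, (u n <= K' * e n)%R.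
Proof.
  intros He. revert K. induction N as [|N IH]; intros K H.
  - exists (Rmax K 1). split; [apply Rlt_le_trans with 1%R; [lra|apply Rmax_r]|].
    intros n. assert (H1 := H n (Nat.le_0_l n)). specialize (He n).
    assert (H2 := Rmax_l K 1). nra.
  - apply (IH (Rmax K (u N / e N))). intros n Hn. specialize (He n).
    assert (H2 := Rmax_l K (u N / e N)). assert (H3 := Rmax_r K (u N / e N)).
    destruct (Nat.eq_dec n N) as [->|Hne].
    + replace (u N) with (u N / e N * e N)%R at 1 by (field; lra).
      apply Rmult_le_compat_r; lra.
    + assert (H4 : (N < n)%nat) by lia. specialize (H n H4). nra.
Qed.

Lemma rsum_inv_sq_le (n : nat) : (rsum (fun k => / (INR k + 1) ^ 2) n <= 2)%R.
Proof.
  (* The subtracted term makes the induction close: 1/(m+2)^2 is at most 1/(m+1) - 1/(m+2). *)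
  assert (H : forall m, (rsum (fun k => / (INR k + 1) ^ 2) (S m) <= 2 - / (INR m + 1))%R).
  { induction m as [|m IH]; [simpl; lra|].
    change (rsum (fun k => / (INR k + 1) ^ 2) (S m) + / (INR (S m) + 1) ^ 2
      <= 2 - / (INR (S m) + 1))%R.
    rewrite S_INR. assert (Hm := pos_INR m). set (x := INR m) in *.
    assert (/ (x + 1 + 1) ^ 2 <= / (x + 1) - / (x + 1 + 1))%R; [|lra].
    replace (/ (x + 1) - / (x + 1 + 1))%R with (/ ((x + 1) * (x + 2)))%R by (field; lra).
    apply Rinv_le_contravar; nra. }
  destruct n as [|n]; [simpl; lra|]. specialize (H n).
  assert (0 < / (INR n + 1))%R.
  { apply Rinv_0_lt_compat. assert (Hm := pos_INR n). lra. }
  lra.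
Qed.

Lemma is_lim_seq_inv_S (K : R) : is_lim_seq (fun n => K / (INR n + 1))%R 0%R.
Proof.
  apply is_lim_seq_scal_0.
  apply is_lim_seq_ext with (fun n => / INR (S n))%R.
  { intros n. now rewrite S_INR. }
  apply (is_lim_seq_incr_1 (fun n => / INR n)%R).
  replace (Finite 0) with (Rbar_inv p_infty) by reflexivity.
  apply is_lim_seq_inv; [apply is_lim_seq_INR|discriminate].
Qed.

(** * Infinite products and the exponential *)

Lemma inv_sq_pos (n : nat) : (0 < / (INR n + 1) ^ 2)%R.
Proof. apply Rinv_0_lt_compat, pow_lt. assert (H := pos_INR n). lra. Qed.

Lemma Cmod_cprod_le_exp (v : nat -> C) (K : R) :
  (forall n, (Cmod (v n - 1) <= K * / (INR n + 1) ^ 2)%R) ->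
  forall n, (Cmod (cprod v n) <= exp (K * rsum (fun k => / (INR k + 1) ^ 2) n))%R.
Proof.
  intros H n. induction n as [|n IH]; simpl.
  - rewrite Cmod_1, Rmult_0_r, exp_0. lra.
  - rewrite Cmod_mult, Rmult_plus_distr_l, exp_plus.
    apply Rmult_le_compat; auto using Cmod_ge_0.
    assert (H1 := Cmod_sub_le (v n) 1). rewrite Cmod_1 in H1.
    specialize (H n). simpl in H.
    assert (H2 := exp_ineq1_le (K * / ((INR n + 1) * ((INR n + 1) * 1)))). lra.
Qed.

Lemma nonneg_of_Cmod_bound (v : nat -> C) (K : R) :
  (forall n, (Cmod (v n) <= K * / (INR n + 1) ^ 2)%R) -> (0 <= K)%R.
Proof.
  intros H. specialize (H O). assert (H1 := Cmod_ge_0 (v O)). simpl in H.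
  replace (K * / ((0 + 1) * ((0 + 1) * 1)))%R with K in H by field. lra.
Qed.

Lemma cprod_bounded (v : nat -> C) (K : R) :
  (forall n, (Cmod (v n - 1) <= K * / (INR n + 1) ^ 2)%R) ->
  forall n, (Cmod (cprod v n) <= exp (2 * K))%R.
Proof.
  intros H n. eapply Rle_trans; [apply (Cmod_cprod_le_exp v K H)|].
  assert (HK := nonneg_of_Cmod_bound _ _ H).
  assert (H1 := rsum_inv_sq_le n).
  destruct (Rle_lt_or_eq_dec (K * rsum (fun k => / (INR k + 1) ^ 2) n)%R (2 * K)%R) as [E|E].
  - nra.
  - left. now apply exp_increasing.
  - rewrite E. lra.
Qed.

Lemma cprod_variation (v : nat -> C) (K : R) :
  (forall n, (Cmod (v n - 1) <= K * / (INR n + 1) ^ 2)%R) ->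
  forall n, (rsum (fun k => Cmod (cprod v (S k) - cprod v k)) n
    <= 2 * K * exp (2 * K))%R.
Proof.
  intros H n. assert (HK := nonneg_of_Cmod_bound _ _ H).
  apply Rle_trans with
    (rsum (fun k => (K * exp (2 * K)) * / (INR k + 1) ^ 2)%R n).
  - apply rsum_le. intros k _. cbv beta. change (cprod v (S k)) with (cprod v k * v k).
    replace (cprod v k * v k - cprod v k) with (cprod v k * (v k - 1)) by ring.
    rewrite Cmod_mult. assert (H1 := cprod_bounded v K H k). specialize (H k).
    replace (K * exp (2 * K) * / (INR k + 1) ^ 2)%R with
      (exp (2 * K) * (K * / (INR k + 1) ^ 2))%R by ring.
    apply Rmult_le_compat; auto using Cmod_ge_0.
  - rewrite rsum_scal. assert (H1 := rsum_inv_sq_le n). assert (H2 := exp_pos (2 * K)).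
    assert (0 <= K * exp (2 * K))%R by nra. nra.
Qed.

Lemma cprod_cv (v : nat -> C) (K : R) :
  (forall n, (Cmod (v n - 1) <= K * / (INR n + 1) ^ 2)%R) ->
  exists l, Ccv (cprod v) l.
Proof.
  intros H. apply (Ccv_of_bounded_variation _ _ (cprod_variation v K H)).
Qed.

(** The inverted factors also differ from 1 by O(1/n^2), so the product of inverses converges too,
    and the two limits multiply to 1. *)
Lemma cprod_cv_neq_0 (v : nat -> C) (K : R) :
  (forall n, (Cmod (v n - 1) <= K * / (INR n + 1) ^ 2)%R) ->
  (forall n, v n <> 0) ->
  exists l : C, l <> 0 /\ Ccv (cprod v) l.
Proof.
  intros H Hv. destruct (cprod_cv v K H) as [l Hl]. exists l. split; auto.
  assert (HK := nonneg_of_Cmod_bound _ _ H).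
  (* From n >= N on, n + 1 exceeds 2K, hence |v n - 1| <= 1/2 and |v n| >= 1/2; inverting then at
     most doubles the constant. *)
  destruct (nfloor_ex (2 * K)) as [N [_ HN]]; [lra|].
  destruct (bound_of_eventual_bound (fun n => Cmod (/ v n - 1))
    (fun n => / (INR n + 1) ^ 2)%R (2 * K) N inv_sq_pos) as [K' [_ HK']].
  { intros n Hn. apply le_INR in Hn. assert (Hn0 := pos_INR n).
    assert (Hi : (/ (INR n + 1) ^ 2 <= / (INR n + 1))%R).
    { apply Rinv_le_contravar; nra. }
    assert (Hi2 : (/ (INR n + 1) * (INR n + 1) = 1)%R) by (field; lra).
    assert (H0 := inv_sq_pos n).
    assert (Hh : (1 / 2 <= Cmod (v n))%R).
    { assert (H1 := Cmod_sub_le 1 (v n)). rewrite Cmod_1, Cmod_sub_sym in H1.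
      specialize (H n).
      assert (K * / (INR n + 1) ^ 2 <= 1 / 2)%R; [|lra]. nra. }
    replace (/ v n - 1) with ((1 - v n) / v n) by (field; auto).
    rewrite Cmod_div by auto. rewrite Cmod_sub_sym. specialize (H n).
    apply Rmult_le_reg_r with (Cmod (v n)); [lra|].
    unfold Rdiv. rewrite Rmult_assoc, Rinv_l, Rmult_1_r by lra.
    assert (0 <= K * / (INR n + 1) ^ 2)%R by (apply Rmult_le_pos; lra).
    nra. }
  destruct (cprod_cv _ _ HK') as [m Hm].
  assert (E : l * m = 1).
  { apply (Ccv_unique (fun n => cprod v n * cprod (fun k => / v k) n)).
    - now apply Ccv_mult.
    - apply Ccv_ext with (fun _ => RtoC 1); [|apply Ccv_const].
      intros n. induction n as [|n IH]; simpl; [ring|].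
      rewrite IH. field. auto. }
  intros ->. apply C1_nz. rewrite <- E. ring.
Qed.

(** With P_n the partial product, passing from n to n+1 adds P_n (v_n - 1 - x d_n) + x d_n (P_n - 1)
    to the error. Both pieces are O(x^2 / (n+1)^2), because P_n is bounded and P_n - 1 = O(x). The
    constant depends on K and D alone, so the bound survives the limit in n and can then be used to
    differentiate in x. *)
Lemma cprod_first_order (K D : R) : (0 <= K)%R -> (0 <= D)%R ->
  exists K', forall (x : R) (v d : nat -> C), (Rabs x <= 1)%R ->
  (forall n, (Cmod (v n - 1 - x * d n) <= K * x ^ 2 * / (INR n + 1) ^ 2)%R) ->
  (forall n, (Cmod (d n) <= D * / (INR n + 1) ^ 2)%R) ->
  forall n, (Cmod (cprod v n - 1 - x * csum d n) <= K' * x ^ 2)%R.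
Proof.
  intros HK HD. set (M := exp (2 * (K + D))). assert (HM := exp_pos (2 * (K + D))).
  fold M in HM.
  exists (2 * (M * K + 2 * M * (K + D) * D))%R. intros x v d Hx Hv Hd.
  assert (Hx2 : (x ^ 2 = Rabs x * Rabs x)%R).
  { rewrite <- Rabs_mult. rewrite Rabs_pos_eq; [ring|]. nra. }
  assert (Hx0 := Rabs_pos x).
  assert (Hv1 : forall n, (Cmod (v n - 1) <= ((K + D) * Rabs x) * / (INR n + 1) ^ 2)%R).
  { intros n. assert (H := Cmod_sub_le (v n - 1) (x * d n)).
    rewrite (Cmod_mult x), Cmod_R in H. specialize (Hv n). specialize (Hd n).
    assert (H0 := inv_sq_pos n). rewrite Hx2 in Hv.
    assert (Rabs x * Cmod (d n) <= Rabs x * (D * / (INR n + 1) ^ 2))%R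
      by (apply Rmult_le_compat_l; auto).
    assert (K * (Rabs x * Rabs x) * / (INR n + 1) ^ 2 <= K * Rabs x * / (INR n + 1) ^ 2)%R.
    { apply Rmult_le_compat_r; [lra|]. apply Rmult_le_compat_l; nra. }
    lra. }
  assert (Hv2 : forall n, (Cmod (v n - 1) <= (K + D) * / (INR n + 1) ^ 2)%R).
  { intros n. eapply Rle_trans; [apply Hv1|]. apply Rmult_le_compat_r.
    - left. apply inv_sq_pos.
    - nra. }
  assert (HP := cprod_bounded v _ Hv2). fold M in HP.
  assert (HP1 : forall n, (Cmod (cprod v n - 1) <= 2 * M * (K + D) * Rabs x)%R).
  { intros n.
    assert (Hq : (Cmod (cprod v n - 1) <=
      M * (K + D) * Rabs x * rsum (fun k => / (INR k + 1) ^ 2) n)%R).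
    { induction n as [|n IH].
      - simpl. replace (1 - 1) with (RtoC 0) by ring. rewrite Cmod_0. lra.
      - change (cprod v (S n)) with (cprod v n * v n).
        change (rsum (fun k => / (INR k + 1) ^ 2) (S n))%R with
          (rsum (fun k => / (INR k + 1) ^ 2) n + / (INR n + 1) ^ 2)%R.
        replace (cprod v n * v n - 1) with ((cprod v n - 1) + cprod v n * (v n - 1)) by ring.
        eapply Rle_trans; [apply Cmod_triangle|]. rewrite Cmod_mult.
        assert (Cmod (cprod v n) * Cmod (v n - 1)
          <= M * ((K + D) * Rabs x * / (INR n + 1) ^ 2))%R.
        { apply Rmult_le_compat; auto using Cmod_ge_0. }
        lra. }
    eapply Rle_trans; [exact Hq|]. assert (H1 := rsum_inv_sq_le n).
    assert (0 <= M * (K + D) * Rabs x)%R.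
    { apply Rmult_le_pos; auto. apply Rmult_le_pos; lra. }
    nra. }
  assert (Hc : (0 <= (M * K + 2 * M * (K + D) * D) * x ^ 2)%R).
  { apply Rmult_le_pos; [|nra]. apply Rplus_le_le_0_compat; [nra|].
    apply Rmult_le_pos; auto. apply Rmult_le_pos; lra. }
  intros n.
  assert (Hq : (Cmod (cprod v n - 1 - x * csum d n) <=
    (M * K + 2 * M * (K + D) * D) * x ^ 2 * rsum (fun k => / (INR k + 1) ^ 2) n)%R).
  { induction n as [|n IH].
    - simpl. replace (1 - 1 - x * 0) with (RtoC 0) by ring. rewrite Cmod_0. lra.
    - change (cprod v (S n)) with (cprod v n * v n).
      change (csum d (S n)) with (csum d n + d n).
      change (rsum (fun k => / (INR k + 1) ^ 2) (S n))%R with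
        (rsum (fun k => / (INR k + 1) ^ 2) n + / (INR n + 1) ^ 2)%R.
      replace (cprod v n * v n - 1 - x * (csum d n + d n)) with
        ((cprod v n - 1 - x * csum d n)
         + (cprod v n * (v n - 1 - x * d n) + x * d n * (cprod v n - 1))) by ring.
      eapply Rle_trans; [apply Cmod_triangle|].
      assert (H1 := Cmod_triangle (cprod v n * (v n - 1 - x * d n))
        (x * d n * (cprod v n - 1))).
      rewrite !Cmod_mult, Cmod_R in H1.
      assert (H2 : (Cmod (cprod v n) * Cmod (v n - 1 - x * d n)
        <= M * (K * x ^ 2 * / (INR n + 1) ^ 2))%R).
      { apply Rmult_le_compat; auto using Cmod_ge_0. }
      assert (H3 : (Rabs x * Cmod (d n) * Cmod (cprod v n - 1)
        <= (Rabs x * (D * / (INR n + 1) ^ 2)) * (2 * M * (K + D) * Rabs x))%R).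
      { apply Rmult_le_compat; auto using Cmod_ge_0.
        - apply Rmult_le_pos; auto using Cmod_ge_0.
        - apply Rmult_le_compat_l; auto. }
      replace (Rabs x * (D * / (INR n + 1) ^ 2) * (2 * M * (K + D) * Rabs x))%R
        with (2 * M * (K + D) * D * x ^ 2 * / (INR n + 1) ^ 2)%R in H3
        by (rewrite Hx2; ring).
      lra. }
  eapply Rle_trans; [exact Hq|]. assert (H1 := rsum_inv_sq_le n). nra.
Qed.

(** Applying 1 + u <= exp u at u and at -u gives u <= exp u - 1 <= u exp u. The next bound follows
    by inserting this once more. *)
Lemma exp_sub_1_le (u : R) : (Rabs (exp u - 1) <= Rabs u * exp (Rabs u))%R.
Proof.
  assert (H1 := exp_ineq1_le u). assert (H2 := exp_ineq1_le (- u)).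
  assert (H3 := exp_pos u).
  assert (H4 : (exp (- u) * exp u = 1)%R).
  { rewrite <- exp_plus. replace (- u + u)%R with 0%R by ring. apply exp_0. }
  assert (H5 : (exp u - 1 <= u * exp u)%R) by nra.
  destruct (Rle_dec 0 u) as [Hu|Hu].
  - rewrite (Rabs_pos_eq u) by auto. apply Rabs_le. split; nra.
  - rewrite (Rabs_left u) by lra. assert (H6 := exp_pos (- u)).
    assert (1 <= exp (- u))%R by lra. apply Rabs_le. split; nra.
Qed.

Lemma exp_sub_1_sub_le (u : R) : (Rabs (exp u - 1 - u) <= u ^ 2 * exp (Rabs u))%R.
Proof.
  assert (H1 := exp_ineq1_le u). assert (H2 := exp_ineq1_le (- u)).
  assert (H3 := exp_pos u).
  assert (H4 : (exp (- u) * exp u = 1)%R).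
  { rewrite <- exp_plus. replace (- u + u)%R with 0%R by ring. apply exp_0. }
  assert (H5 : (exp u - 1 - u <= u * (exp u - 1))%R) by nra.
  rewrite Rabs_pos_eq by lra. eapply Rle_trans; [exact H5|].
  eapply Rle_trans; [apply Rle_abs|]. rewrite Rabs_mult.
  replace (u ^ 2)%R with (Rabs u * Rabs u)%R.
  - assert (H := exp_sub_1_le u). assert (H6 := Rabs_pos u). nra.
  - rewrite <- Rabs_mult, Rabs_pos_eq; [ring|nra].
Qed.

Lemma Cexp_eq (z : C) : Cexp z = (exp (Re z) * cos (Im z), exp (Re z) * sin (Im z))%R.
Proof. unfold Cexp, Ci, Cmult, Cplus, RtoC; simpl. f_equal; ring. Qed.

Lemma Cmod_le_abs (x y : R) : (Cmod (x, y) <= Rabs x + Rabs y)%R.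
Proof.
  replace (x, y) with (RtoC x + Ci * RtoC y).
  - eapply Rle_trans; [apply Cmod_triangle|]. rewrite Cmod_mult, Cmod_Ci, !Cmod_R. lra.
  - unfold Ci, Cmult, Cplus, RtoC; simpl. f_equal; ring.
Qed.

Lemma abs_sin_le (v : R) : (Rabs (sin v) <= Rabs v)%R.
Proof.
  destruct (Req_dec v 0) as [->|Hv]; [rewrite sin_0; lra|].
  destruct (MVT_abs sin cos 0 v) as [c [Hc _]].
  { intros c _. apply derivable_pt_lim_sin. }
  rewrite sin_0, !Rminus_0_r in Hc. rewrite Hc.
  assert (H := COS_bound c). assert (Hc1 : (Rabs (cos c) <= 1)%R) by (apply Rabs_le; lra).
  assert (Hv0 := Rabs_pos v). nra.
Qed.

Lemma one_sub_cos_bounds (v : R) : (0 <= 1 - cos v <= v ^ 2)%R.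
Proof.
  replace v with (2 * (v / 2))%R at 1 2 by field. rewrite cos_2a_sin.
  assert (H := abs_sin_le (v / 2)). assert (H0 := Rabs_pos (sin (v / 2))).
  assert (H1 : (sin (v / 2) * sin (v / 2) <= (v / 2) * (v / 2))%R).
  { apply Rsqr_le_abs_1 in H. exact H. }
  nra.
Qed.

Lemma sin_sub_le (v : R) : (Rabs (sin v - v) <= v ^ 2 * exp (Rabs v))%R.
Proof.
  destruct (Req_dec v 0) as [->|Hv].
  { rewrite sin_0. replace (0 - 0)%R with 0%R by ring. rewrite Rabs_R0.
    rewrite pow_i by lia. lra. }
  destruct (MVT_abs (fun x => sin x - x)%R (fun x => cos x - 1)%R 0 v) as [c [Hc Hcv]].
  { intros c _. apply derivable_pt_lim_minus; [apply derivable_pt_lim_sin|apply derivable_pt_lim_id]. }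
  rewrite sin_0, !Rminus_0_r in Hc. rewrite Hc.
  assert (H := one_sub_cos_bounds c).
  assert (Hb : (Rabs (cos c - 1) <= c ^ 2)%R) by (apply Rabs_le; lra).
  assert (Hcv2 : (Rabs c <= Rabs v)%R).
  { unfold Rmin, Rmax in Hcv. destruct (Rle_dec 0 v).
    - rewrite !Rabs_pos_eq; lra.
    - rewrite !Rabs_left1; lra. }
  assert (He := exp_ineq1_le (Rabs v)).
  assert (Ev : (v ^ 2 = Rabs v * Rabs v)%R).
  { rewrite <- Rabs_mult, Rabs_pos_eq; [ring|nra]. }
  assert (Ec : (c ^ 2 = Rabs c * Rabs c)%R).
  { rewrite <- Rabs_mult, Rabs_pos_eq; [ring|nra]. }
  rewrite Ec in Hb. rewrite Ev. assert (H1 := Rabs_pos c). assert (H2 := Rabs_pos v).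
  assert (Hcc : (Rabs (cos c - 1) <= Rabs v * Rabs v)%R) by nra.
  assert (0 <= Rabs v * Rabs v)%R by nra.
  (* The mean value theorem gives |v|^3; the factor |v| is absorbed into exp |v|, so that the bound
     has the shape of those for the real exponential. *)
  apply Rle_trans with (Rabs v * Rabs v * Rabs v)%R; [|nra].
  apply Rmult_le_compat_r; auto.
Qed.

Lemma exp_le_exp (x y : R) : (x <= y)%R -> (exp x <= exp y)%R.
Proof.
  intros [H| ->]; [left; now apply exp_increasing|lra].
Qed.

(** The real and the imaginary part each split into two terms of size at most m^2 exp m, with m the
    modulus of w; the factor 5 covers the four of them. *)
Lemma Cexp_sub_1_sub_le (w : C) :
  (Cmod (Cexp w - 1 - w) <= 5 * Cmod w ^ 2 * exp (Cmod w))%R.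
Proof.
  destruct w as [u v]. set (m := Cmod (u, v)). rewrite Cexp_eq. simpl Re. simpl Im.
  assert (Hu : (Rabs u <= m)%R) by (apply (re_le_Cmod (u, v))).
  assert (Hv : (Rabs v <= m)%R) by (apply (im_le_Cmod (u, v))).
  unfold Cminus, Cplus, Copp, RtoC. simpl.
  eapply Rle_trans; [apply Cmod_le_abs|].
  replace (exp u * cos v + - (1) + - u)%R with
    ((exp u - 1 - u) + exp u * (cos v - 1))%R by ring.
  replace (exp u * sin v + - 0 + - v)%R with
    ((exp u - 1) * sin v + (sin v - v))%R by ring.
  assert (E1 := exp_sub_1_sub_le u). assert (E2 := exp_sub_1_le u).
  assert (E3 := one_sub_cos_bounds v). assert (E4 := abs_sin_le v).
  assert (E5 := sin_sub_le v).
  assert (Eu := exp_le_exp _ _ Hu). assert (Ev := exp_le_exp _ _ Hv).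
  assert (Eu' := exp_le_exp _ _ (Rle_trans _ _ _ (Rle_abs u) Hu)).
  assert (P0 := exp_pos u). assert (P1 := exp_pos (Rabs u)). assert (P2 := exp_pos m).
  assert (P3 := exp_pos (Rabs v)).
  assert (A0 := Rabs_pos u). assert (A1 := Rabs_pos v).
  assert (Su : (u ^ 2 <= m * m)%R).
  { replace (u ^ 2)%R with (Rabs u * Rabs u)%R; [nra|].
    rewrite <- Rabs_mult, Rabs_pos_eq; [ring|nra]. }
  assert (Sv : (v ^ 2 <= m * m)%R).
  { replace (v ^ 2)%R with (Rabs v * Rabs v)%R; [nra|].
    rewrite <- Rabs_mult, Rabs_pos_eq; [ring|nra]. }
  assert (Su0 := pow2_ge_0 u). assert (Sv0 := pow2_ge_0 v).
  assert (T1 := Rabs_triang (exp u - 1 - u) (exp u * (cos v - 1))).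
  assert (T2 := Rabs_triang ((exp u - 1) * sin v) (sin v - v)).
  rewrite Rabs_mult in T1, T2. rewrite (Rabs_pos_eq (exp u)) in T1 by lra.
  assert (B1 : (Rabs (cos v - 1) <= m * m)%R) by (apply Rabs_le; lra).
  assert (B2 : (Rabs (exp u - 1 - u) <= m * m * exp m)%R).
  { eapply Rle_trans; [exact E1|]. apply Rmult_le_compat; lra. }
  assert (B3 : (exp u * Rabs (cos v - 1) <= exp m * (m * m))%R).
  { apply Rmult_le_compat; auto using Rabs_pos; lra. }
  assert (B4 : (Rabs (exp u - 1) <= m * exp m)%R).
  { eapply Rle_trans; [exact E2|]. apply Rmult_le_compat; lra. }
  assert (B5 : (Rabs (exp u - 1) * Rabs (sin v) <= m * exp m * m)%R).
  { apply Rmult_le_compat; auto using Rabs_pos; lra. }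
  assert (B6 : (Rabs (sin v - v) <= m * m * exp m)%R).
  { eapply Rle_trans; [exact E5|]. apply Rmult_le_compat; lra. }
  assert (0 <= m * m * exp m)%R.
  { apply Rmult_le_pos; [nra|lra]. }
  lra.
Qed.

Lemma Cexp_0 : Cexp 0 = 1.
Proof.
  rewrite Cexp_eq. simpl. rewrite exp_0, cos_0, sin_0. unfold RtoC. f_equal; ring.
Qed.

Lemma Cexp_plus (z w : C) : Cexp (z + w) = Cexp z * Cexp w.
Proof.
  rewrite !Cexp_eq. destruct z as [x y], w as [u v]. unfold Cmult, Cplus; simpl.
  rewrite exp_plus, cos_plus, sin_plus. f_equal; ring.
Qed.

Lemma Cexp_neq_0 (z : C) : Cexp z <> 0.
Proof.
  intros H. apply C1_nz. rewrite <- Cexp_0.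
  replace (RtoC 0) with (z + - z) by ring. rewrite Cexp_plus, H. ring.
Qed.

Lemma Cexp_R (x : R) : Cexp (RtoC x) = RtoC (exp x).
Proof. rewrite Cexp_eq. simpl. rewrite cos_0, sin_0. unfold RtoC. f_equal; ring. Qed.

(** * The digamma function as a series *)

(** For large k the modulus is at least k - |z|, and the finitely many remaining values are nonzero.
    This linear lower bound is the form in which staying off the poles enters all later
    estimates. *)
Lemma Cmod_add_INR_ge (z : C) : (forall k : nat, z <> - RtoC (INR k)) ->
  exists d, (0 < d)%R /\ forall k, (d * (INR k + 1) <= Cmod (z + RtoC (INR k)))%R.
Proof.
  intros Hz.
  assert (Hp : forall k, (0 < Cmod (z + RtoC (INR k)))%R).
  { intros k. apply Cmod_gt_0. intros H. apply (Hz k).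
    replace z with ((z + RtoC (INR k)) - RtoC (INR k)) by ring. rewrite H. ring. }
  assert (H0 := Cmod_ge_0 z).
  destruct (nfloor_ex (2 * Cmod z)) as [N [_ HN]]; [lra|].
  destruct (bound_of_eventual_bound
    (* The ratio is at most 2 as soon as k >= 2|z| + 1; the inverse of the global bound on it serves
       as d. *)
    (fun k => (INR k + 1) / Cmod (z + RtoC (INR k)))%R (fun _ => 1%R) 2 (S (S N))) as [K [HK H]].
  - intros _. lra.
  - intros k Hk. apply le_INR in Hk. rewrite !S_INR in Hk.
    assert (H1 := Cmod_sub_le (RtoC (INR k)) (z + RtoC (INR k))).
    replace (RtoC (INR k) - (z + RtoC (INR k))) with (- z) in H1 by ring.
    rewrite Cmod_opp, Cmod_R, Rabs_pos_eq in H1 by apply pos_INR.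
    apply div_le_of_le_mul; [apply Hp|]. lra.
  - exists (/ K)%R. split; [now apply Rinv_0_lt_compat|]. intros k. specialize (H k).
    cbv beta in H. rewrite Rmult_1_r in H. apply le_mul_of_div_le in H; [|apply Hp].
    apply Rmult_le_reg_l with K; auto.
    replace (K * (/ K * (INR k + 1)))%R with (INR k + 1)%R by (field; lra). exact H.
Qed.

Lemma add_INR_neq_0 (z : C) (k : nat) :
  (forall k : nat, z <> - RtoC (INR k)) -> z + RtoC (INR k) <> 0.
Proof.
  intros Hz H. apply (Hz k).
  replace z with ((z + RtoC (INR k)) - RtoC (INR k)) by ring. rewrite H. ring.
Qed.

(** Increments of the logarithm, which spread the factor n^z over the factors of Gauss's product.
    [pred 0] is 0, so [dln 0] vanishes; with ln 0 = 0 so does [dln 1]. *)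
Definition dln (k : nat) : R := (ln (INR k) - ln (INR (pred k)))%R.

Lemma ln_le_sub_1 (x : R) : (0 < x)%R -> (ln x <= x - 1)%R.
Proof.
  intros Hx. assert (H := exp_ineq1_le (ln x)). rewrite exp_ln in H by auto. lra.
Qed.

(** For k >= 2 the increment lies between 1/k and 1/(k-1), hence within 1/(k-1) - 1/(k+1) of
    1/(k+1). The constant 6 makes 2/(x(x+2)) <= 6/(x+2)^2 valid from x = k - 1 = 1 on. *)
Lemma dln_close : exists K, (0 < K)%R /\
  forall k, (Rabs (dln k - / (INR k + 1)) <= K * / (INR k + 1) ^ 2)%R.
Proof.
  apply (bound_of_eventual_bound (fun k => Rabs (dln k - / (INR k + 1)))%R
    (fun k => / (INR k + 1) ^ 2)%R 6 2 inv_sq_pos).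
  intros k Hk. destruct k as [|k]; [lia|]. unfold dln. simpl pred.
  assert (Hk1 : (1 <= k)%nat) by lia. apply le_INR in Hk1. simpl in Hk1.
  rewrite S_INR. set (x := INR k) in *.
  assert (H1 : (ln (x + 1) - ln x <= / x)%R).
  { rewrite <- ln_div by lra. eapply Rle_trans; [apply ln_le_sub_1|].
    - apply Rdiv_lt_0_compat; lra.
    - right. field. lra. }
  assert (H2 : (/ (x + 1) <= ln (x + 1) - ln x)%R).
  { assert (ln x - ln (x + 1) <= - / (x + 1))%R; [|lra].
    rewrite <- ln_div by lra. eapply Rle_trans; [apply ln_le_sub_1|].
    - apply Rdiv_lt_0_compat; lra.
    - right. field. lra. }
  assert (H3 : (/ (x + 1 + 1) <= / (x + 1))%R) by (apply Rinv_le_contravar; lra).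
  rewrite Rabs_pos_eq by lra.
  apply Rle_trans with (/ x - / (x + 1 + 1))%R; [lra|].
  replace (/ x - / (x + 1 + 1))%R with (2 / (x * (x + 2)))%R by (field; lra).
  apply div_le_of_le_mul; [nra|].
  replace (6 * / (x + 1 + 1) ^ 2 * (x * (x + 2)))%R with (6 * x / (x + 2))%R by (field; lra).
  assert (H4 : (6 * x = 2 * (x + 2) + (4 * x - 4))%R) by ring.
  apply Rmult_le_reg_r with (x + 2)%R; [lra|].
  replace (6 * x / (x + 2) * (x + 2))%R with (6 * x)%R by (field; lra). lra.
Qed.

Lemma inv_sq_le_inv (k : nat) : (/ (INR k + 1) ^ 2 <= / (INR k + 1))%R.
Proof. assert (H := pos_INR k). apply Rinv_le_contravar; nra. Qed.

Lemma dln_bound : exists K, (0 < K)%R /\ forall k, (Rabs (dln k) <= K * / (INR k + 1))%R.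
Proof.
  destruct dln_close as [K [HK H]]. exists (K + 1)%R. split; [lra|]. intros k.
  specialize (H k). assert (H1 := inv_sq_le_inv k).
  replace (dln k) with ((dln k - / (INR k + 1)) + / (INR k + 1))%R by ring.
  eapply Rle_trans; [apply Rabs_triang|].
  assert (Hk := pos_INR k).
  assert (0 < / (INR k + 1))%R by (apply Rinv_0_lt_compat; lra).
  rewrite (Rabs_pos_eq (/ (INR k + 1))) by lra. nra.
Qed.

(* [ln 0] is [0] by convention. *)
Lemma csum_dln (n : nat) : csum (fun k => RtoC (dln k)) (S n) = RtoC (ln (INR n)).
Proof.
  induction n as [|n IH].
  - simpl. unfold dln. simpl.
    assert (H : ln 0 = 0%R).
    { unfold ln. destruct (Rlt_dec 0 0); [exfalso; lra|easy]. }
    rewrite H. replace (0 - 0)%R with 0%R by ring. ring.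
  - change (csum (fun k => RtoC (dln k)) (S (S n))) with
      (csum (fun k => RtoC (dln k)) (S n) + RtoC (dln (S n))).
    rewrite IH. unfold dln. simpl pred. rewrite RtoC_minus. ring.
Qed.

(** The k-th factor k/(z+k) of Gauss's product times (k/(k-1))^z. The maximum turns the numerator
    into 1 at k = 0, where only 1/z is wanted. *)
Definition gamma_factor (z : C) (k : nat) : C :=
  Cexp (z * RtoC (dln k)) * RtoC (INR (Nat.max 1 k)) / (z + RtoC (INR k)).

Lemma RtoC_INR_S (n : nat) : RtoC (INR (S n)) = RtoC (INR n) + 1.
Proof. now rewrite S_INR, RtoC_plus. Qed.

Lemma pochhammer_neq_0 (z : C) (n : nat) :
  (forall k : nat, z <> - RtoC (INR k)) -> pochhammer z n <> 0.
Proof.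
  intros Hz. induction n as [|n IH]; [exact C1_nz|].
  apply Cmult_neq_0; auto. now apply add_INR_neq_0.
Qed.

Lemma gamma_seq_eq_cprod (z : C) (n : nat) : (forall k : nat, z <> - RtoC (INR k)) ->
  gamma_seq z n = cprod (gamma_factor z) (S n).
Proof.
  intros Hz.
  assert (H : cprod (gamma_factor z) (S n) = RtoC (INR (fact n)) *
    Cexp (z * csum (fun k => RtoC (dln k)) (S n)) / pochhammer z (S n)).
  { induction n as [|n IH].
    - assert (Hz0 := add_INR_neq_0 z 0 Hz). simpl in *. unfold gamma_factor. simpl.
      replace (0 + RtoC (dln 0)) with (RtoC (dln 0)) by ring. rewrite Cplus_0_r in *. field. exact Hz0.
    - change (cprod (gamma_factor z) (S (S n))) with
        (cprod (gamma_factor z) (S n) * gamma_factor z (S n)).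
      rewrite IH.
      change (csum (fun k => RtoC (dln k)) (S (S n))) with
        (csum (fun k => RtoC (dln k)) (S n) + RtoC (dln (S n))).
      change (pochhammer z (S (S n))) with (pochhammer z (S n) * (z + RtoC (INR (S n)))).
      rewrite Cmult_plus_distr_l, Cexp_plus. unfold gamma_factor.
      replace (Nat.max 1 (S n)) with (S n) by lia.
      rewrite fact_simpl, mult_INR, RtoC_mult.
      field. split; [now apply add_INR_neq_0|now apply pochhammer_neq_0]. }
  rewrite H, csum_dln. reflexivity.
Qed.

Lemma gamma_factor_neq_0 (z : C) (k : nat) : (forall k : nat, z <> - RtoC (INR k)) ->
  gamma_factor z k <> 0.
Proof.
  intros Hz H. unfold gamma_factor in H.
  assert (H1 := add_INR_neq_0 z k Hz).
  assert (H2 : Cexp (z * RtoC (dln k)) * RtoC (INR (Nat.max 1 k)) <> 0).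
  { apply Cmult_neq_0; [apply Cexp_neq_0|]. intros E. apply RtoC_inj in E.
    apply (INR_eq _ 0) in E. lia. }
  apply H2. replace (Cexp (z * RtoC (dln k)) * RtoC (INR (Nat.max 1 k))) with
    (Cexp (z * RtoC (dln k)) * RtoC (INR (Nat.max 1 k)) / (z + RtoC (INR k)) * (z + RtoC (INR k)))
    by (field; auto).
  rewrite H. ring.
Qed.

(** With l = [dln k] and w = z l, the difference from 1 equals (k (exp w - 1 - w) + z (k l - 1)) /
    (z + k). The numerator is O(1/k) by the quadratic remainder of the exponential and by l =
    1/(k+1) + O(1/k^2); the denominator supplies the second power. *)
Lemma gamma_factor_close (z : C) : (forall k : nat, z <> - RtoC (INR k)) ->
  exists K, forall k, (Cmod (gamma_factor z k - 1) <= K * / (INR k + 1) ^ 2)%R.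
Proof.
  intros Hz. destruct (Cmod_add_INR_ge z Hz) as [d [Hd Hdk]].
  destruct dln_close as [K1 [HK1 H1]]. destruct dln_bound as [K2 [HK2 H2]].
  assert (Hz0 := Cmod_ge_0 z).
  set (m := (Cmod z * K2)%R). assert (Hm : (0 <= m)%R) by (apply Rmult_le_pos; lra).
  set (K3 := (5 * m ^ 2 * exp m + Cmod z * (K1 + K2))%R).
  destruct (bound_of_eventual_bound (fun k => Cmod (gamma_factor z k - 1))
    (fun k => / (INR k + 1) ^ 2)%R (K3 / d) 1 inv_sq_pos) as [K [_ HK]]; [|exists K; exact HK].
  intros k Hk. cbv beta. unfold gamma_factor. replace (Nat.max 1 k) with k by lia.
  assert (Hzk := add_INR_neq_0 z k Hz).
  set (l := dln k) in *. set (w := z * RtoC l).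
  replace (Cexp w * RtoC (INR k) / (z + RtoC (INR k)) - 1) with
    ((RtoC (INR k) * (Cexp w - 1 - w) + z * RtoC (INR k * l - 1)) / (z + RtoC (INR k)))
    by (unfold w; rewrite RtoC_minus, RtoC_mult; field; auto).
  rewrite Cmod_div by auto.
  specialize (H1 k). specialize (H2 k). specialize (Hdk k).
  fold l in H1, H2. assert (Hk0 := pos_INR k). set (x := INR k) in *.
  set (i := (/ (x + 1))%R) in *.
  assert (Hi : (0 < i)%R) by (apply Rinv_0_lt_compat; lra).
  assert (Hxi : ((x + 1) * i = 1)%R) by (unfold i; field; lra).
  assert (Hi2 : (/ (x + 1) ^ 2 = i ^ 2)%R) by (unfold i; field; lra).
  rewrite Hi2 in *.
  assert (Hw : (Cmod w <= m * i)%R).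
  { unfold w, m. rewrite Cmod_mult, Cmod_R, Rmult_assoc.
    apply Rmult_le_compat_l; auto. }
  assert (Hi1 : (i <= 1)%R) by nra.
  assert (Hw1 : (Cmod w <= m)%R) by nra.
  assert (Hw0 := Cmod_ge_0 w).
  assert (HE : (Cmod (Cexp w - 1 - w) <= 5 * (m ^ 2 * i ^ 2) * exp m)%R).
  { eapply Rle_trans; [apply Cexp_sub_1_sub_le|].
    apply Rmult_le_compat; [nra|left; apply exp_pos| |now apply exp_le_exp].
    apply Rmult_le_compat_l; [lra|].
    replace (m ^ 2 * i ^ 2)%R with ((m * i) ^ 2)%R by ring. now apply pow_incr. }
  assert (HL : (Rabs (x * l - 1) <= (K1 + K2) * i)%R).
  { replace (x * l - 1)%R with ((x + 1) * (l - i) + - l)%R.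
    2:{ rewrite Rmult_minus_distr_l, Hxi. ring. }
    eapply Rle_trans; [apply Rabs_triang|]. rewrite Rabs_Ropp, Rabs_mult.
    rewrite (Rabs_pos_eq (x + 1)) by lra.
    assert ((x + 1) * Rabs (l - i) <= (x + 1) * (K1 * i ^ 2))%R
      by (apply Rmult_le_compat_l; lra).
    replace ((x + 1) * (K1 * i ^ 2))%R with (K1 * i * ((x + 1) * i))%R in * by ring.
    rewrite Hxi in *. lra. }
  assert (HN : (Cmod (RtoC x * (Cexp w - 1 - w) + z * RtoC (x * l - 1)) <= K3 * i)%R).
  { eapply Rle_trans; [apply Cmod_triangle|]. rewrite !Cmod_mult, !Cmod_R.
    rewrite (Rabs_pos_eq x) by lra. unfold K3.
    assert (Hx1 : (x * i <= 1)%R) by nra.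
    assert (G1 : (x * Cmod (Cexp w - 1 - w) <= 5 * m ^ 2 * exp m * i)%R).
    { apply Rle_trans with (x * (5 * (m ^ 2 * i ^ 2) * exp m))%R.
      - apply Rmult_le_compat_l; auto.
      - replace (x * (5 * (m ^ 2 * i ^ 2) * exp m))%R with
          (5 * m ^ 2 * exp m * i * (x * i))%R by ring.
        assert (0 <= 5 * m ^ 2 * exp m * i)%R.
        { assert (He := exp_pos m). apply Rmult_le_pos; [|lra].
          apply Rmult_le_pos; [|lra]. nra. }
        nra. }
    assert (G2 : (Cmod z * Rabs (x * l - 1) <= Cmod z * ((K1 + K2) * i))%R)
      by (apply Rmult_le_compat_l; auto).
    lra. }
  assert (Hp : (0 < Cmod (z + RtoC x))%R) by (now apply Cmod_gt_0).
  apply div_le_of_le_mul; [exact Hp|]. eapply Rle_trans; [exact HN|].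
  assert (HK3 : (0 <= K3)%R).
  { unfold K3. assert (He := exp_pos m). apply Rplus_le_le_0_compat.
    - apply Rmult_le_pos; [nra|lra].
    - apply Rmult_le_pos; lra. }
  replace (K3 * i)%R with (K3 / d * i ^ 2 * (d * (x + 1)))%R.
  - apply Rmult_le_compat_l; [|exact Hdk]. apply Rmult_le_pos; [|nra].
    apply Rmult_le_pos; [lra|]. left. now apply Rinv_0_lt_compat.
  - unfold i. field. split; lra.
Qed.

Lemma gamma_seq_cv (z : C) : (forall k : nat, z <> - RtoC (INR k)) ->
  Gamma z <> 0 /\ Ccv (gamma_seq z) (Gamma z).
Proof.
  intros Hz. destruct (gamma_factor_close z Hz) as [K HK].
  destruct (cprod_cv_neq_0 _ K HK) as [l [Hl0 Hl]].
  { intros k. now apply gamma_factor_neq_0. }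
  assert (H : Ccv (gamma_seq z) l).
  { apply Ccv_incr in Hl. eapply Ccv_ext; [|exact Hl].
    intros n. symmetry. now apply gamma_seq_eq_cprod. }
  change (Gamma z) with (Clim (gamma_seq z)).
  rewrite (Clim_unique _ _ H). now split.
Qed.

(** [C_derive] is a limit along real increments taken in each component, so a quadratic error bound
    for real h determines it. *)
Lemma C_derive_of_first_order (f : C -> C) (z D : C) (K delta : R) : (0 < delta)%R ->
  (forall h : R, (Rabs h < delta)%R ->
    (Cmod (f (z + RtoC h)%C - f z - RtoC h * D) <= K * h ^ 2)%R) ->
  C_derive f z = D.
Proof.
  intros Hdelta H.
  assert (HK : (0 <= K)%R).
  { assert (H1 := H (delta / 2)%R). assert (H2 := Cmod_ge_0 (f (z + RtoC (delta / 2)) - f z - RtoC (delta / 2) * D)).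
    rewrite Rabs_pos_eq in H1 by lra. specialize (H1 ltac:(lra)).
    assert (H3 : (0 < (delta / 2) ^ 2)%R) by (apply pow_lt; lra). nra. }
  assert (Hq : forall x : R, (Rabs (x - fst z) < delta)%R -> x <> fst z ->
    (Cmod ((f (x, snd z) - f z) / ((x, snd z) - z) - D) <= K * Rabs (x - fst z))%R).
  { intros x Hx Hne. set (h := (x - fst z)%R) in *.
    assert (Ez : (x, snd z) = z + RtoC h).
    { unfold h, Cplus, RtoC. simpl. f_equal; ring. }
    assert (Hh : h <> 0%R) by (unfold h; lra).
    assert (HhC : RtoC h <> 0) by (intros E; apply RtoC_inj in E; auto).
    rewrite Ez.
    replace ((f (z + RtoC h) - f z) / (z + RtoC h - z) - D) with
      ((f (z + RtoC h) - f z - RtoC h * D) / RtoC h).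
    2:{ replace (z + RtoC h - z) with (RtoC h) by ring. field. auto. }
    rewrite Cmod_div, Cmod_R by auto.
    assert (Hp : (0 < Rabs h)%R) by (now apply Rabs_pos_lt).
    apply div_le_of_le_mul; auto. specialize (H h Hx).
    replace (K * Rabs h * Rabs h)%R with (K * h ^ 2)%R; auto.
    rewrite Rmult_assoc, <- Rabs_mult, Rabs_pos_eq; [ring|nra]. }
  assert (Hlim : forall (p : C -> R) , (forall u v, Rabs (p u - p v) <= Cmod (u - v))%R ->
    is_lim (fun x => p ((f (x, snd z) - f z) / ((x, snd z) - z))) (fst z) (p D)).
  { intros p Hp. apply is_lim_spec. intros eps.
    assert (He : (0 < Rmin delta (eps / (K + 1)))%R).
    { apply Rmin_pos; auto. apply Rdiv_lt_0_compat; [apply cond_pos|lra]. }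
    exists (mkposreal _ He). intros x Hx Hne. change (Rabs (x - fst z) < Rmin delta (eps / (K + 1)))%R in Hx.
    eapply Rle_lt_trans; [apply Hp|]. eapply Rle_lt_trans; [apply Hq; auto|].
    - eapply Rlt_le_trans; [exact Hx|apply Rmin_l].
    - assert (Hx2 : (Rabs (x - fst z) < eps / (K + 1))%R)
        by (eapply Rlt_le_trans; [exact Hx|apply Rmin_r]).
      apply Rlt_div_r in Hx2; [|lra]. assert (H0 := Rabs_pos (x - fst z)). nra. }
  unfold C_derive, C_lim.
  rewrite (is_lim_unique _ _ _ (Hlim fst (fun u v => re_le_Cmod (u - v)))).
  rewrite (is_lim_unique _ _ _ (Hlim snd (fun u v => im_le_Cmod (u - v)))).
  now destruct D.
Qed.

Lemma inv_add_INR_bound (z : C) (d : R) (k : nat) : (0 < d)%R ->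
  (d * (INR k + 1) <= Cmod (z + RtoC (INR k)))%R ->
  (Cmod (/ (z + RtoC (INR k))) <= / d * / (INR k + 1))%R.
Proof.
  intros Hd H. assert (Hk := pos_INR k).
  assert (Hp : (0 < d * (INR k + 1))%R) by (apply Rmult_lt_0_compat; lra).
  rewrite Cmod_inv.
  - rewrite <- Rinv_mult. now apply Rinv_le_contravar.
  - apply Cmod_gt_0. lra.
Qed.

(** The term splits as (l - 1/(k+1)) + (z - 1) / ((z + k)(k + 1)) with l = [dln k], and both parts
    are O(1/k^2). *)
Lemma digamma_term_close (z : C) : (forall k : nat, z <> - RtoC (INR k)) ->
  exists D, (0 <= D)%R /\ forall k,
    (Cmod (RtoC (dln k) - / (z + RtoC (INR k))) <= D * / (INR k + 1) ^ 2)%R.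
Proof.
  intros Hz. destruct (Cmod_add_INR_ge z Hz) as [d [Hd Hdk]].
  destruct dln_close as [K1 [HK1 H1]].
  exists (K1 + Cmod (z - 1) * / d)%R.
  assert (Hd' : (0 < / d)%R) by (now apply Rinv_0_lt_compat).
  assert (Hz1 := Cmod_ge_0 (z - 1)). split; [nra|].
  intros k. assert (Hk := pos_INR k). assert (Hzk := add_INR_neq_0 z k Hz).
  assert (Hk1 : RtoC (INR k) + 1 <> 0).
  { rewrite <- RtoC_INR_S. intros E. apply RtoC_inj in E. apply (not_0_INR (S k)); auto. }
  replace (RtoC (dln k) - / (z + RtoC (INR k))) with
    (RtoC (dln k - / (INR k + 1)) + (z - 1) * / (z + RtoC (INR k)) * RtoC (/ (INR k + 1))).
  2:{ rewrite RtoC_minus, RtoC_inv, RtoC_plus by lra. field. auto. }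
  eapply Rle_trans; [apply Cmod_triangle|]. rewrite !Cmod_mult, !Cmod_R.
  rewrite Rmult_plus_distr_r. apply Rplus_le_compat; [apply H1|].
  assert (Hi : (0 < / (INR k + 1))%R) by (apply Rinv_0_lt_compat; lra).
  rewrite (Rabs_pos_eq (/ (INR k + 1))) by lra.
  replace (/ (INR k + 1) ^ 2)%R with (/ (INR k + 1) * / (INR k + 1))%R by (field; lra).
  rewrite <- !Rmult_assoc. apply Rmult_le_compat_r; [lra|].
  rewrite Rmult_assoc. apply Rmult_le_compat_l; auto. now apply inv_add_INR_bound.
Qed.

(* The product for [Gamma (z + x) / Gamma z] has factors [1 + x d_k + O(x^2 / k^2)]
   uniformly in [k], where [d_k] are the terms below. *)
Lemma digamma_cv (z : C) : (forall k : nat, z <> - RtoC (INR k)) ->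
  Ccv (csum (fun k => RtoC (dln k) - / (z + RtoC (INR k)))) (digamma z).
Proof.
  intros Hz. destruct (Cmod_add_INR_ge z Hz) as [d [Hd Hdk]].
  destruct dln_bound as [K2 [HK2 H2]].
  destruct (digamma_term_close z Hz) as [D [HD HDk]].
  set (dd := fun k => RtoC (dln k) - / (z + RtoC (INR k))) in *.
  (* The quadratic constant for the factors: [K2 ^ 2 * exp K2] bounds the exponential remainder and
     [D / d] the cross term. Division by a modulus of at least 1/2 doubles them; the 10 leaves
     room. *)
  assert (HK : (0 <= 10 * K2 ^ 2 * exp K2 + 2 * D / d)%R).
  { assert (He := exp_pos K2). assert (Hd' : (0 < / d)%R) by (now apply Rinv_0_lt_compat).
    unfold Rdiv. nra. }
  destruct (cprod_first_order _ D HK HD) as [K' HK'].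
  destruct (csum_abs_cv dd (2 * D)) as [L [HL _]].
  { intros n. eapply Rle_trans; [apply rsum_le; intros k _; apply HDk|].
    rewrite rsum_scal. assert (H := rsum_inv_sq_le n). nra. }
  set (v := fun (x : R) k => Cexp (RtoC (x * dln k)) * (z + RtoC (INR k)) / (z + RtoC x + RtoC (INR k))).
  (* The bound d/2 keeps x/(z+k) within 1/2 for every k, so z + x stays off the poles as well; the
     bound 1 is the range of the product expansion. *)
  set (delta := Rmin 1 (d / 2)).
  assert (Hdelta : (0 < delta)%R) by (apply Rmin_pos; lra).
  assert (Hshift : forall x, (Rabs x < delta)%R -> forall k,
    (1 / 2 <= Cmod (1 + RtoC x * / (z + RtoC (INR k))))%R).
  { intros x Hx k. assert (Hx2 : (Rabs x < d / 2)%R)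
      by (eapply Rlt_le_trans; [exact Hx|apply Rmin_r]).
    assert (Hz1 := inv_add_INR_bound z d k Hd (Hdk k)).
    assert (Hk := pos_INR k). assert (Hi : (/ (INR k + 1) <= 1)%R).
    { rewrite <- Rinv_1. apply Rinv_le_contravar; lra. }
    assert (Hd' : (0 < / d)%R) by (now apply Rinv_0_lt_compat).
    assert (Hm : (Cmod (RtoC x * / (z + RtoC (INR k))) <= 1 / 2)%R).
    { rewrite Cmod_mult, Cmod_R.
      apply Rle_trans with (d / 2 * / d)%R; [|right; field; lra].
      apply Rmult_le_compat; auto using Rabs_pos, Cmod_ge_0; [lra|]. nra. }
    assert (H := Cmod_sub_le 1 (1 + RtoC x * / (z + RtoC (INR k)))).
    replace (1 - (1 + RtoC x * / (z + RtoC (INR k)))) with (- (RtoC x * / (z + RtoC (INR k)))) in H by ring.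
    rewrite Cmod_opp, Cmod_1 in H. lra. }
  assert (Hzx : forall x, (Rabs x < delta)%R -> forall k : nat, z + RtoC x <> - RtoC (INR k)).
  { intros x Hx k E. assert (Hzk := add_INR_neq_0 z k Hz). specialize (Hshift x Hx k).
    replace (1 + RtoC x * / (z + RtoC (INR k))) with (RtoC 0) in Hshift.
    - rewrite Cmod_0 in Hshift. lra.
    - replace (RtoC x) with (- RtoC (INR k) - z) by (rewrite <- E; ring). field. auto. }
  assert (Hv : forall x, (Rabs x < delta)%R -> forall n,
    (Cmod (cprod (v x) n - 1 - RtoC x * csum dd n) <= K' * x ^ 2)%R).
  { intros x Hx. assert (Hx1 : (Rabs x <= 1)%R).
    { left. eapply Rlt_le_trans; [exact Hx|apply Rmin_l]. }
    apply HK'; auto. intros k.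
    assert (Hzk := add_INR_neq_0 z k Hz). specialize (Hshift x Hx k).
    specialize (HDk k). specialize (H2 k).
    set (zeta := / (z + RtoC (INR k))) in *.
    assert (Hsn : 1 + RtoC x * zeta <> 0) by (apply Cmod_gt_0; lra).
    assert (Ezk : z + RtoC (INR k) = / zeta) by (unfold zeta; field; auto).
    assert (Hzeta : zeta <> 0).
    { intros E. assert (E2 : zeta * (z + RtoC (INR k)) = 1) by (unfold zeta; field; auto).
      rewrite E in E2. apply C1_nz. rewrite <- E2. ring. }
    set (l := dln k) in *. set (u := (x * l)%R) in *.
    (* With zeta = 1/(z+k) the factor is exp u / (1 + x zeta), and subtracting 1 + x (l - zeta)
       leaves exactly second-order quantities over the same denominator. *)
    replace (v x k - 1 - RtoC x * dd k) with
      ((RtoC (exp u - 1 - u) - RtoC (x ^ 2) * zeta * (RtoC l - zeta)) / (1 + RtoC x * zeta)).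
    2:{ unfold v, dd. fold l u zeta. rewrite Cexp_R.
        replace (z + RtoC x + RtoC (INR k)) with (/ zeta + RtoC x) by (rewrite <- Ezk; ring).
        rewrite Ezk. unfold u. rewrite !RtoC_minus, RtoC_pow, RtoC_mult. field.
        repeat split; auto. }
    rewrite Cmod_div by auto. apply div_le_of_le_mul; [lra|].
    assert (Hk := pos_INR k). set (i := (/ (INR k + 1))%R) in *.
    assert (Hi : (0 < i)%R) by (apply Rinv_0_lt_compat; lra).
    assert (Hi1 : (i <= 1)%R).
    { unfold i. rewrite <- Rinv_1. apply Rinv_le_contravar; lra. }
    assert (Hi2 : (/ (INR k + 1) ^ 2 = i ^ 2)%R) by (unfold i; field; lra).
    rewrite Hi2 in *.
    assert (Hzb := inv_add_INR_bound z d k Hd (Hdk k)). fold zeta i in Hzb.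
    assert (Hd' : (0 < / d)%R) by (now apply Rinv_0_lt_compat).
    assert (Hx0 := Rabs_pos x). assert (Hl0 := Rabs_pos l).
    assert (Hu : (Rabs u <= K2)%R).
    { unfold u. rewrite Rabs_mult. nra. }
    assert (Hu2 : (u ^ 2 <= x ^ 2 * (K2 ^ 2 * i ^ 2))%R).
    { unfold u. rewrite Rpow_mult_distr. apply Rmult_le_compat_l; [nra|].
      rewrite <- Rpow_mult_distr, <- (pow2_abs l). apply pow_incr. lra. }
    assert (E1 : (Rabs (exp u - 1 - u) <= x ^ 2 * (K2 ^ 2 * i ^ 2) * exp K2)%R).
    { eapply Rle_trans; [apply exp_sub_1_sub_le|].
      apply Rmult_le_compat; auto; [nra|left; apply exp_pos|now apply exp_le_exp]. }
    assert (E2 : (Cmod (RtoC (x ^ 2) * zeta * (RtoC l - zeta)) <= x ^ 2 * / d * (D * i ^ 2))%R).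
    { rewrite !Cmod_mult, Cmod_R, Rabs_pos_eq by nra.
      apply Rmult_le_compat; auto using Cmod_ge_0.
      - apply Rmult_le_pos; [nra|apply Cmod_ge_0].
      - apply Rmult_le_compat_l; [nra|]. nra. }
    eapply Rle_trans; [apply Cmod_minus_le|]. rewrite Cmod_R.
    apply Rle_trans with ((10 * K2 ^ 2 * exp K2 + 2 * D / d) * x ^ 2 * i ^ 2 * (1 / 2))%R.
    - assert (0 <= x ^ 2 * (K2 ^ 2 * i ^ 2) * exp K2)%R.
      { apply Rmult_le_pos; [|left; apply exp_pos]. apply Rmult_le_pos; [nra|].
        apply Rmult_le_pos; nra. }
      unfold Rdiv. lra.
    - apply Rmult_le_compat_l; auto. apply Rmult_le_pos; [apply Rmult_le_pos; [exact HK|]|]; nra. }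
  destruct (gamma_seq_cv z Hz) as [HG0 HG].
  assert (Hder : C_derive Gamma z = Gamma z * L).
  { apply (C_derive_of_first_order _ _ _ (Cmod (Gamma z) * K') delta Hdelta).
    intros x Hx. destruct (gamma_seq_cv _ (Hzx x Hx)) as [_ HGx].
    assert (Hfac : forall n, gamma_seq (z + RtoC x) n = gamma_seq z n * cprod (v x) (S n)).
    { intros n. rewrite !gamma_seq_eq_cprod by auto.
      generalize (S n). intros m. induction m as [|m IH]; simpl; [ring|].
      rewrite IH. unfold gamma_factor, v.
      replace ((z + RtoC x) * RtoC (dln m)) with (z * RtoC (dln m) + RtoC (x * dln m))
        by (rewrite RtoC_mult; ring).
      rewrite Cexp_plus. field. split; apply add_INR_neq_0; auto. }
    assert (Hlim : Ccv (fun n => gamma_seq (z + RtoC x) n - gamma_seq z n -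
      RtoC x * (gamma_seq z n * csum dd (S n)))
      (Gamma (z + RtoC x) - Gamma z - RtoC x * (Gamma z * L))).
    { apply Ccv_minus; [now apply Ccv_minus|]. apply Ccv_scal. apply Ccv_mult; auto.
      now apply (Ccv_incr (csum dd)). }
    (* The quadratic bound has a constant independent of n, so it passes to the limit and becomes
       one for [Gamma] itself. *)
    apply (is_lim_seq_le
      (fun n => Cmod (gamma_seq (z + RtoC x) n - gamma_seq z n -
        RtoC x * (gamma_seq z n * csum dd (S n))))
      (fun n => Cmod (gamma_seq z n) * (K' * x ^ 2))%R
      (Cmod (Gamma (z + RtoC x) - Gamma z - RtoC x * (Gamma z * L)))
      (Cmod (Gamma z) * K' * x ^ 2)%R).
    - intros n. rewrite Hfac.
      replace (gamma_seq z n * cprod (v x) (S n) - gamma_seq z n - RtoC x * (gamma_seq z n * csum dd (S n)))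
        with (gamma_seq z n * (cprod (v x) (S n) - 1 - RtoC x * csum dd (S n))) by ring.
      rewrite Cmod_mult. apply Rmult_le_compat_l; auto using Cmod_ge_0.
    - now apply Ccv_Cmod.
    - replace (Finite (Cmod (Gamma z) * K' * x ^ 2)) with (Finite (Cmod (Gamma z) * (K' * x ^ 2)))
        by (f_equal; ring).
      apply is_lim_seq_mult'; [|apply is_lim_seq_const].
      now apply Ccv_Cmod. }
  unfold digamma. rewrite Hder. replace (Gamma z * L / Gamma z) with L by (field; auto).
  exact HL.
Qed.

(** * The cosine product *)

(* For f(t) = cos(2xt), whose second derivative is -4x^2 f, integrating by parts
   twice gives (n^2 - 4x^2) I_n = n(n-1) I_(n-2), from which the product unrolls. *)
Definition cos_moment (f : R -> R) (n : nat) : R :=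
  RInt (fun t => f t * cos t ^ n)%R 0 (PI / 2).

Lemma continuous_cos_pow (n : nat) (t : R) : continuous (fun t => cos t ^ n)%R t.
Proof.
  apply (ex_derive_continuous (fun t => cos t ^ n)%R). auto_derive. auto.
Qed.

Lemma is_RInt_cos_moment (f : R -> R) (n : nat) :
  (forall t, continuous f t) ->
  is_RInt (fun t => f t * cos t ^ n)%R 0 (PI / 2) (cos_moment f n).
Proof.
  intros Hf. apply (RInt_correct (V := R_CompleteNormedModule)).
  apply (ex_RInt_continuous (V := R_CompleteNormedModule)). intros t _.
  apply (continuous_mult (K := R_AbsRing)); auto. apply continuous_cos_pow.
Qed.

Section Moments.

(** The equation f'' = -al f + be g admits a second function because the real and imaginary parts of
    cos (2xt) for complex x satisfy a coupled system, with al and be taken from 4x^2. The Wallis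
    integrals are the case f = 1, al = be = 0. *)
Variables (f f' g : R -> R) (al be : R).
Hypothesis Hf : forall t, is_derive f t (f' t).
Hypothesis Hf' : forall t, is_derive f' t (- al * f t + be * g t)%R.
Hypothesis Hg : forall t, continuous g t.
Hypothesis Hf'0 : f' 0%R = 0%R.

Let Hfc : forall t, continuous f t.
Proof. intros t. apply (ex_derive_continuous f). eexists. apply Hf. Qed.

Lemma cos_moment_rec (m : nat) : let n := S (S m) in
  (INR n * (INR n - 1) * cos_moment f m =
   (INR n ^ 2 - al) * cos_moment f n + be * cos_moment g n)%R.
Proof.
  intros n.
  (* The boundary expression f (cos^n)' - f' cos^n of the two integrations by parts. It vanishes at
     PI/2 through the cosine, and at 0 through the sine and f'(0) = 0. *)
  set (F := fun t => (f t * (- INR n * cos t ^ S m * sin t) - f' t * cos t ^ n)%R).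
  set (D := fun t => (INR n * (INR n - 1) * (f t * cos t ^ m) +
    (- (INR n ^ 2 - al) * (f t * cos t ^ n) + - be * (g t * cos t ^ n)))%R).
  assert (HF : forall t, is_derive F t (D t)).
  { intros t. unfold F. auto_derive.
    - repeat split; eexists; [apply Hf|apply Hf'].
    - rewrite (is_derive_unique _ _ _ (Hf t) : Derive (fun x => f x) t = f' t).
      rewrite (is_derive_unique _ _ _ (Hf' t) : Derive (fun x => f' x) t = (- al * f t + be * g t)%R).
      unfold D, n. simpl pred. rewrite !S_INR.
      assert (E : (sin t * sin t = 1 - cos t * cos t)%R).
      { assert (H := sin2_cos2 t). unfold Rsqr in H. lra. }
      (* The left side is [INR (S m)] in unfolded form. *)
      assert (EI : match m with O => 1%R | S _ => (INR m + 1)%R end = (INR m + 1)%R).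
      { destruct m; simpl; ring. }
      simpl pow. rewrite ?EI. set (c := cos t) in *. set (s := sin t) in *. set (cm := (c ^ m)%R).
      transitivity (f' t * (- (INR m + 1 + 1) * (c * cm) * s) + f t * (- (INR m + 1 + 1) * (c * cm) * c + (INR m + 1 + 1) * (INR m + 1) * cm * (s * s)) - (- al * f t + be * g t) * (c * (c * cm)) + f' t * ((INR m + 1 + 1) * (c * cm) * s))%R; [|rewrite E]; ring. }
  assert (H1 : is_RInt D 0 (PI / 2) (minus (F (PI / 2)%R) (F 0%R))).
  { apply (is_RInt_derive (V := R_CompleteNormedModule) F D); intros t _; auto.
    unfold D.
    assert (Hc : forall (u : R -> R) k, (forall t, continuous u t) -> continuous (fun t => u t * cos t ^ k)%R t).
    { intros u k Hu. apply (continuous_mult (K := R_AbsRing)); auto. apply continuous_cos_pow. }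
    repeat apply (continuous_plus (V := R_NormedModule));
    apply (continuous_scal_r (V := R_NormedModule)); auto. }
  assert (H2 : is_RInt D 0 (PI / 2) (INR n * (INR n - 1) * cos_moment f m +
    (- (INR n ^ 2 - al) * cos_moment f n + - be * cos_moment g n))%R).
  { unfold D. apply (is_RInt_plus (V := R_NormedModule));
      [|apply (is_RInt_plus (V := R_NormedModule))];
    apply (is_RInt_scal (V := R_NormedModule)); now apply is_RInt_cos_moment. }
  apply (is_RInt_unique (V := R_CompleteNormedModule)) in H1. apply (is_RInt_unique (V := R_CompleteNormedModule)) in H2. rewrite H1 in H2.
  assert (E0 : minus (F (PI / 2)%R) (F 0%R) = 0%R).
  { unfold minus, plus, opp, F; simpl. rewrite cos_PI2, sin_0, Hf'0. ring. }
  rewrite E0 in H2. lra.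
Qed.

(** For exponent 1 the derivative of the cosine is -1 at PI/2, so the boundary term there survives
    and brings in f(PI/2). For f = cos (2xt) this is the value cos (PI x) that the product is meant
    to represent. *)
Lemma cos_moment_1 :
  f (PI / 2)%R = ((1 - al) * cos_moment f 1 + be * cos_moment g 1)%R.
Proof.
  set (F := fun t => (f t * - sin t - f' t * cos t)%R).
  set (D := fun t => (- (1 - al) * (f t * cos t ^ 1) + - be * (g t * cos t ^ 1))%R).
  assert (HF : forall t, is_derive F t (D t)).
  { intros t. unfold F. auto_derive.
    - repeat split; eexists; [apply Hf|apply Hf'].
    - rewrite (is_derive_unique _ _ _ (Hf t) : Derive (fun x => f x) t = f' t).
      rewrite (is_derive_unique _ _ _ (Hf' t) : Derive (fun x => f' x) t = (- al * f t + be * g t)%R).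
      unfold D. ring. }
  assert (H1 : is_RInt D 0 (PI / 2) (minus (F (PI / 2)%R) (F 0%R))).
  { apply (is_RInt_derive (V := R_CompleteNormedModule) F D); intros t _; auto.
    unfold D.
    assert (Hc : forall (u : R -> R) k, (forall t, continuous u t) -> continuous (fun t => u t * cos t ^ k)%R t).
    { intros u k Hu. apply (continuous_mult (K := R_AbsRing)); auto. apply continuous_cos_pow. }
    apply (continuous_plus (V := R_NormedModule));
    apply (continuous_scal_r (V := R_NormedModule)); auto. }
  assert (H2 : is_RInt D 0 (PI / 2)
    (- (1 - al) * cos_moment f 1 + - be * cos_moment g 1)%R).
  { unfold D. apply (is_RInt_plus (V := R_NormedModule));
    apply (is_RInt_scal (V := R_NormedModule)); now apply is_RInt_cos_moment. }
  apply (is_RInt_unique (V := R_CompleteNormedModule)) in H1. apply (is_RInt_unique (V := R_CompleteNormedModule)) in H2. rewrite H1 in H2.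
  assert (E0 : minus (F (PI / 2)%R) (F 0%R) = (- f (PI / 2))%R).
  { unfold minus, plus, opp, F; simpl. rewrite cos_PI2, sin_PI2, sin_0, Hf'0. ring. }
  rewrite E0 in H2. lra.
Qed.

End Moments.

Definition wallis (n : nat) : R := cos_moment (fun _ => 1%R) n.

Lemma wallis_rec (m : nat) : ((INR m + 2) * wallis (S (S m)) = (INR m + 1) * wallis m)%R.
Proof.
  assert (H := cos_moment_rec (fun _ => 1%R) (fun _ => 0%R) (fun _ => 0%R) 0 0).
  simpl in H.
  assert (H1 := H (fun t => is_derive_const 1%R t)).
  assert (H2 : forall t : R, is_derive (fun _ : R => 0%R) t (- 0 * 1 + 0 * 0)%R).
  { intros t. replace (- 0 * 1 + 0 * 0)%R with 0%R by ring. exact (is_derive_const 0%R t). }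
  specialize (H1 H2 (fun t => continuous_const 0%R t) eq_refl m).
  fold (wallis m) in H1.
  change (INR (S (S m)) * (INR (S (S m)) - 1) * wallis m = (INR (S (S m)) ^ 2 - 0) * wallis (S (S m)) + 0 * cos_moment (fun _ => 0%R) (S (S m)))%R in H1.
  rewrite !S_INR in H1. assert (Hm := pos_INR m).
  apply Rmult_eq_reg_l with (INR m + 2)%R; lra.
Qed.

Lemma wallis_1 : wallis 1 = 1%R.
Proof.
  assert (H := cos_moment_1 (fun _ => 1%R) (fun _ => 0%R) (fun _ => 0%R) 0 0).
  assert (H1 := H (fun t => is_derive_const 1%R t)).
  assert (H2 : forall t : R, is_derive (fun _ : R => 0%R) t (- 0 * 1 + 0 * 0)%R).
  { intros t. replace (- 0 * 1 + 0 * 0)%R with 0%R by ring. exact (is_derive_const 0%R t). }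
  specialize (H1 H2 (fun t => continuous_const 0%R t) eq_refl).
  fold (wallis 1) in H1. lra.
Qed.

Lemma wallis_odd_pos (j : nat) : (0 < wallis (2 * j + 1))%R.
Proof.
  induction j as [|j IH]; [simpl; rewrite wallis_1; lra|].
  replace (2 * S j + 1)%nat with (S (S (2 * j + 1))) by lia.
  assert (H := wallis_rec (2 * j + 1)). assert (Hm := pos_INR (2 * j + 1)).
  apply Rmult_lt_reg_l with (INR (2 * j + 1) + 2)%R; [lra|]. rewrite H, Rmult_0_r.
  apply Rmult_lt_0_compat; lra.
Qed.

(** Up to PI/3 the derivative of the sine is at least 1/2; beyond it the sine is at least sqrt 3 / 2
    while t <= 2. This turns bounds in t^2 into bounds in sin^2 t, which integrate exactly against
    cos^n t. *)
Lemma le_3_mul_sin (t : R) : (0 <= t <= PI / 2)%R -> (t <= 3 * sin t)%R.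
Proof.
  intros [H0 H1].
  destruct (Rle_dec t (PI / 3)) as [Ht|Ht].
  - destruct (Req_dec t 0) as [->|Hne]; [rewrite sin_0; lra|].
    destruct (MVT_cor2 sin cos 0 t) as [c [Hc Hct]]; [lra|intros; apply derivable_pt_lim_sin|].
    rewrite sin_0, !Rminus_0_r in Hc. rewrite Hc.
    assert (cos (PI / 3) <= cos c)%R by (apply cos_decr_1; lra).
    rewrite cos_PI3 in *. nra.
  - assert (HPI := PI_4).
    assert (H : (sin (PI / 3) <= sin t)%R) by (apply sin_incr_1; lra).
    rewrite sin_PI3 in H.
    assert (Hs : (1 < sqrt 3)%R).
    { rewrite <- sqrt_1 at 1. apply sqrt_lt_1; lra. }
    assert (Hs2 : (sqrt 3 * sqrt 3 = 3)%R) by (apply sqrt_sqrt; lra).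
    assert (17 / 10 <= sqrt 3)%R by nra. lra.
Qed.

(** Since sin^2 = 1 - cos^2, the integral of sin^2 t cos^n t is [wallis n - wallis (S (S n))], which
    equals [wallis n / (n + 2)] by the recursion. The weight cos^n thus concentrates at t = 0, and a
    moment divided by [wallis n] tends to the value c there. *)
Lemma cos_moment_close (f : R -> R) (c K : R) (n : nat) :
  (forall t, continuous f t) ->
  (forall t, (0 <= t <= PI / 2)%R -> (Rabs (f t - c) <= K * sin t ^ 2)%R) ->
  (Rabs (cos_moment f n - c * wallis n) <= K * (wallis n / (INR n + 2)))%R.
Proof.
  intros Hf HK.
  assert (Hpi : (0 < PI / 2)%R) by (assert (H := PI_RGT_0); lra).
  assert (Hw := is_RInt_cos_moment (fun _ => 1%R)).
  assert (Hwc : forall n, is_RInt (fun t => 1 * cos t ^ n)%R 0 (PI / 2) (wallis n)).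
  { intros k. apply Hw. intros t. apply continuous_const. }
  assert (Hl : is_RInt (fun t => f t * cos t ^ n + - c * (1 * cos t ^ n))%R 0 (PI / 2)
    (cos_moment f n + - c * wallis n)%R).
  { apply (is_RInt_plus (V := R_NormedModule)); [now apply is_RInt_cos_moment|].
    now apply (is_RInt_scal (V := R_NormedModule)). }
  assert (Hr : is_RInt (fun t => K * (1 * cos t ^ n + - 1 * (1 * cos t ^ S (S n))))%R 0 (PI / 2)
    (K * (wallis n + - 1 * wallis (S (S n))))%R).
  { apply (is_RInt_scal (V := R_NormedModule)). apply (is_RInt_plus (V := R_NormedModule)); auto.
    now apply (is_RInt_scal (V := R_NormedModule)). }
  assert (Hpt : forall t, (0 <= t <= PI / 2)%R ->
    (norm (f t * cos t ^ n + - c * (1 * cos t ^ n))%R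
       <= K * (1 * cos t ^ n + - 1 * (1 * cos t ^ S (S n))))%R).
  { intros t Ht. change (Rabs (f t * cos t ^ n + - c * (1 * cos t ^ n)) <= K * (1 * cos t ^ n + - 1 * (1 * cos t ^ S (S n))))%R.
    replace (f t * cos t ^ n + - c * (1 * cos t ^ n))%R with ((f t - c) * cos t ^ n)%R by ring.
    assert (Hcos : (0 <= cos t)%R) by (apply cos_ge_0; lra).
    assert (Hp : (0 <= cos t ^ n)%R) by (now apply pow_le).
    rewrite Rabs_mult, (Rabs_pos_eq (cos t ^ n)) by auto.
    replace (K * (1 * cos t ^ n + - 1 * (1 * cos t ^ S (S n))))%R with
      (K * sin t ^ 2 * cos t ^ n)%R.
    - apply Rmult_le_compat_r; auto.
    - assert (E := sin2_cos2 t). unfold Rsqr in E. simpl.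
      replace (sin t * (sin t * 1))%R with (1 - cos t * cos t)%R by lra. ring. }
  assert (H := norm_RInt_le (V := R_NormedModule) _ _ 0 (PI / 2) _ _ (Rlt_le _ _ Hpi) Hpt Hl Hr).
  replace (cos_moment f n - c * wallis n)%R with (cos_moment f n + - c * wallis n)%R by ring.
  eapply Rle_trans; [exact H|]. right. f_equal.
  assert (Hrec := wallis_rec n). assert (Hn := pos_INR n).
  apply Rmult_eq_reg_l with (INR n + 2)%R; [|lra].
  transitivity ((INR n + 2) * wallis n - (INR n + 2) * wallis (S (S n)))%R; [ring|].
  rewrite Hrec. field. lra.
Qed.

Section CosProduct.

Variable x : C.

Let p := Re x.
Let q := Im x.

(** Real and imaginary parts of cos (2xt) for x = p + iq, that is cos (2pt) cosh (2qt) and -sin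
    (2pt) sinh (2qt). *)
Let f1 (t : R) : R := (cos (2 * p * t) * ((exp (2 * q * t) + exp (- (2 * q * t))) / 2))%R.
Let f2 (t : R) : R := (- sin (2 * p * t) * ((exp (2 * q * t) - exp (- (2 * q * t))) / 2))%R.
Let f1' (t : R) : R :=
  (- 2 * p * sin (2 * p * t) * ((exp (2 * q * t) + exp (- (2 * q * t))) / 2)
   + 2 * q * cos (2 * p * t) * ((exp (2 * q * t) - exp (- (2 * q * t))) / 2))%R.
Let f2' (t : R) : R :=
  (- 2 * p * cos (2 * p * t) * ((exp (2 * q * t) - exp (- (2 * q * t))) / 2)
   - 2 * q * sin (2 * p * t) * ((exp (2 * q * t) + exp (- (2 * q * t))) / 2))%R.

Let Hf1 : forall t, is_derive f1 t (f1' t).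
Proof. intros t. unfold f1, f1'. auto_derive; auto. field. Qed.

Let Hf2 : forall t, is_derive f2 t (f2' t).
Proof. intros t. unfold f2, f2'. auto_derive; auto. field. Qed.

Let Hf1' : forall t, is_derive f1' t (- (4 * (p ^ 2 - q ^ 2)) * f1 t + 8 * p * q * f2 t)%R.
Proof. intros t. unfold f1', f1, f2. auto_derive; auto. field. Qed.

Let Hf2' : forall t, is_derive f2' t (- (4 * (p ^ 2 - q ^ 2)) * f2 t + (- (8 * p * q)) * f1 t)%R.
Proof. intros t. unfold f2', f1, f2. auto_derive; auto. field. Qed.

Let Hf1'0 : f1' 0%R = 0%R.
Proof. unfold f1'. rewrite !Rmult_0_r, sin_0, Ropp_0. field. Qed.

Let Hf2'0 : f2' 0%R = 0%R.
Proof. unfold f2'. rewrite !Rmult_0_r, sin_0, Ropp_0, exp_0. field. Qed.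

Let Hf1c : forall t, continuous f1 t.
Proof. intros t. apply (ex_derive_continuous f1). eexists. apply Hf1. Qed.

Let Hf2c : forall t, continuous f2 t.
Proof. intros t. apply (ex_derive_continuous f2). eexists. apply Hf2. Qed.

Lemma C2_neq_0 : RtoC 2 <> 0.
Proof. intros E. apply RtoC_inj in E. lra. Qed.

Let f12 : forall t, @eq C (f1 t, f2 t) (Ccos (2 * x * RtoC t)).
Proof.
  intros t.
  assert (E : (f1 t, f2 t) * 2 = Cexp (Ci * (2 * x * RtoC t)) + Cexp (- (Ci * (2 * x * RtoC t)))).
  { rewrite !Cexp_eq. destruct x as [u v]. unfold f1, f2, p, q, Ci, Cmult, Cplus, Copp, RtoC. simpl.
    replace (0 * ((2 * u - 0 * v) * t - (2 * v + 0 * u) * 0) - 1 * ((2 * u - 0 * v) * 0 + (2 * v + 0 * u) * t))%R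
      with (- (2 * v * t))%R by ring.
    replace (0 * ((2 * u - 0 * v) * 0 + (2 * v + 0 * u) * t) + 1 * ((2 * u - 0 * v) * t - (2 * v + 0 * u) * 0))%R
      with (2 * u * t)%R by ring.
    rewrite Ropp_involutive, cos_neg, sin_neg. f_equal; field. }
  assert (G : forall y z : C, y * 2 = z -> y = z / 2).
  { intros y z <-. field. }
  apply G, E.
Qed.

Let cosC_moment (n : nat) : C := (cos_moment f1 n, cos_moment f2 n).

Let I1 : Ccos (RtoC PI * x) = (1 - 4 * (x * x)) * cosC_moment 1.
Proof.
  replace (RtoC PI * x) with (2 * x * RtoC (PI / 2)).
  2:{ rewrite RtoC_div by lra. field. }
  rewrite <- f12. rewrite (cos_moment_1 f1 f1' f2 _ _ Hf1 Hf1' Hf2c Hf1'0).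
  rewrite (cos_moment_1 f2 f2' f1 _ _ Hf2 Hf2' Hf1c Hf2'0).
  unfold cosC_moment, p, q. destruct x as [u v].
  unfold Cmult, Cminus, Cplus, Copp, RtoC. simpl. f_equal; ring.
Qed.

Let Irec : forall m, RtoC (INR m + 2) * RtoC (INR m + 1) * cosC_moment m =
  (RtoC (INR m + 2) * RtoC (INR m + 2) - 4 * (x * x)) * cosC_moment (S (S m)).
Proof.
  intros m.
  assert (E1 := cos_moment_rec f1 f1' f2 _ _ Hf1 Hf1' Hf2c Hf1'0 m).
  assert (E2 := cos_moment_rec f2 f2' f1 _ _ Hf2 Hf2' Hf1c Hf2'0 m).
  cbv zeta in E1, E2. rewrite !S_INR in E1, E2.
  replace (INR m + 1 + 1)%R with (INR m + 2)%R in * by ring.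
  replace (INR m + 2 - 1)%R with (INR m + 1)%R in * by ring.
  unfold cosC_moment. unfold p, q in *. destruct x as [u v].
  unfold Cmult, Cminus, Cplus, Copp, RtoC. simpl in *. f_equal; lra.
Qed.

Let cosC_ratio (j : nat) : C := cosC_moment (2 * j + 1) / RtoC (wallis (2 * j + 1)).

Let wallis_odd_neq_0 : forall j, RtoC (wallis (2 * j + 1)) <> 0.
Proof. intros j E. apply RtoC_inj in E. assert (H := wallis_odd_pos j). lra. Qed.

Definition cos_factor (j : nat) : C := 1 - 4 * (x * x) / (RtoC (2 * INR j + 1) * RtoC (2 * INR j + 1)).

Let odd_neq_0 : forall j, RtoC (2 * INR j + 1) <> 0.
Proof. intros j E. apply RtoC_inj in E. assert (H := pos_INR j). lra. Qed.

(** Dividing the recursion for the moments of cos (2xt) by the Wallis recursion yields (n^2 -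
    4x^2)/n^2 with n odd, which is one factor of the product. The ratio of moments is the remainder,
    and it tends to 1. *)
Let cos_eq_partial : forall j, Ccos (RtoC PI * x) = cprod cos_factor (S j) * cosC_ratio j.
Proof.
  induction j as [|j IH].
  - rewrite I1. simpl. unfold cos_factor, cosC_ratio. simpl. rewrite wallis_1, Rmult_0_r, Rplus_0_l.
    field.
  - rewrite IH. change (cprod cos_factor (S (S j))) with (cprod cos_factor (S j) * cos_factor (S j)).
    rewrite <- Cmult_assoc. f_equal. unfold cosC_ratio, cos_factor.
    replace (2 * S j + 1)%nat with (S (S (2 * j + 1))) by lia.
    assert (E := Irec (2 * j + 1)). assert (Ew := wallis_rec (2 * j + 1)).
    apply (f_equal RtoC) in Ew. rewrite !RtoC_mult in Ew.
    replace (2 * INR (S j) + 1)%R with (INR (2 * j + 1) + 2)%R.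
    2:{ rewrite S_INR, plus_INR, mult_INR. simpl. ring. }
    assert (Hn2 : RtoC (INR (2 * j + 1) + 2) <> 0).
    { intros H. apply RtoC_inj in H. assert (H1 := pos_INR (2 * j + 1)). lra. }
    assert (Hn1 : RtoC (INR (2 * j + 1) + 1) <> 0).
    { intros H. apply RtoC_inj in H. assert (H1 := pos_INR (2 * j + 1)). lra. }
    assert (W1 := wallis_odd_neq_0 j). assert (W2 := wallis_odd_neq_0 (S j)).
    replace (2 * S j + 1)%nat with (S (S (2 * j + 1))) in W2 by lia.
    set (n2 := RtoC (INR (2 * j + 1) + 2)) in *. set (n1 := RtoC (INR (2 * j + 1) + 1)) in *.
    set (w := RtoC (wallis (2 * j + 1))) in *.
    set (w2 := RtoC (wallis (S (S (2 * j + 1))))) in *.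
    replace (cosC_moment (2 * j + 1)) with
      ((n2 * n2 - 4 * (x * x)) * cosC_moment (S (S (2 * j + 1))) / (n2 * n1))
      by (rewrite <- E; field; auto).
    replace w with (n2 * w2 / n1) by (rewrite Ew; field; auto).
    field. auto.
Qed.

Let cos_close : exists K, forall t, (0 <= t <= PI / 2)%R ->
  (Cmod ((f1 t, f2 t) - 1) <= K * sin t ^ 2)%R.
Proof.
  assert (Hx := Cmod_ge_0 x).
  (* Here |w| = 2|x|t <= 6|x| sin t, so 180 = 5 * 36 with the 5 from the exponential remainder; t <=
     2 gives |w| <= 4|x| in the exponent. *)
  exists (180 * Cmod x ^ 2 * exp (4 * Cmod x))%R. intros t Ht. rewrite f12.
  set (w := Ci * (2 * x * RtoC t)).
  assert (Hw : Cmod w = (2 * Cmod x * t)%R).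
  { unfold w. rewrite !Cmod_mult, Cmod_Ci, !Cmod_R, (Rabs_pos_eq t), (Rabs_pos_eq 2) by lra. ring. }
  unfold Ccos. fold w.
  replace ((Cexp w + Cexp (- w)) / 2 - 1) with
    (((Cexp w - 1 - w) + (Cexp (- w) - 1 - - w)) / 2) by field.
  rewrite Cmod_div by apply C2_neq_0. rewrite Cmod_R, (Rabs_pos_eq 2) by lra.
  assert (H1 := Cexp_sub_1_sub_le w). assert (H2 := Cexp_sub_1_sub_le (- w)).
  rewrite Cmod_opp in H2. assert (H3 := Cmod_triangle (Cexp w - 1 - w) (Cexp (- w) - 1 - - w)).
  apply Rle_trans with (5 * Cmod w ^ 2 * exp (Cmod w))%R; [lra|].
  assert (Ht2 : (t <= 2)%R) by (assert (H := PI_4); lra).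
  assert (Hts := le_3_mul_sin t Ht).
  assert (He : (exp (Cmod w) <= exp (4 * Cmod x))%R).
  { apply exp_le_exp. rewrite Hw. nra. }
  assert (Hsq : (Cmod w ^ 2 <= 36 * Cmod x ^ 2 * sin t ^ 2)%R).
  { rewrite Hw. replace (36 * Cmod x ^ 2 * sin t ^ 2)%R with ((2 * Cmod x * (3 * sin t)) ^ 2)%R by ring.
    apply pow_incr. split; [apply Rmult_le_pos; lra|]. apply Rmult_le_compat_l; lra. }
  replace (180 * Cmod x ^ 2 * exp (4 * Cmod x) * sin t ^ 2)%R with
    ((5 * (36 * Cmod x ^ 2 * sin t ^ 2)) * exp (4 * Cmod x))%R by ring.
  apply Rmult_le_compat; auto; [|left; apply exp_pos|lra].
  assert (H := pow2_ge_0 (Cmod w)). lra.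
Qed.

Let cosC_ratio_cv : Ccv cosC_ratio 1.
Proof.
  destruct cos_close as [K HK].
  assert (H1 : forall n, (Rabs (cos_moment f1 n - 1 * wallis n) <= K * (wallis n / (INR n + 2)))%R).
  { intros n. apply cos_moment_close; auto. intros t Ht. eapply Rle_trans; [|apply (HK t Ht)].
    apply (re_le_Cmod ((f1 t, f2 t) - 1)). }
  assert (H2 : forall n, (Rabs (cos_moment f2 n - 0 * wallis n) <= K * (wallis n / (INR n + 2)))%R).
  { intros n. apply cos_moment_close; auto. intros t Ht. eapply Rle_trans; [|apply (HK t Ht)].
    replace (f2 t - 0)%R with (Im ((f1 t, f2 t) - 1)) by (simpl; ring).
    apply im_le_Cmod. }
  apply Ccv_squeeze with (fun j => 2 * K / (INR j + 1))%R; [|apply is_lim_seq_inv_S].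
  intros j. assert (Hw := wallis_odd_pos j). specialize (H1 (2 * j + 1)%nat).
  specialize (H2 (2 * j + 1)%nat). unfold cosC_ratio.
  set (w := wallis (2 * j + 1)) in *.
  assert (HwC : RtoC w <> 0) by apply wallis_odd_neq_0.
  replace (cosC_moment (2 * j + 1) / RtoC w - 1) with ((cosC_moment (2 * j + 1) - RtoC w) / RtoC w)
    by (field; auto).
  rewrite Cmod_div, Cmod_R, Rabs_pos_eq by (auto; lra).
  apply div_le_of_le_mul; auto. unfold cosC_moment.
  eapply Rle_trans; [apply Cmod_le_abs|]. unfold Copp, RtoC, fst, snd.
  replace (cos_moment f1 (2 * j + 1) + - w)%R with (cos_moment f1 (2 * j + 1) - 1 * w)%R by ring.
  replace (cos_moment f2 (2 * j + 1) + - 0)%R with (cos_moment f2 (2 * j + 1) - 0 * w)%R by ring.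
  assert (HK0 : (0 <= K * (w / (INR (2 * j + 1) + 2)))%R).
  { eapply Rle_trans; [apply Rabs_pos|exact H1]. }
  assert (Hj := pos_INR j).
  assert (En : (INR (2 * j + 1) + 2 = 2 * INR j + 3)%R).
  { rewrite plus_INR, mult_INR. simpl. ring. }
  rewrite En in *.
  assert (HKp : (0 <= K)%R).
  { apply Rmult_le_reg_r with (w / (2 * INR j + 3))%R; [apply Rdiv_lt_0_compat; lra|]. lra. }
  apply Rle_trans with (2 * (K * (w / (2 * INR j + 3))))%R; [lra|].
  replace (2 * K / (INR j + 1) * w)%R with (2 * (K * (w / (INR j + 1))))%R by (field; lra).
  apply Rmult_le_compat_l; [lra|]. apply Rmult_le_compat_l; auto.
  apply Rmult_le_compat_l; [lra|]. apply Rinv_le_contravar; lra.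
Qed.

Lemma cos_product : Ccv (cprod cos_factor) (Ccos (RtoC PI * x)).
Proof.
  destruct (cprod_cv cos_factor (4 * Cmod x ^ 2)) as [l Hl].
  { intros j. unfold cos_factor.
    replace (1 - 4 * (x * x) / (RtoC (2 * INR j + 1) * RtoC (2 * INR j + 1)) - 1) with
      (- (4 * (x * x) / (RtoC (2 * INR j + 1) * RtoC (2 * INR j + 1)))) by (field; apply odd_neq_0).
    assert (Hj := pos_INR j).
    rewrite Cmod_opp, Cmod_div by (apply Cmult_neq_0; apply odd_neq_0).
    rewrite !Cmod_mult, !Cmod_R, (Rabs_pos_eq 4), (Rabs_pos_eq (2 * INR j + 1)) by lra.
    replace (4 * Cmod x ^ 2)%R with (4 * (Cmod x * Cmod x))%R by ring.
    apply Rmult_le_compat_l; [assert (H := Cmod_ge_0 x); nra|].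
    apply Rinv_le_contravar; nra. }
  assert (E : l * 1 = Ccos (RtoC PI * x)).
  { apply (Ccv_unique (fun j => cprod cos_factor (S j) * cosC_ratio j)).
    - apply Ccv_mult; auto. now apply (Ccv_incr (cprod cos_factor)).
    - apply Ccv_ext with (fun _ => Ccos (RtoC PI * x)); auto using Ccv_const. }
  rewrite <- E, Cmult_1_r. exact Hl.
Qed.

End CosProduct.

(** * Gauss's theorem *)

Lemma Re_plus (x y : C) : Re (x + y) = (Re x + Re y)%R.
Proof. reflexivity. Qed.

Lemma Re_minus (x y : C) : Re (x - y) = (Re x - Re y)%R.
Proof. reflexivity. Qed.

Definition hyp_term (A B c : C) (m : nat) : C :=
  pochhammer A m * pochhammer B m / (RtoC (INR (fact m)) * pochhammer c m).

Definition Hsum (n : nat) : R := rsum (fun j => / (INR j + 1))%R n.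

Lemma Hsum_nonneg (n : nat) : (0 <= Hsum n)%R.
Proof.
  induction n as [|n IH]; unfold Hsum in *; simpl; [lra|].
  assert (H := pos_INR n). assert (0 < / (INR n + 1))%R by (apply Rinv_0_lt_compat; lra). lra.
Qed.

Lemma INR_S_neq_0 (n : nat) : RtoC (INR n) + 1 <> 0.
Proof.
  rewrite <- RtoC_INR_S. intros E. apply RtoC_inj in E. now apply (not_0_INR (S n)) in E.
Qed.

Lemma fact_neq_0_C (n : nat) : RtoC (INR (fact n)) <> 0.
Proof. intros E. apply RtoC_inj in E. revert E. apply INR_fact_neq_0. Qed.

Lemma hyp_term_0 (A B c : C) : hyp_term A B c 0 = 1.
Proof. unfold hyp_term. simpl. field. Qed.

Lemma hyp_term_S (A B c : C) (m : nat) : (forall k : nat, c <> - RtoC (INR k)) ->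
  hyp_term A B c (S m) =
  hyp_term A B c m * ((A + RtoC (INR m)) * (B + RtoC (INR m))
    / ((RtoC (INR m) + 1) * (c + RtoC (INR m)))).
Proof.
  intros Hc. unfold hyp_term. rewrite fact_simpl, mult_INR, RtoC_mult, RtoC_INR_S. simpl pochhammer.
  field. repeat split; auto using INR_S_neq_0, fact_neq_0_C, pochhammer_neq_0, add_INR_neq_0.
Qed.

(** The linear correction must be Re A, where the triangle inequality would give |A|. After
    squaring, the excess (Im A)^2 is absorbed by 2 (m + Re A) |A|^2 / m, since m >= 2|A|. *)
Lemma Cmod_add_R_le (A : C) (m : R) : (1 <= m)%R -> (2 * Cmod A <= m)%R ->
  (Cmod (A + RtoC m) <= m + Re A + Cmod A ^ 2 / m)%R.
Proof.
  intros H1 H2. assert (Ha := re_le_Cmod A). apply Rabs_le_between in Ha.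
  assert (HK := pow2_ge_0 (Cmod A)). assert (E := Cmod2_alt A).
  assert (Hi : (0 <= Cmod A ^ 2 / m)%R).
  { apply Rmult_le_pos; auto. left. apply Rinv_0_lt_compat. lra. }
  apply Rsqr_incr_0_var; [|lra]. unfold Rsqr.
  assert (E2 := Cmod2_alt (A + RtoC m)).
  replace (Re (A + RtoC m)) with (Re A + m)%R in E2 by reflexivity.
  replace (Im (A + RtoC m)) with (Im A) in E2 by (unfold Im; simpl; ring).
  replace (Cmod (A + RtoC m) * Cmod (A + RtoC m))%R with (Cmod (A + RtoC m) ^ 2)%R by ring.
  rewrite E2.
  assert (E3 : (Cmod A ^ 2 / m * m = Cmod A ^ 2)%R) by (field; lra).
  set (y := (Cmod A ^ 2 / m)%R) in *.
  assert (H3 : (Cmod A ^ 2 <= 2 * (m + Re A) * y)%R) by nra.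
  assert (H4 := pow2_ge_0 (Re A)). nra.
Qed.

(** Compared as cubics in m, the two sides have the same leading term, and their m^2 coefficients
    differ by Re (c - A - B) - 1 - d. Taking d as half the excess over 1 leaves d m^2 in hand to
    dominate all lower terms. *)
Lemma raabe_ratio (A B c : C) : (1 < Re (c - A - B))%R ->
  exists d N, (0 < d)%R /\ (1 <= N)%nat /\ forall m, (N <= m)%nat ->
  (Cmod (A + RtoC (INR m)) * Cmod (B + RtoC (INR m)) * (INR m + 1)
    <= Cmod (c + RtoC (INR m)) * (INR m ^ 2 - d * INR m))%R.
Proof.
  intros Hre. set (d := ((Re (c - A - B) - 1) / 2)%R).
  assert (Hd : (0 < d)%R) by (unfold d; lra).
  assert (EC : (Re c = 2 * d + 1 + Re A + Re B)%R) by (unfold d; rewrite !Re_minus; lra).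
  set (a := Cmod A). set (b := Cmod B).
  assert (Ha0 : (0 <= a)%R) by apply Cmod_ge_0. assert (Hb0 : (0 <= b)%R) by apply Cmod_ge_0.
  set (Q := (a + b + a ^ 2 + b ^ 2)%R).
  assert (HQ : (0 <= Q)%R) by (unfold Q; nra).
  (* [Z] collects the coefficients of the terms at most linear in x; the threshold below ensures Z
     <= d x, along with x >= d and the range of the modulus bounds for A and B. *)
  set (Z := (2 * Q + 2 * Q ^ 2 + 2 * Q + Rabs (Re c) * d)%R).
  destruct (nfloor_ex (Rabs (Z / d) + 2 * a + 2 * b + 1 + d)) as [N [_ HN]].
  { assert (H := Rabs_pos (Z / d)). lra. }
  exists d, (S N). split; auto. split; [lia|]. intros m Hm.
  apply le_INR in Hm. rewrite S_INR in Hm. set (x := INR m) in *.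
  assert (HZ0 := Rle_abs (Z / d)). assert (HZ1 := Rabs_pos (Z / d)).
  assert (Hx1 : (1 <= x)%R) by lra.
  assert (HA := Cmod_add_R_le A x Hx1 ltac:(fold a; lra)). fold a in HA.
  assert (HB := Cmod_add_R_le B x Hx1 ltac:(fold b; lra)). fold b in HB.
  assert (HZ : (Z <= d * x)%R).
  { replace Z with (d * (Z / d))%R by (field; lra). apply Rmult_le_compat_l; lra. }
  assert (HCC : (Re c + x <= Cmod (c + RtoC x))%R).
  { eapply Rle_trans; [apply Rle_abs|]. apply (re_le_Cmod (c + RtoC x)). }
  assert (HAr := re_le_Cmod A). assert (HBr := re_le_Cmod B).
  apply Rabs_le_between in HAr. apply Rabs_le_between in HBr. fold a in HAr. fold b in HBr.
  assert (Hax : (0 <= a ^ 2 / x <= a ^ 2)%R).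
  { split; [apply Rmult_le_pos; [nra|left; apply Rinv_0_lt_compat; lra]|].
    apply div_le_of_le_mul; nra. }
  assert (Hbx : (0 <= b ^ 2 / x <= b ^ 2)%R).
  { split; [apply Rmult_le_pos; [nra|left; apply Rinv_0_lt_compat; lra]|].
    apply div_le_of_le_mul; nra. }
  assert (Hax' : (a ^ 2 / x * x = a ^ 2)%R) by (field; lra).
  assert (Hbx' : (b ^ 2 / x * x = b ^ 2)%R) by (field; lra).
  set (u := (Re A + a ^ 2 / x)%R). set (v := (Re B + b ^ 2 / x)%R).
  assert (Hu : (- Q <= u <= Q)%R) by (unfold u, Q; nra).
  assert (Hv : (- Q <= v <= Q)%R) by (unfold v, Q; nra).
  apply Rle_trans with ((x + u) * (x + v) * (x + 1))%R.
  - apply Rmult_le_compat_r; [lra|].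
    apply Rmult_le_compat; auto using Cmod_ge_0; unfold u, v; lra.
  - apply Rle_trans with ((Re c + x) * (x ^ 2 - d * x))%R.
    2:{ apply Rmult_le_compat_r; auto. replace (x ^ 2 - d * x)%R with (x * (x - d))%R by ring.
        apply Rmult_le_pos; lra. }
    assert (Huv : (u * v <= Q ^ 2)%R) by nra.
    assert (Euv : ((u + v) * x = (Re A + Re B) * x + a ^ 2 + b ^ 2)%R).
    { unfold u, v. replace ((Re A + a ^ 2 / x + (Re B + b ^ 2 / x)) * x)%R with
        ((Re A + Re B) * x + a ^ 2 / x * x + b ^ 2 / x * x)%R by ring.
      rewrite Hax', Hbx'. ring. }
    assert (HcR := Rle_abs (Re c)).
    replace ((x + u) * (x + v) * (x + 1))%R with
      (x ^ 3 + x ^ 2 + ((u + v) * x) * x + (u + v) * x + u * v * x + u * v)%R by ring.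
    rewrite Euv. rewrite EC in *.
    replace ((2 * d + 1 + Re A + Re B + x) * (x ^ 2 - d * x))%R with
      (x ^ 3 + (d + 1 + Re A + Re B) * x ^ 2 - (2 * d + 1 + Re A + Re B) * d * x)%R by ring.
    assert (G1 : ((a ^ 2 + b ^ 2) * x <= Q * x)%R).
    { apply Rmult_le_compat_r; [lra|]. unfold Q. nra. }
    assert (G2 : ((Re A + Re B) * x + a ^ 2 + b ^ 2 <= 2 * Q * x)%R).
    { rewrite <- Euv. apply Rmult_le_compat_r; lra. }
    assert (G3 : (u * v * x <= Q ^ 2 * x)%R) by (apply Rmult_le_compat_r; lra).
    assert (G4 : (u * v <= Q ^ 2 * x)%R) by nra.
    assert (G5 : ((2 * d + 1 + Re A + Re B) * d * x <= Rabs (2 * d + 1 + Re A + Re B) * d * x)%R).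
    { apply Rmult_le_compat_r; [lra|]. apply Rmult_le_compat_r; lra. }
    assert (G6 : (Z * x <= d * x * x)%R) by (apply Rmult_le_compat_r; lra).
    assert (G7 : (0 <= Q * x)%R) by (apply Rmult_le_pos; lra).
    unfold Z in G6. rewrite EC in G6. lra.
Qed.

Lemma rsum_mono (f : nat -> R) (n m : nat) :
  (forall k, (0 <= f k)%R) -> (n <= m)%nat -> (rsum f n <= rsum f m)%R.
Proof.
  intros Hf H. induction H as [|m H IH]; [lra|]. simpl. specialize (Hf m). lra.
Qed.

(** With T_m = m^2 |t_m|, the ratio estimate reads T_(m+1) + d m |t_m| <= T_m from some index on.
    Telescoping bounds the sum of m |t_m|. Moreover T_n (1 + H_n) minus that partial sum does not
    increase, because the new harmonic term costs T_(n+1)/(n+1) <= n |t_n|. The first bound gives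
    convergence with weights growing linearly, the second makes boundary terms with a logarithmic
    factor vanish. *)
Lemma hyp_term_decay (A B c : C) :
  (forall k : nat, c <> - RtoC (INR k)) -> (1 < Re (c - A - B))%R ->
  exists M, (0 < M)%R /\
    (forall n, (rsum (fun m => INR m * Cmod (hyp_term A B c m)) n <= M)%R) /\
    (forall n, (INR n ^ 2 * Cmod (hyp_term A B c n) * (1 + Hsum n) <= M)%R).
Proof.
  intros Hc Hre. destruct (raabe_ratio A B c Hre) as [d [N [Hd [HN1 HN]]]].
  set (u := fun m => Cmod (hyp_term A B c m)).
  assert (Hu : forall m, (0 <= u m)%R) by (intros m; apply Cmod_ge_0).
  set (T := fun m => (INR m ^ 2 * u m)%R).
  assert (HT : forall m, (0 <= T m)%R).
  { intros m. apply Rmult_le_pos; auto. apply pow2_ge_0. }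
  set (S1 := rsum (fun m => INR m * u m)%R).
  assert (HS1 : forall k, (0 <= INR k * u k)%R).
  { intros k. apply Rmult_le_pos; auto. apply pos_INR. }
  assert (Hstep : forall m, (N <= m)%nat -> (T (S m) + d * (INR m * u m) <= T m)%R).
  { intros m Hm. specialize (HN m Hm). unfold T.
    assert (Hm0 := pos_INR m).
    assert (Hcm : c + RtoC (INR m) <> 0) by (now apply add_INR_neq_0).
    assert (Hcp : (0 < Cmod (c + RtoC (INR m)))%R) by (now apply Cmod_gt_0).
    assert (E : u (S m) = (u m * (Cmod (A + RtoC (INR m)) * Cmod (B + RtoC (INR m))
      / ((INR m + 1) * Cmod (c + RtoC (INR m)))))%R).
    { unfold u. rewrite hyp_term_S by auto. rewrite Cmod_mult, Cmod_div, !Cmod_mult.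
      - rewrite <- RtoC_plus, (Cmod_R (INR m + 1)), (Rabs_pos_eq (INR m + 1)) by lra. reflexivity.
      - apply Cmult_neq_0; auto using INR_S_neq_0. }
    rewrite E, S_INR.
    replace ((INR m + 1) ^ 2 * (u m * (Cmod (A + RtoC (INR m)) * Cmod (B + RtoC (INR m))
      / ((INR m + 1) * Cmod (c + RtoC (INR m))))))%R with
      (u m * (Cmod (A + RtoC (INR m)) * Cmod (B + RtoC (INR m)) * (INR m + 1)
        / Cmod (c + RtoC (INR m))))%R by (field; split; lra).
    assert (H : (Cmod (A + RtoC (INR m)) * Cmod (B + RtoC (INR m)) * (INR m + 1)
        / Cmod (c + RtoC (INR m)) <= INR m ^ 2 - d * INR m)%R).
    { apply div_le_of_le_mul; auto. lra. }
    specialize (Hu m). nra. }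
  assert (HSb : forall n, (d * S1 n <= d * S1 N + T N)%R).
  { intros n. destruct (Nat.le_ge_cases n N) as [Hn|Hn].
    - assert (S1 n <= S1 N)%R by (now apply rsum_mono). specialize (HT N). nra.
    - assert (d * S1 n + T n <= d * S1 N + T N)%R; [|specialize (HT n); lra].
      induction Hn as [|n Hn IH]; [lra|]. specialize (Hstep n Hn).
      change (S1 (S n)) with (S1 n + INR n * u n)%R. lra. }
  set (M1 := (S1 N + T N / d)%R).
  assert (HM1 : forall n, (S1 n <= M1)%R).
  { intros n. specialize (HSb n). unfold M1. apply Rmult_le_reg_l with d; auto.
    replace (d * (S1 N + T N / d))%R with (d * S1 N + T N)%R by (field; lra). exact HSb. }
  assert (HTH : forall n, (N <= n)%nat ->
    (T n * (1 + Hsum n) - S1 n <= T N * (1 + Hsum N) - S1 N)%R).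
  { intros n Hn. induction Hn as [|n Hn IH]; [lra|].
    assert (Hs := Hstep n Hn). change (S1 (S n)) with (S1 n + INR n * u n)%R.
    change (Hsum (S n)) with (Hsum n + / (INR n + 1))%R.
    assert (Hn1 : (1 <= INR n)%R).
    { apply (le_INR 1). lia. }
    assert (HH := Hsum_nonneg n). specialize (HS1 n). specialize (HT (S n)).
    assert (H1 : (T (S n) <= T n)%R) by nra.
    assert (H2 : (T (S n) * / (INR n + 1) <= INR n * u n)%R).
    { apply div_le_of_le_mul; [lra|]. unfold T in H1 at 2. nra. }
    nra. }
  destruct (bound_of_eventual_bound (fun n => INR n ^ 2 * u n * (1 + Hsum n))%R (fun _ => 1%R)
    (T N * (1 + Hsum N) - S1 N + M1) N) as [K [HK HKn]].
  - intros; lra.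
  - intros n Hn. specialize (HTH n Hn). specialize (HM1 n). unfold T in *. lra.
  - exists (Rmax K M1). split; [eapply Rlt_le_trans; [exact HK|apply Rmax_l]|]. split.
    + intros n. eapply Rle_trans; [apply HM1|apply Rmax_r].
    + intros n. eapply Rle_trans; [apply HKn|]. rewrite Rmult_1_r. apply Rmax_l.
Qed.

Lemma mul_hyp_term_cv (A B c : C) (y : nat -> C) (K : R) :
  (forall k : nat, c <> - RtoC (INR k)) -> (1 < Re (c - A - B))%R ->
  (forall n, (Cmod (y n) <= K * (1 + Hsum (S n)))%R) ->
  Ccv (fun n => RtoC (INR (S n)) * hyp_term A B c (S n) * y n) 0.
Proof.
  intros Hc Hre Hy. destruct (hyp_term_decay A B c Hc Hre) as [M [HM [_ H]]].
  apply Ccv_squeeze with (fun n => (K * M) / (INR n + 1))%R; [|apply is_lim_seq_inv_S].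
  intros n. replace (RtoC (INR (S n)) * hyp_term A B c (S n) * y n - 0)
    with (RtoC (INR (S n)) * hyp_term A B c (S n) * y n) by ring.
  assert (Hn := pos_INR n). rewrite !Cmod_mult, Cmod_R, Rabs_pos_eq by apply pos_INR.
  specialize (H (S n)). specialize (Hy n). assert (HH := Hsum_nonneg (S n)).
  assert (HK : (0 <= K)%R).
  { assert (H0 := Cmod_ge_0 (y n)). nra. }
  rewrite S_INR in *. set (t := Cmod (hyp_term A B c (S n))) in *.
  assert (Ht : (0 <= t)%R) by apply Cmod_ge_0.
  apply Rmult_le_reg_r with (INR n + 1)%R; [lra|].
  replace (K * M / (INR n + 1) * (INR n + 1))%R with (K * M)%R by (field; lra).
  apply Rle_trans with (K * ((INR n + 1) ^ 2 * t * (1 + Hsum (S n))))%R.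
  - replace (K * ((INR n + 1) ^ 2 * t * (1 + Hsum (S n))))%R with
      ((INR n + 1) * t * (K * (1 + Hsum (S n))) * (INR n + 1))%R by ring.
    apply Rmult_le_compat_r; [lra|]. apply Rmult_le_compat_l; auto.
    apply Rmult_le_pos; lra.
  - apply Rmult_le_compat_l; auto.
Qed.

Definition hyp_sum (A B c : C) : C := Clim (csum (hyp_term A B c)).

(** Summation starts at index 1, where the factor m in the sum of m |t_m| is positive and can
    majorise the weights. *)
Lemma hyp_tail_sum (A B c : C) (y : nat -> C) (K : R) :
  (forall k : nat, c <> - RtoC (INR k)) -> (1 < Re (c - A - B))%R ->
  (forall n, (Cmod (y n) <= K * INR (S n))%R) ->
  Ccv (csum (fun n => hyp_term A B c (S n) * y n))
    (Clim (csum (fun n => hyp_term A B c (S n) * y n))).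
Proof.
  intros Hc Hre Hy. destruct (hyp_term_decay A B c Hc Hre) as [M [HM [H _]]].
  assert (HK : (0 <= K)%R).
  { specialize (Hy O). assert (H0 := Cmod_ge_0 (y O)). simpl in Hy. lra. }
  destruct (csum_abs_cv (fun n => hyp_term A B c (S n) * y n) (K * M)) as [l [Hl _]].
  - intros n. specialize (H (S n)).
    apply Rle_trans with (K * rsum (fun m => INR m * Cmod (hyp_term A B c m)) (S n))%R.
    2:{ apply Rmult_le_compat_l; auto. }
    clear H. induction n as [|n IH]; [simpl; lra|].
    change (rsum (fun m => INR m * Cmod (hyp_term A B c m)) (S (S n)))%R with
      (rsum (fun m => INR m * Cmod (hyp_term A B c m)) (S n)
       + INR (S n) * Cmod (hyp_term A B c (S n)))%R.
    change (rsum (fun k => Cmod (hyp_term A B c (S k) * y k)) (S n)) with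
      (rsum (fun k => Cmod (hyp_term A B c (S k) * y k)) n + Cmod (hyp_term A B c (S n) * y n))%R.
    rewrite Cmod_mult. specialize (Hy n). assert (H0 := Cmod_ge_0 (hyp_term A B c (S n))).
    nra.
  - exact (Clim_correct _ _ Hl).
Qed.

Lemma csum_S_hyp_term (A B c : C) (n : nat) :
  csum (hyp_term A B c) (S n) = 1 + csum (fun m => hyp_term A B c (S m) * 1) n.
Proof.
  rewrite csum_shift, hyp_term_0. f_equal. apply csum_ext. intros k. ring.
Qed.

Lemma hyp_sum_cv (A B c : C) :
  (forall k : nat, c <> - RtoC (INR k)) -> (1 < Re (c - A - B))%R ->
  Ccv (csum (hyp_term A B c)) (hyp_sum A B c).
Proof.
  intros Hc Hre. eapply Clim_correct. apply Ccv_incr.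
  eapply Ccv_ext; [intros n; symmetry; apply csum_S_hyp_term|].
  apply Ccv_plus; [apply Ccv_const|]. apply (hyp_tail_sum A B c _ 1 Hc Hre).
  intros n. rewrite Cmod_1, S_INR. assert (H := pos_INR n). lra.
Qed.

Lemma pochhammer_shift (x : C) (n : nat) :
  x * pochhammer (x + 1) n = pochhammer x n * (x + RtoC (INR n)).
Proof.
  induction n as [|n IH]; [simpl; ring|].
  change (pochhammer (x + 1) (S n)) with (pochhammer (x + 1) n * (x + 1 + RtoC (INR n))).
  rewrite Cmult_assoc, IH, RtoC_INR_S. simpl. ring.
Qed.

Lemma add_1_neq (c : C) : (forall k : nat, c <> - RtoC (INR k)) ->
  forall k : nat, c + 1 <> - RtoC (INR k).
Proof.
  intros Hc k E. apply (Hc (S k)). rewrite RtoC_INR_S.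
  replace c with (c + 1 - 1) by ring. rewrite E. ring.
Qed.

Lemma hyp_term_shift (A B c : C) (m : nat) : (forall k : nat, c <> - RtoC (INR k)) ->
  hyp_term A B (c + 1) m = hyp_term A B c m * (c / (c + RtoC (INR m))).
Proof.
  intros Hc. unfold hyp_term.
  assert (H1 := pochhammer_neq_0 c m Hc). assert (H2 := add_INR_neq_0 c m Hc).
  assert (H3 := pochhammer_neq_0 _ m (add_1_neq c Hc)).
  assert (H4 := fact_neq_0_C m).
  assert (H5 : c <> 0) by (rewrite <- (Cplus_0_r c); exact (add_INR_neq_0 c 0 Hc)).
  replace (pochhammer (c + 1) m) with (pochhammer c m * (c + RtoC (INR m)) / c).
  - field. auto.
  - rewrite <- pochhammer_shift. field. auto.
Qed.

(** Gauss's contiguous relation in c. On partial sums the combination telescopes to -c n t_n, which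
    tends to 0. *)
Lemma gauss_step (A B c : C) :
  (forall k : nat, c <> - RtoC (INR k)) -> (1 < Re (c - A - B))%R ->
  c * (c - A - B) * hyp_sum A B c = (c - A) * (c - B) * hyp_sum A B (c + 1).
Proof.
  intros Hc Hre.
  assert (H1 := hyp_sum_cv A B c Hc Hre).
  assert (H2 : Ccv (csum (hyp_term A B (c + 1))) (hyp_sum A B (c + 1))).
  { apply hyp_sum_cv; [now apply add_1_neq|].
    rewrite !Re_minus in *. rewrite Re_plus, re_RtoC. lra. }
  assert (H3 : forall n, c * (c - A - B) * csum (hyp_term A B c) n
    - (c - A) * (c - B) * csum (hyp_term A B (c + 1)) n = - c * (RtoC (INR n) * hyp_term A B c n)).
  { induction n as [|n IH]; [simpl; ring|].
    change (csum (hyp_term A B c) (S n)) with (csum (hyp_term A B c) n + hyp_term A B c n).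
    change (csum (hyp_term A B (c + 1)) (S n)) with
      (csum (hyp_term A B (c + 1)) n + hyp_term A B (c + 1) n).
    rewrite hyp_term_S, hyp_term_shift, RtoC_INR_S by auto.
    assert (Hn := INR_S_neq_0 n). assert (Hcn := add_INR_neq_0 c n Hc).
    transitivity (- c * (RtoC (INR n) * hyp_term A B c n) +
      (c * (c - A - B) * hyp_term A B c n - (c - A) * (c - B) * (hyp_term A B c n * (c / (c + RtoC (INR n)))))).
    - rewrite <- IH. ring.
    - field. auto. }
  assert (H4 : Ccv (fun n => - c * (RtoC (INR n) * hyp_term A B c n)) (- c * 0)).
  { apply Ccv_scal. apply Ccv_incr.
    eapply Ccv_ext; [|apply (mul_hyp_term_cv A B c (fun _ => 1) 1 Hc Hre)].
    - intros n. simpl. ring.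
    - intros n. rewrite Cmod_1. assert (H := Hsum_nonneg (S n)). lra. }
  assert (H5 : c * (c - A - B) * hyp_sum A B c - (c - A) * (c - B) * hyp_sum A B (c + 1) = - c * 0).
  { apply (Ccv_unique (fun n => - c * (RtoC (INR n) * hyp_term A B c n))); auto.
    eapply Ccv_ext; [exact H3|]. apply Ccv_minus; now apply Ccv_scal. }
  apply Ceq_minus. rewrite H5. ring.
Qed.

Lemma add_INR_neq (c : C) (n : nat) : (forall k : nat, c <> - RtoC (INR k)) ->
  forall k : nat, c + RtoC (INR n) <> - RtoC (INR k).
Proof.
  intros Hc k E. apply (Hc (n + k)%nat). rewrite plus_INR, RtoC_plus.
  replace c with (c + RtoC (INR n) - RtoC (INR n)) by ring. rewrite E. ring.
Qed.

(** In (c+n)_(m+1) the first factor c + n is kept and each other factor is at least as large in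
    modulus as the corresponding one of (c)_(m+1). Every term of positive index is therefore O(1/n)
    times the term for c, uniformly enough to sum. *)
Lemma hyp_sum_shift_cv (A B c : C) :
  (forall k : nat, c <> - RtoC (INR k)) -> (1 < Re (c - A - B))%R ->
  Ccv (fun n => hyp_sum A B (c + RtoC (INR n))) 1.
Proof.
  intros Hc Hre.
  destruct (hyp_term_decay A B c Hc Hre) as [M [HM [HS _]]].
  assert (Hc0 := Cmod_ge_0 c).
  destruct (Cmod_add_INR_ge c Hc) as [d [Hd Hdn]].
  destruct (nfloor_ex (2 * Cmod c)) as [N [_ HN]]; [lra|].
  destruct (bound_of_eventual_bound
    (fun n => Cmod (hyp_sum A B (c + RtoC (INR n)) - 1)) (fun n => / (INR n + 1))%R
    (M * (Cmod c / d)) (S N)) as [K [HK H]].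
  - intros n. apply Rinv_0_lt_compat. assert (H := pos_INR n). lra.
  - intros n Hn. apply le_INR in Hn. rewrite S_INR in Hn.
    assert (Hcn := add_INR_neq c n Hc).
    (* Since n >= 2|c|, one has |c + n + j| >= n + j - |c| >= |c| + j. *)
    assert (Hj : forall j, (Cmod (c + RtoC (INR j)) <= Cmod (c + RtoC (INR n) + RtoC (INR j)))%R).
    { intros j. assert (Hj := pos_INR j). assert (Hn0 := pos_INR n).
      eapply Rle_trans; [apply Cmod_triangle|]. rewrite Cmod_R, Rabs_pos_eq by auto.
      assert (H := Cmod_sub_le (RtoC (INR n + INR j)) (c + RtoC (INR n) + RtoC (INR j))).
      rewrite Cmod_R, Rabs_pos_eq in H by lra.
      replace (RtoC (INR n + INR j) - (c + RtoC (INR n) + RtoC (INR j))) with (- c) in H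
        by (rewrite RtoC_plus; ring).
      rewrite Cmod_opp in H. lra. }
    assert (Hcnp : (0 < Cmod (c + RtoC (INR n)))%R).
    { apply Cmod_gt_0. now apply add_INR_neq_0. }
    assert (Hpoch : forall m, (Cmod (pochhammer c (S m)) * Cmod (c + RtoC (INR n))
      <= Cmod (pochhammer (c + RtoC (INR n)) (S m)) * Cmod c)%R).
    { induction m as [|m IH].
      - simpl. rewrite !Cplus_0_r, !Cmult_1_l. lra.
      - change (pochhammer c (S (S m))) with (pochhammer c (S m) * (c + RtoC (INR (S m)))).
        change (pochhammer (c + RtoC (INR n)) (S (S m))) with
          (pochhammer (c + RtoC (INR n)) (S m) * (c + RtoC (INR n) + RtoC (INR (S m)))).
        rewrite !Cmod_mult. specialize (Hj (S m)).
        assert (P1 := Cmod_ge_0 (c + RtoC (INR (S m)))).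
        assert (P2 := Cmod_ge_0 (pochhammer (c + RtoC (INR n)) (S m))).
        assert (P3 : (0 <= Cmod (pochhammer (c + RtoC (INR n)) (S m)) * Cmod c)%R)
          by (apply Rmult_le_pos; auto).
        nra. }
    assert (Hterm : forall m, (Cmod (hyp_term A B (c + RtoC (INR n)) (S m))
      <= Cmod c / Cmod (c + RtoC (INR n)) * (INR (S m) * Cmod (hyp_term A B c (S m))))%R).
    { intros m. specialize (Hpoch m). unfold hyp_term.
      assert (Z1 := pochhammer_neq_0 c (S m) Hc).
      assert (Z2 := pochhammer_neq_0 _ (S m) Hcn). assert (Z3 := fact_neq_0_C (S m)).
      rewrite !Cmod_div by (apply Cmult_neq_0; auto). rewrite !Cmod_mult.
      apply Cmod_gt_0 in Z1, Z2, Z3.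
      set (F := Cmod (RtoC (INR (fact (S m))))) in *.
      set (P := Cmod (pochhammer c (S m))) in *.
      set (P' := Cmod (pochhammer (c + RtoC (INR n)) (S m))) in *.
      set (X := Cmod (pochhammer A (S m))). set (Y := Cmod (pochhammer B (S m))).
      set (D := Cmod (c + RtoC (INR n))) in *.
      assert (HX : (0 <= X)%R) by apply Cmod_ge_0. assert (HY : (0 <= Y)%R) by apply Cmod_ge_0.
      assert (Hinv : (/ P' <= Cmod c / D * / P)%R).
      { apply Rmult_le_reg_r with (P' * D * P)%R; [apply Rmult_lt_0_compat; [apply Rmult_lt_0_compat|]; auto|].
        replace (/ P' * (P' * D * P))%R with (P * D)%R by (field; lra).
        replace (Cmod c / D * / P * (P' * D * P))%R with (P' * Cmod c)%R by (field; lra). exact Hpoch. }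
      apply Rle_trans with (X * Y * / F * (Cmod c / D * / P))%R.
      - replace (X * Y / (F * P'))%R with (X * Y * / F * / P')%R by (field; lra).
        apply Rmult_le_compat_l; auto. apply Rmult_le_pos; [nra|]. left. now apply Rinv_0_lt_compat.
      - replace (Cmod c / D * (INR (S m) * (X * Y / (F * P))))%R with
          (INR (S m) * (X * Y * / F * (Cmod c / D * / P)))%R by (field; lra).
        assert (0 <= X * Y * / F * (Cmod c / D * / P))%R.
        { apply Rmult_le_pos; [apply Rmult_le_pos; [nra|left; now apply Rinv_0_lt_compat]|].
          apply Rmult_le_pos; [apply Rmult_le_pos; auto|]; left; now apply Rinv_0_lt_compat. }
        rewrite S_INR. assert (H0 := pos_INR m). nra. }
    assert (Hcv : Ccv (fun k => csum (hyp_term A B (c + RtoC (INR n))) (S k) - 1)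
      (hyp_sum A B (c + RtoC (INR n)) - 1)).
    { apply Ccv_minus; [|apply Ccv_const].
      apply (Ccv_incr (csum (hyp_term A B (c + RtoC (INR n))))).
      apply hyp_sum_cv; auto. assert (Hn0 := pos_INR n).
      rewrite !Re_minus in *. rewrite Re_plus, re_RtoC. lra. }
    assert (Hfin : (Cmod (hyp_sum A B (c + RtoC (INR n)) - 1) <= Cmod c / Cmod (c + RtoC (INR n)) * M)%R).
    { apply (Ccv_Cmod_le _ _ _ Hcv). intros k. rewrite csum_S_hyp_term.
      replace (1 + csum (fun m => hyp_term A B (c + RtoC (INR n)) (S m) * 1) k - 1) with
        (csum (fun m => hyp_term A B (c + RtoC (INR n)) (S m) * 1) k) by ring.
      eapply Rle_trans; [apply Cmod_csum_le|].
      eapply Rle_trans; [apply rsum_le; intros m _; rewrite Cmult_1_r; apply Hterm|].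
      rewrite rsum_scal. apply Rmult_le_compat_l.
      - apply Rmult_le_pos; auto. left. now apply Rinv_0_lt_compat.
      - eapply Rle_trans; [|apply (HS (S k))]. clear.
        induction k as [|k IH]; [simpl; lra|].
        change (rsum (fun m => INR m * Cmod (hyp_term A B c m)) (S (S k)))%R with
          (rsum (fun m => INR m * Cmod (hyp_term A B c m)) (S k)
           + INR (S k) * Cmod (hyp_term A B c (S k)))%R.
        change (rsum (fun m => INR (S m) * Cmod (hyp_term A B c (S m))) (S k))%R with
          (rsum (fun m => INR (S m) * Cmod (hyp_term A B c (S m))) k
           + INR (S k) * Cmod (hyp_term A B c (S k)))%R.
        lra. }
    eapply Rle_trans; [exact Hfin|]. specialize (Hdn n). assert (Hn0 := pos_INR n).
    replace (M * (Cmod c / d) * / (INR n + 1))%R with (Cmod c * / (d * (INR n + 1)) * M)%R by (field; lra).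
    apply Rmult_le_compat_r; [lra|]. apply Rmult_le_compat_l; auto.
    apply Rinv_le_contravar; auto. apply Rmult_lt_0_compat; lra.
  - apply Ccv_squeeze with (fun n => K / (INR n + 1))%R; [exact H|apply is_lim_seq_inv_S].
Qed.

Definition gauss_factor (A B c : C) (k : nat) : C :=
  (c - A + RtoC (INR k)) * (c - B + RtoC (INR k))
  / ((c + RtoC (INR k)) * (c - A - B + RtoC (INR k))).

Lemma neq_opp_INR_of_Re_pos (z : C) : (0 < Re z)%R -> forall k : nat, z <> - RtoC (INR k).
Proof.
  intros H k ->. rewrite <- RtoC_opp, re_RtoC in H. assert (Hk := pos_INR k). lra.
Qed.

(** Numerator minus denominator is the constant A B, so the factor is 1 + A B / ((c + k)(c - A - B +
    k)). *)
Lemma gauss_factor_close (A B c : C) :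
  (forall k : nat, c <> - RtoC (INR k)) -> (0 < Re (c - A - B))%R ->
  exists K, forall k, (Cmod (gauss_factor A B c k - 1) <= K * / (INR k + 1) ^ 2)%R.
Proof.
  intros Hc Hre. assert (Hs := neq_opp_INR_of_Re_pos _ Hre).
  destruct (Cmod_add_INR_ge c Hc) as [d1 [Hd1 H1]].
  destruct (Cmod_add_INR_ge _ Hs) as [d2 [Hd2 H2]].
  exists (Cmod (A * B) * (/ d1 * / d2))%R. intros k.
  assert (Z1 := add_INR_neq_0 c k Hc). assert (Z2 := add_INR_neq_0 _ k Hs).
  replace (gauss_factor A B c k - 1) with
    (A * B * (/ (c + RtoC (INR k)) * / (c - A - B + RtoC (INR k)))) by (unfold gauss_factor; field; auto).
  rewrite (Cmod_mult (A * B)), (Cmod_mult (/ _)). rewrite Rmult_assoc.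
  apply Rmult_le_compat_l; [apply Cmod_ge_0|].
  assert (Hk := pos_INR k).
  replace (/ d1 * / d2 * / (INR k + 1) ^ 2)%R with
    ((/ d1 * / (INR k + 1)) * (/ d2 * / (INR k + 1)))%R by (field; lra).
  apply Rmult_le_compat; auto using Cmod_ge_0, inv_add_INR_bound.
Qed.

(** Iterating the contiguous relation leaves the remainder 2F1(A, B; c + n; 1), which tends to 1. *)
Lemma gauss_product (A B c : C) :
  (forall k : nat, c <> - RtoC (INR k)) -> (1 < Re (c - A - B))%R ->
  Ccv (cprod (gauss_factor A B c)) (hyp_sum A B c).
Proof.
  intros Hc Hre.
  destruct (gauss_factor_close A B c Hc) as [K HK]; [lra|].
  destruct (cprod_cv _ K HK) as [l Hl].
  assert (E : forall n, hyp_sum A B c = cprod (gauss_factor A B c) n * hyp_sum A B (c + RtoC (INR n))).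
  { induction n as [|n IH].
    - simpl. rewrite Cplus_0_r. ring.
    - rewrite IH. change (cprod (gauss_factor A B c) (S n)) with
        (cprod (gauss_factor A B c) n * gauss_factor A B c n).
      rewrite <- Cmult_assoc. f_equal.
      assert (Hn0 := pos_INR n).
      assert (Hre' : (1 < Re (c + RtoC (INR n) - A - B))%R)
        by (rewrite !Re_minus in *; rewrite Re_plus, re_RtoC; lra).
      assert (G := gauss_step A B (c + RtoC (INR n)) (add_INR_neq c n Hc) Hre').
      replace (c + RtoC (INR n) + 1) with (c + RtoC (INR (S n))) in G by (rewrite RtoC_INR_S; ring).
      assert (Z1 := add_INR_neq_0 c n Hc).
      assert (Z2 : c - A - B + RtoC (INR n) <> 0).
      { apply add_INR_neq_0, neq_opp_INR_of_Re_pos. lra. }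
      unfold gauss_factor.
      replace (hyp_sum A B (c + RtoC (INR n))) with
        ((c + RtoC (INR n)) * (c + RtoC (INR n) - A - B) * hyp_sum A B (c + RtoC (INR n))
         / ((c + RtoC (INR n)) * (c - A - B + RtoC (INR n)))).
      + rewrite G. field. auto.
      + field. auto. }
  replace (hyp_sum A B c) with l; auto.
  assert (H : l * 1 = hyp_sum A B c).
  { apply (Ccv_unique (fun n => cprod (gauss_factor A B c) n * hyp_sum A B (c + RtoC (INR n)))).
    - apply Ccv_mult; auto. now apply hyp_sum_shift_cv.
    - eapply Ccv_ext; [exact E|]. apply Ccv_const. }
  rewrite <- H. ring.
Qed.

(** * Watson's recursion *)

(* [watson_weight k j] is [(k)_m / (2k)_m] for [m = j + 1], continued to [k = 0];
   [watson_dlog k j] is its logarithmic derivative in [k]. *)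
Fixpoint watson_weight (k : R) (j : nat) : R :=
  match j with
  | O => / 2
  | S i => watson_weight k i * ((k + INR (S i)) / (2 * k + INR (S i)))
  end%R.

Fixpoint watson_dlog (k : R) (j : nat) : R :=
  match j with
  | O => 0
  | S i => watson_dlog k i - INR (S i) / ((k + INR (S i)) * (2 * k + INR (S i)))
  end%R.

Lemma watson_weight_S (k : R) (j : nat) : watson_weight k (S j) =
  (watson_weight k j * ((k + (INR j + 1)) / (2 * k + (INR j + 1))))%R.
Proof. rewrite <- S_INR. reflexivity. Qed.

Lemma watson_dlog_S (k : R) (j : nat) : watson_dlog k (S j) =
  (watson_dlog k j - (INR j + 1) / ((k + (INR j + 1)) * (2 * k + (INR j + 1))))%R.
Proof. rewrite <- S_INR. reflexivity. Qed.

Lemma watson_weight_bounds (k : R) (j : nat) : (0 <= k)%R -> (0 <= watson_weight k j <= 1)%R.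
Proof.
  intros Hk. induction j as [|j IH]; [simpl; lra|].
  rewrite watson_weight_S. assert (Hj := pos_INR j).
  assert (H : (0 <= (k + (INR j + 1)) / (2 * k + (INR j + 1)) <= 1)%R).
  { split.
    - apply Rmult_le_pos; [lra|left; apply Rinv_0_lt_compat; lra].
    - apply div_le_of_le_mul; lra. }
  nra.
Qed.

Lemma watson_dlog_le_Hsum (k : R) (j : nat) : (0 <= k)%R -> (Rabs (watson_dlog k j) <= Hsum j)%R.
Proof.
  intros Hk. induction j as [|j IH].
  - simpl. rewrite Rabs_R0. unfold Hsum. simpl. lra.
  - change (Hsum (S j)) with (Hsum j + / (INR j + 1))%R. rewrite watson_dlog_S.
    assert (Hj := pos_INR j). eapply Rle_trans; [apply Rabs_triang|]. rewrite Rabs_Ropp.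
    apply Rplus_le_compat; auto. rewrite Rabs_pos_eq.
    + apply div_le_of_le_mul; [nra|].
      apply Rmult_le_reg_l with (INR j + 1)%R; [lra|].
      replace ((INR j + 1) * (/ (INR j + 1) * ((k + (INR j + 1)) * (2 * k + (INR j + 1)))))%R with
        ((k + (INR j + 1)) * (2 * k + (INR j + 1)))%R by (field; lra). nra.
    + apply Rmult_le_pos; [lra|]. left. apply Rinv_0_lt_compat. nra.
Qed.

(** Each subtracted fraction is at most 1/(k+1). This bound grows linearly in j but decays in k, and
    against the finite sum of m |t_m| it gives W'(k) = O(1/k). The bound by [Hsum] is the one fit
    for boundary terms, where only a logarithm in j is affordable. *)
Lemma watson_dlog_le_div (k j : nat) :
  (Rabs (watson_dlog (INR k) j) <= / (INR k + 1) * INR j)%R.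
Proof.
  assert (Hk := pos_INR k). assert (Hi : (0 < / (INR k + 1))%R) by (apply Rinv_0_lt_compat; lra).
  induction j as [|j IH].
  - simpl. rewrite Rabs_R0. lra.
  - rewrite watson_dlog_S, S_INR.
    replace (/ (INR k + 1) * (INR j + 1))%R with (/ (INR k + 1) * INR j + / (INR k + 1))%R by ring.
    assert (Hj := pos_INR j). eapply Rle_trans; [apply Rabs_triang|]. rewrite Rabs_Ropp.
    apply Rplus_le_compat; auto. rewrite Rabs_pos_eq.
    + apply div_le_of_le_mul; [nra|].
      apply Rmult_le_reg_l with (INR k + 1)%R; [lra|].
      replace ((INR k + 1) * (/ (INR k + 1) * ((INR k + (INR j + 1)) * (2 * INR k + (INR j + 1)))))%R with
        ((INR k + (INR j + 1)) * (2 * INR k + (INR j + 1)))%R by (field; lra). nra.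
    + apply Rmult_le_pos; [lra|]. left. apply Rinv_0_lt_compat. nra.
Qed.

(** The quotient of (k+1)_m / (2k+2)_m by (k)_m / (2k)_m, with m = j + 1 and the common factor k
    cancelled, so that it also holds at k = 0. The next lemma is its logarithmic derivative in k. *)
Lemma watson_weight_succ (k : R) (j : nat) : (0 <= k)%R ->
  watson_weight (k + 1) j = (watson_weight k j * (2 * (2 * k + 1) * (k + (INR j + 1))
    / ((2 * k + (INR j + 1)) * (2 * k + (INR j + 1) + 1))))%R.
Proof.
  intros Hk. induction j as [|j IH].
  - simpl. field. lra.
  - rewrite !watson_weight_S, IH, S_INR. assert (Hj := pos_INR j). field. lra.
Qed.

Lemma watson_dlog_succ (k : R) (j : nat) : (0 <= k)%R ->
  watson_dlog (k + 1) j = (watson_dlog k j + (2 / (2 * k + 1) + / (k + (INR j + 1))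
    - 2 / (2 * k + (INR j + 1)) - 2 / (2 * k + (INR j + 1) + 1)))%R.
Proof.
  intros Hk. induction j as [|j IH].
  - simpl. field. lra.
  - rewrite !watson_dlog_S, IH, S_INR. assert (Hj := pos_INR j). field. lra.
Qed.

Section Watson.

Variables A B c : C.
Hypothesis Hc : forall k : nat, c <> - RtoC (INR k).
Hypothesis Hre : (1 < Re (1 - c))%R.
Hypothesis HB : B = 2 * c - 1 - A.

Let Hre' : (1 < Re (c - A - B))%R.
Proof. replace (c - A - B) with (1 - c) by (rewrite HB; ring). exact Hre. Qed.

(** The term m = 0 is split off: its weight is 1 for every k, while the continued weights for m >= 1
    equal 1/2 at k = 0. *)
Definition watson_sum (k : nat) : C :=
  1 + Clim (csum (fun j => hyp_term A B c (S j) * RtoC (watson_weight (INR k) j))).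

Definition watson_dsum (k : nat) : C :=
  Clim (csum (fun j => hyp_term A B c (S j)
    * RtoC (watson_weight (INR k) j * watson_dlog (INR k) j))).

(** The r(k) of the overview, written so that r(k) - 1 = O(1/k^2) is visible and [watson_dratio],
    its derivative in k, is immediate. The factored form is derived once a and b are available. *)
Definition watson_ratio (k : nat) : C :=
  1 + A * B / (2 * (2 * RtoC (INR k) + 1) * (RtoC (INR k) + 1 - c)).

Definition watson_dratio (k : nat) : C :=
  - (A * B / (2 * (2 * RtoC (INR k) + 1) * (RtoC (INR k) + 1 - c))
     * (2 / (2 * RtoC (INR k) + 1) + / (RtoC (INR k) + 1 - c))).

Lemma watson_sum_cv (k : nat) :
  Ccv (csum (fun j => hyp_term A B c (S j) * RtoC (watson_weight (INR k) j))) (watson_sum k - 1).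
Proof.
  assert (E : forall x : C, 1 + x - 1 = x) by (intros; ring).
  unfold watson_sum. rewrite E.
  apply (hyp_tail_sum A B c _ 1 Hc Hre'). intros n. rewrite Cmod_R.
  assert (H := watson_weight_bounds (INR k) n (pos_INR k)). rewrite Rabs_pos_eq by lra.
  rewrite S_INR. assert (Hn := pos_INR n). lra.
Qed.

Lemma watson_dterm_bound (k j : nat) :
  (Cmod (RtoC (watson_weight (INR k) j * watson_dlog (INR k) j)) <= / (INR k + 1) * INR j)%R.
Proof.
  rewrite Cmod_R, Rabs_mult. assert (H := watson_weight_bounds (INR k) j (pos_INR k)).
  assert (H1 := watson_dlog_le_div k j). assert (H2 := Rabs_pos (watson_dlog (INR k) j)).
  rewrite (Rabs_pos_eq (watson_weight _ _)) by lra. nra.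
Qed.

Lemma watson_dterm_bound_S (k j : nat) :
  (Cmod (RtoC (watson_weight (INR k) j * watson_dlog (INR k) j)) <= / (INR k + 1) * INR (S j))%R.
Proof.
  eapply Rle_trans; [apply watson_dterm_bound|]. rewrite S_INR.
  assert (Hk := pos_INR k). assert (Hi : (0 < / (INR k + 1))%R) by (apply Rinv_0_lt_compat; lra).
  nra.
Qed.

Lemma watson_dsum_cv (k : nat) :
  Ccv (csum (fun j => hyp_term A B c (S j)
    * RtoC (watson_weight (INR k) j * watson_dlog (INR k) j))) (watson_dsum k).
Proof. exact (hyp_tail_sum A B c _ _ Hc Hre' (watson_dterm_bound_S k)). Qed.

(* [X] is the telescoping certificate and [X'] its derivative in [k]. *)
Let Q (k j : nat) : C :=
  - (RtoC (watson_weight (INR k) j)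
     * ((RtoC (INR (S j)) + c - 1) / ((RtoC (INR k) + 1 - c) * (2 * RtoC (INR k) + RtoC (INR (S j)))))).

Let X (k j : nat) : C := RtoC (INR (S j)) * hyp_term A B c (S j) * Q k j.

Let X' (k j : nat) : C :=
  X k j * (RtoC (watson_dlog (INR k) j) - / (RtoC (INR k) + 1 - c)
    - 2 / (2 * RtoC (INR k) + RtoC (INR (S j)))).

Let D1 (k : nat) : RtoC (INR k) + 1 - c <> 0.
Proof.
  replace (RtoC (INR k) + 1 - c) with (1 - c + RtoC (INR k)) by ring.
  apply add_INR_neq_0, neq_opp_INR_of_Re_pos. lra.
Qed.

Let D2 (k j : nat) : 2 * RtoC (INR k) + RtoC (INR j) + 1 <> 0.
Proof.
  rewrite <- RtoC_mult, <- !RtoC_plus. intros E. apply RtoC_inj in E.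
  assert (H1 := pos_INR k). assert (H2 := pos_INR j). lra.
Qed.

Let D3 (k j : nat) : RtoC (INR k) + (RtoC (INR j) + 1) <> 0.
Proof.
  rewrite <- !RtoC_plus. intros E. apply RtoC_inj in E.
  assert (H1 := pos_INR k). assert (H2 := pos_INR j). lra.
Qed.

Let D4 (k : nat) : 2 * RtoC (INR k) + 1 <> 0.
Proof. assert (H := D2 k 0). simpl in H. rewrite Cplus_0_r in H. exact H. Qed.

Let D5 (j : nat) : c + RtoC (INR j) + 1 <> 0.
Proof.
  assert (H := add_INR_neq_0 c (S j) Hc). rewrite RtoC_INR_S in H. rewrite Cplus_assoc in H. exact H.
Qed.

Let D6 (k j : nat) : 2 * RtoC (INR k) + RtoC (INR j) + 1 + 1 <> 0.
Proof.
  assert (H := D2 k (S j)). rewrite RtoC_INR_S in H. rewrite !Cplus_assoc in *. exact H.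
Qed.

(** These four restate the recursions over C with sums associated to the left, so that [field] meets
    the denominators of the certificate in one shape. *)
Let weight_succ_C (k j : nat) : RtoC (watson_weight (INR (S k)) j) =
  RtoC (watson_weight (INR k) j) * (2 * (2 * RtoC (INR k) + 1) * (RtoC (INR k) + RtoC (INR j) + 1)
    / ((2 * RtoC (INR k) + RtoC (INR j) + 1) * (2 * RtoC (INR k) + RtoC (INR j) + 1 + 1))).
Proof.
  rewrite S_INR, watson_weight_succ by apply pos_INR.
  assert (Hk := pos_INR k). assert (Hj := pos_INR j).
  rewrite RtoC_mult, RtoC_div by nra. repeat (rewrite RtoC_mult || rewrite RtoC_plus).
  now rewrite !Cplus_assoc.
Qed.

Let dlog_succ_C (k j : nat) : RtoC (watson_dlog (INR (S k)) j) =
  RtoC (watson_dlog (INR k) j) + (2 / (2 * RtoC (INR k) + 1) + / (RtoC (INR k) + RtoC (INR j) + 1)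
    - 2 / (2 * RtoC (INR k) + RtoC (INR j) + 1) - 2 / (2 * RtoC (INR k) + RtoC (INR j) + 1 + 1)).
Proof.
  rewrite S_INR, watson_dlog_succ by apply pos_INR.
  assert (Hk := pos_INR k). assert (Hj := pos_INR j).
  rewrite RtoC_plus, !RtoC_minus, RtoC_plus, !RtoC_div, RtoC_inv by lra.
  repeat (rewrite RtoC_mult || rewrite RtoC_plus). now rewrite !Cplus_assoc.
Qed.

Let weight_S_C (k j : nat) : RtoC (watson_weight (INR k) (S j)) =
  RtoC (watson_weight (INR k) j) * ((RtoC (INR k) + RtoC (INR j) + 1) / (2 * RtoC (INR k) + RtoC (INR j) + 1)).
Proof.
  rewrite watson_weight_S. assert (Hk := pos_INR k). assert (Hj := pos_INR j).
  rewrite RtoC_mult, RtoC_div by lra. repeat (rewrite RtoC_mult || rewrite RtoC_plus). now rewrite !Cplus_assoc.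
Qed.

Let dlog_S_C (k j : nat) : RtoC (watson_dlog (INR k) (S j)) =
  RtoC (watson_dlog (INR k) j) - (RtoC (INR j) + 1) / ((RtoC (INR k) + RtoC (INR j) + 1) * (2 * RtoC (INR k) + RtoC (INR j) + 1)).
Proof.
  rewrite watson_dlog_S. assert (Hk := pos_INR k). assert (Hj := pos_INR j).
  rewrite RtoC_minus, RtoC_div by nra. repeat (rewrite RtoC_mult || rewrite RtoC_plus).
  now rewrite !Cplus_assoc.
Qed.

(** Once everything is expressed by the term and the weight at j and k, both are common factors and
    a rational identity in k and j remains. It rests on B = 2c - 1 - A, Watson's condition on the
    parameters. *)
Let X_step (k j : nat) :
  hyp_term A B c (S j) * RtoC (watson_weight (INR k) j)
  - watson_ratio k * (hyp_term A B c (S j) * RtoC (watson_weight (INR (S k)) j))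
  = X k (S j) - X k j.
Proof.
  unfold X, Q, watson_ratio. rewrite (hyp_term_S A B c (S j) Hc), weight_succ_C, weight_S_C.
  rewrite !RtoC_INR_S.
  assert (E1 := D1 k). assert (E2 := D2 k j). assert (E3 := D3 k j). assert (E4 := D4 k).
  assert (E5 := D5 j). assert (E6 := D6 k j). rewrite Cplus_assoc in E3.
  assert (E7 := INR_S_neq_0 (S j)). rewrite RtoC_INR_S in E7.
  rewrite HB. rewrite !Cplus_assoc in *.
  set (t := hyp_term A (2 * c - 1 - A) c (S j)).
  set (w := RtoC (watson_weight (INR k) j)). set (x := RtoC (INR k)) in *. set (y := RtoC (INR j)) in *.
  field. repeat split; auto.
Qed.

(** The derivative of [X_step] in k by the product rule. The logarithmic derivative of the weight
    enters linearly, as one more indeterminate of a rational identity. *)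
Let X'_step (k j : nat) :
  hyp_term A B c (S j) * RtoC (watson_weight (INR k) j * watson_dlog (INR k) j)
  - watson_dratio k * (hyp_term A B c (S j) * RtoC (watson_weight (INR (S k)) j))
  - watson_ratio k * (hyp_term A B c (S j) * RtoC (watson_weight (INR (S k)) j * watson_dlog (INR (S k)) j))
  = X' k (S j) - X' k j.
Proof.
  unfold X', X, Q, watson_ratio, watson_dratio. rewrite !RtoC_mult.
  rewrite (hyp_term_S A B c (S j) Hc), weight_succ_C, weight_S_C, dlog_succ_C, dlog_S_C.
  rewrite !RtoC_INR_S.
  assert (E1 := D1 k). assert (E2 := D2 k j). assert (E3 := D3 k j). assert (E4 := D4 k).
  assert (E5 := D5 j). assert (E6 := D6 k j). rewrite Cplus_assoc in E3.
  assert (E7 := INR_S_neq_0 (S j)). rewrite RtoC_INR_S in E7.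
  rewrite HB. rewrite !Cplus_assoc in *.
  set (t := hyp_term A (2 * c - 1 - A) c (S j)). set (s := RtoC (watson_dlog (INR k) j)).
  set (w := RtoC (watson_weight (INR k) j)). set (x := RtoC (INR k)) in *. set (y := RtoC (INR j)) in *.
  field. repeat split; auto.
Qed.


Let Q_bound (k : nat) : exists K, (0 <= K)%R /\ forall j, (Cmod (Q k j) <= K)%R.
Proof.
  set (e := Cmod (RtoC (INR k) + 1 - c)).
  assert (He : (0 < e)%R) by (apply Cmod_gt_0, D1).
  assert (Hc0 := Cmod_ge_0 c).
  exists ((1 + Cmod c) / e)%R. split.
  { apply Rmult_le_pos; [lra|]. left. now apply Rinv_0_lt_compat. }
  intros j. unfold Q. assert (Hw := watson_weight_bounds (INR k) j (pos_INR k)).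
  assert (Hk := pos_INR k). assert (Hj := pos_INR j).
  rewrite <- RtoC_mult, <- (RtoC_plus (2 * INR k)).
  assert (Hd : (0 < 2 * INR k + INR (S j))%R) by (rewrite S_INR; lra).
  rewrite Cmod_opp, Cmod_mult, Cmod_div.
  2:{ apply Cmult_neq_0; [apply D1|]. intros E. apply RtoC_inj in E. lra. }
  rewrite Cmod_mult, !Cmod_R, (Rabs_pos_eq (watson_weight _ _)), (Rabs_pos_eq (2 * INR k + _)) by lra.
  fold e.
  assert (Hn : (Cmod (RtoC (INR (S j)) + c - 1) <= INR j + Cmod c)%R).
  { rewrite RtoC_INR_S. replace (RtoC (INR j) + 1 + c - 1) with (RtoC (INR j) + c) by ring.
    eapply Rle_trans; [apply Cmod_triangle|]. rewrite Cmod_R, Rabs_pos_eq; lra. }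
  assert (Hq : (Cmod (RtoC (INR (S j)) + c - 1) / (e * (2 * INR k + INR (S j))) <= (1 + Cmod c) / e)%R).
  { apply div_le_of_le_mul; [now apply Rmult_lt_0_compat|].
    replace ((1 + Cmod c) / e * (e * (2 * INR k + INR (S j))))%R with
      ((1 + Cmod c) * (2 * INR k + INR (S j)))%R by (field; lra).
    rewrite S_INR in *. nra. }
  assert (Hq0 : (0 <= Cmod (RtoC (INR (S j)) + c - 1) / (e * (2 * INR k + INR (S j))))%R).
  { apply Rmult_le_pos; [apply Cmod_ge_0|]. left. apply Rinv_0_lt_compat.
    now apply Rmult_lt_0_compat. }
  nra.
Qed.

Let X_cv (k : nat) : Ccv (X k) 0.
Proof.
  destruct (Q_bound k) as [K [HK H]].
  apply (mul_hyp_term_cv A B c (Q k) K Hc Hre').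
  intros j. eapply Rle_trans; [apply H|]. assert (HH := Hsum_nonneg (S j)). nra.
Qed.

Let X'_cv (k : nat) : Ccv (X' k) 0.
Proof.
  destruct (Q_bound k) as [K [HK H]].
  set (e := Cmod (/ (RtoC (INR k) + 1 - c))). assert (He : (0 <= e)%R) by apply Cmod_ge_0.
  eapply Ccv_ext; [|apply (mul_hyp_term_cv A B c (fun j => Q k j * (RtoC (watson_dlog (INR k) j) - / (RtoC (INR k) + 1 - c)
    - 2 / (2 * RtoC (INR k) + RtoC (INR (S j))))) (K * (3 + e)) Hc Hre')].
  { intros j. unfold X', X. ring. }
  intros j. cbv beta. rewrite Cmod_mult, Rmult_assoc.
  apply Rmult_le_compat; auto using Cmod_ge_0.
  assert (Hk := pos_INR k). assert (Hj := pos_INR j).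
  assert (H2 : (Cmod (2 / (2 * RtoC (INR k) + RtoC (INR (S j)))) <= 2)%R).
  { rewrite <- RtoC_mult, <- RtoC_plus. rewrite Cmod_div.
    - rewrite !Cmod_R, (Rabs_pos_eq 2), Rabs_pos_eq; rewrite ?S_INR; try lra.
      apply div_le_of_le_mul; lra.
    - intros E. apply RtoC_inj in E. rewrite S_INR in E. lra. }
  assert (H3 := watson_dlog_le_Hsum (INR k) j Hk).
  assert (H4 : (Hsum j <= Hsum (S j))%R).
  { change (Hsum (S j)) with (Hsum j + / (INR j + 1))%R.
    assert (0 < / (INR j + 1))%R by (apply Rinv_0_lt_compat; lra). lra. }
  assert (H5 := Hsum_nonneg j).
  eapply Rle_trans; [apply Cmod_minus_le|].
  assert (H6 := Cmod_minus_le (RtoC (watson_dlog (INR k) j)) (/ (RtoC (INR k) + 1 - c))).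
  rewrite Cmod_R in H6. fold e in H6. nra.
Qed.

Let c_neq_0 : c <> 0.
Proof. rewrite <- (Cplus_0_r c). exact (add_INR_neq_0 c 0 Hc). Qed.

(** The initial value of the certificate accounts exactly for the split-off terms m = 0, which
    contribute 1 to W(k) and r(k) to r(k) W(k+1). Likewise [X'] starts at -r'(k). *)
Let X_0 (k : nat) : X k 0 = 1 - watson_ratio k.
Proof.
  unfold X, Q, watson_ratio. rewrite hyp_term_S, hyp_term_0 by auto. simpl watson_weight.
  rewrite RtoC_inv by lra. simpl INR. assert (E1 := D1 k). assert (E4 := D4 k).
  field. repeat split; auto.
Qed.

Lemma watson_sum_rec (k : nat) : watson_sum k = watson_ratio k * watson_sum (S k).
Proof.
  assert (H := Ccv_minus _ _ _ _ (watson_sum_cv k)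
    (Ccv_scal _ (watson_ratio k) _ (watson_sum_cv (S k)))).
  assert (H' : Ccv (fun n => X k n - X k 0) (0 - X k 0)).
  { apply Ccv_minus; auto. apply Ccv_const. }
  assert (E : watson_sum k - 1 - watson_ratio k * (watson_sum (S k) - 1) = 0 - X k 0).
  { refine (Ccv_unique _ _ _ _ H'). eapply Ccv_ext; [|exact H].
    intros n. cbv beta. rewrite <- csum_scal, <- csum_minus, <- csum_telescope.
    apply csum_ext. intros j. apply X_step. }
  rewrite X_0 in E.
  replace (watson_sum k) with ((watson_sum k - 1 - watson_ratio k * (watson_sum (S k) - 1))
    + 1 + watson_ratio k * (watson_sum (S k) - 1)) by ring.
  rewrite E. ring.
Qed.

Lemma watson_dsum_rec (k : nat) :
  watson_dsum k = watson_dratio k * watson_sum (S k) + watson_ratio k * watson_dsum (S k).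
Proof.
  assert (H := Ccv_minus _ _ _ _ (Ccv_minus _ _ _ _ (watson_dsum_cv k)
    (Ccv_scal _ (watson_dratio k) _ (watson_sum_cv (S k))))
    (Ccv_scal _ (watson_ratio k) _ (watson_dsum_cv (S k)))).
  assert (H' : Ccv (fun n => X' k n - X' k 0) (0 - X' k 0)).
  { apply Ccv_minus; auto. apply Ccv_const. }
  assert (E : watson_dsum k - watson_dratio k * (watson_sum (S k) - 1)
    - watson_ratio k * watson_dsum (S k) = 0 - X' k 0).
  { refine (Ccv_unique _ _ _ _ H'). eapply Ccv_ext; [|exact H].
    intros n. cbv beta. rewrite <- !csum_scal, <- !csum_minus, <- csum_telescope.
    apply csum_ext. intros j. apply X'_step. }
  assert (E0 : X' k 0 = - watson_dratio k).
  { unfold X'. rewrite X_0. unfold watson_ratio, watson_dratio. simpl watson_dlog. simpl INR.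
    assert (E1 := D1 k). assert (E4 := D4 k). field. repeat split; auto. }
  rewrite E0 in E.
  replace (watson_dsum k) with ((watson_dsum k - watson_dratio k * (watson_sum (S k) - 1)
    - watson_ratio k * watson_dsum (S k)) + watson_dratio k * (watson_sum (S k) - 1)
    + watson_ratio k * watson_dsum (S k)) by ring.
  rewrite E. ring.
Qed.

Lemma watson_dsum_bound : exists M, forall k, (Cmod (watson_dsum k) <= M / (INR k + 1))%R.
Proof.
  destruct (hyp_term_decay A B c Hc Hre') as [M [HM [H _]]]. exists M. intros k.
  assert (Hk := pos_INR k). assert (Hi : (0 < / (INR k + 1))%R) by (apply Rinv_0_lt_compat; lra).
  apply (Ccv_Cmod_le _ _ _ (watson_dsum_cv k)). intros n.
  eapply Rle_trans; [apply Cmod_csum_le|].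
  apply Rle_trans with (/ (INR k + 1) * rsum (fun m => INR m * Cmod (hyp_term A B c m)) (S n))%R.
  2:{ unfold Rdiv. rewrite Rmult_comm. apply Rmult_le_compat_r; [lra|auto]. }
  clear H. induction n as [|n IH]; [simpl; lra|].
  change (rsum (fun m => INR m * Cmod (hyp_term A B c m)) (S (S n)))%R with
    (rsum (fun m => INR m * Cmod (hyp_term A B c m)) (S n)
     + INR (S n) * Cmod (hyp_term A B c (S n)))%R.
  rewrite Rmult_plus_distr_l. simpl rsum at 1. apply Rplus_le_compat; [exact IH|].
  rewrite Cmod_mult. assert (H1 := watson_dterm_bound_S k n).
  assert (H2 := Cmod_ge_0 (hyp_term A B c (S n))). nra.
Qed.

Lemma watson_ratio_bound :
  exists K, forall k, (Cmod (watson_ratio k - 1) <= K * / (INR k + 1) ^ 2)%R.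
Proof.
  assert (Hs := neq_opp_INR_of_Re_pos (1 - c) ltac:(lra)).
  destruct (Cmod_add_INR_ge _ Hs) as [d [Hd H]].
  exists (Cmod (A * B) * / d)%R. intros k. specialize (H k).
  replace (watson_ratio k - 1) with (A * B * (/ RtoC (2 * (2 * INR k + 1)) * / (1 - c + RtoC (INR k)))).
  2:{ unfold watson_ratio. assert (E1 := D1 k). assert (E4 := D4 k).
      repeat (rewrite RtoC_mult || rewrite RtoC_plus). field. repeat split; auto. }
  rewrite Cmod_mult, Rmult_assoc. apply Rmult_le_compat_l; [apply Cmod_ge_0|].
  assert (Hk := pos_INR k). rewrite Cmod_mult.
  replace (/ d * / (INR k + 1) ^ 2)%R with (/ (INR k + 1) * (/ d * / (INR k + 1)))%R by (field; lra).
  apply Rmult_le_compat; auto using Cmod_ge_0, inv_add_INR_bound.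
  rewrite Cmod_inv, Cmod_R, Rabs_pos_eq by (try lra; intros E; apply RtoC_inj in E; lra).
  apply Rinv_le_contravar; lra.
Qed.

Lemma watson_dsum_0 (P : C) : (forall k, watson_ratio k <> 0) ->
  Ccv (csum (fun k => watson_dratio k / watson_ratio k)) P ->
  watson_dsum 0 = watson_sum 0 * P.
Proof.
  intros Hr HP. set (p := cprod watson_ratio).
  assert (EW : forall n, watson_sum 0 = p n * watson_sum n).
  { induction n as [|n IH]; [unfold p; simpl; ring|].
    rewrite IH, (watson_sum_rec n). unfold p. simpl. ring. }
  (* Unrolled with remainder p_n W'(n). The partial products p_n of r are bounded, since r(k) = 1 +
     O(1/k^2), so the remainder tends to 0 with W'(n). *)
  assert (ED : forall n, watson_dsum 0 =
    watson_sum 0 * csum (fun k => watson_dratio k / watson_ratio k) n + p n * watson_dsum n).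
  { induction n as [|n IH]; [unfold p; simpl; ring|].
    change (csum (fun k => watson_dratio k / watson_ratio k) (S n)) with
      (csum (fun k => watson_dratio k / watson_ratio k) n + watson_dratio n / watson_ratio n).
    rewrite Cmult_plus_distr_l. rewrite (EW (S n)) at 2. rewrite IH at 1.
    rewrite (watson_dsum_rec n). change (p (S n)) with (p n * watson_ratio n). field. auto. }
  destruct watson_dsum_bound as [M HM]. destruct watson_ratio_bound as [K HK].
  assert (Hp := cprod_bounded _ _ HK). fold p in Hp.
  assert (H0 : Ccv (fun n => p n * watson_dsum n) 0).
  { apply Ccv_squeeze with (fun n => exp (2 * K) * M / (INR n + 1))%R; [|apply is_lim_seq_inv_S].
    intros n. replace (p n * watson_dsum n - 0) with (p n * watson_dsum n) by ring.
    rewrite Cmod_mult. unfold Rdiv. rewrite Rmult_assoc.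
    apply Rmult_le_compat; auto using Cmod_ge_0. }
  assert (H1 := Ccv_plus _ _ _ _ (Ccv_scal _ (watson_sum 0) _ HP) H0).
  rewrite Cplus_0_r in H1. refine (Ccv_unique _ _ _ _ H1).
  eapply Ccv_ext; [exact ED|apply Ccv_const].
Qed.

Lemma watson_weight_0 (j : nat) : watson_weight 0 j = (/ 2)%R.
Proof.
  induction j as [|j IH]; [reflexivity|]. rewrite watson_weight_S, IH.
  assert (Hj := pos_INR j). field. lra.
Qed.

Lemma watson_dlog_0 (j : nat) : watson_dlog 0 j = (- Hsum j)%R.
Proof.
  induction j as [|j IH]; [unfold Hsum; simpl; ring|]. rewrite watson_dlog_S, IH.
  change (Hsum (S j)) with (Hsum j + / (INR j + 1))%R.
  assert (Hj := pos_INR j). field. lra.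
Qed.

Lemma watson_sum_0 : watson_sum 0 = (1 + hyp_sum A B c) / 2.
Proof.
  assert (H : Ccv (csum (fun j => hyp_term A B c (S j) * RtoC (watson_weight (INR 0) j)))
    (/ 2 * (hyp_sum A B c - 1))).
  { assert (G := hyp_sum_cv A B c Hc Hre'). apply Ccv_incr in G.
    apply (fun H => Ccv_minus _ _ _ _ H (Ccv_const 1)) in G.
    apply (Ccv_scal _ (/ 2)) in G. eapply Ccv_ext; [|exact G].
    intros n. cbv beta. rewrite csum_S_hyp_term.
    transitivity (/ 2 * csum (fun m => hyp_term A B c (S m) * 1) n); [ring|].
    rewrite <- csum_scal. apply csum_ext. intros j.
    change (INR 0) with 0%R. rewrite watson_weight_0, RtoC_inv by lra. ring. }
  assert (E := Ccv_unique _ _ _ (watson_sum_cv 0) H).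
  replace (watson_sum 0) with (watson_sum 0 - 1 + 1) by ring. rewrite E. field.
Qed.

Lemma hyp_term_Hsum_cv :
  Ccv (csum (fun j => hyp_term A B c (S j) * RtoC (Hsum j))) (- 2 * watson_dsum 0).
Proof.
  eapply Ccv_ext; [|exact (Ccv_scal _ (- 2) _ (watson_dsum_cv 0))].
  intros n. cbv beta. rewrite <- csum_scal. apply csum_ext. intros j.
  change (INR 0) with 0%R.
  rewrite watson_weight_0, watson_dlog_0, RtoC_mult, RtoC_inv, RtoC_opp by lra. field.
Qed.

End Watson.

(** * Trigonometric identities and the closed form *)

Lemma Ci_sq : Ci * Ci = - (1).
Proof. unfold Ci, Cmult, Copp, RtoC. simpl. f_equal; ring. Qed.

Lemma Csin_mul_Csin (u v : C) : 2 * (Csin u * Csin v) = Ccos (u - v) - Ccos (u + v).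
Proof.
  unfold Csin, Ccos.
  replace (Ci * (u - v)) with (Ci * u + - (Ci * v)) by ring.
  replace (- (Ci * u + - (Ci * v))) with (- (Ci * u) + Ci * v) by ring.
  replace (Ci * (u + v)) with (Ci * u + Ci * v) by ring.
  replace (- (Ci * u + Ci * v)) with (- (Ci * u) + - (Ci * v)) by ring.
  rewrite !Cexp_plus.
  set (e1 := Cexp (Ci * u)). set (e2 := Cexp (Ci * v)).
  set (f1 := Cexp (- (Ci * u))). set (f2 := Cexp (- (Ci * v))).
  transitivity (2 * ((e1 - f1) * (e2 - f2)) / (4 * (Ci * Ci))).
  - field. apply Ci_nz.
  - rewrite Ci_sq. field.
Qed.

Lemma Ccos_sub_PI (z : C) : Ccos (z - RtoC PI) = - Ccos z.
Proof.
  unfold Ccos.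
  replace (- (Ci * (z - RtoC PI))) with (- (Ci * z) + Ci * RtoC PI) by ring.
  replace (Ci * (z - RtoC PI)) with (Ci * z + Ci * RtoC (- PI)) by (rewrite RtoC_opp; ring).
  rewrite !Cexp_plus.
  assert (H : forall x, Cexp (Ci * RtoC x) = (cos x, sin x)).
  { intros x. rewrite Cexp_eq. unfold Ci, Cmult, RtoC. simpl.
    replace (0 * x - 1 * 0)%R with 0%R by ring. replace (0 * 0 + 1 * x)%R with x by ring.
    rewrite exp_0. f_equal; ring. }
  rewrite !H, cos_neg, sin_neg, cos_PI, sin_PI.
  replace (-1, (- 0)%R) with (- (1)) by (unfold Copp, RtoC; simpl; f_equal; ring).
  replace (-1, 0%R) with (- (1)) by (unfold Copp, RtoC; simpl; f_equal; ring).
  field.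
Qed.

(** With z = u + iv, the real part has a positive sum of exponentials as a factor, so cos (PI u) =
    0; then sin (PI u) is nonzero and the imaginary part forces v = 0. This serves to show that cos
    PI(a+b), a denominator of the result, does not vanish. *)
Lemma Ccos_zero (z : C) : Ccos (RtoC PI * z) = 0 -> exists k : Z, z = RtoC (IZR k + 1 / 2).
Proof.
  intros H. destruct z as [u v].
  assert (E : Cexp (Ci * (RtoC PI * (u, v))) + Cexp (- (Ci * (RtoC PI * (u, v)))) = 0).
  { replace (Cexp (Ci * (RtoC PI * (u, v))) + Cexp (- (Ci * (RtoC PI * (u, v)))))
      with (Ccos (RtoC PI * (u, v)) * 2) by (unfold Ccos; field).
    rewrite H. ring. }
  rewrite !Cexp_eq in E. unfold Ci, Cmult, Cplus, Copp, RtoC in E. simpl in E.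
  replace (0 * (PI * u - 0 * v) - 1 * (PI * v + 0 * u))%R with (- (PI * v))%R in E by ring.
  replace (0 * (PI * v + 0 * u) + 1 * (PI * u - 0 * v))%R with (PI * u)%R in E by ring.
  rewrite Ropp_involutive, cos_neg, sin_neg in E.
  injection E as E1 E2.
  assert (P1 := exp_pos (PI * v)). assert (P2 := exp_pos (- (PI * v))).
  assert (Hcos : cos (PI * u) = 0%R).
  { apply Rmult_eq_reg_l with (exp (- (PI * v)) + exp (PI * v))%R; lra. }
  assert (Hsin : sin (PI * u) <> 0%R).
  { intros Hs. assert (Hq := sin2_cos2 (PI * u)). rewrite Hs, Hcos in Hq. unfold Rsqr in Hq. lra. }
  assert (Hexp : exp (- (PI * v)) = exp (PI * v)).
  { apply Rmult_eq_reg_r with (sin (PI * u)); auto. lra. }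
  apply exp_inv in Hexp. assert (HPI := PI_RGT_0).
  assert (Hv : v = 0%R) by nra.
  destruct (cos_eq_0_0 _ Hcos) as [k Hk]. exists k. unfold RtoC. f_equal; auto.
  apply Rmult_eq_reg_l with PI; lra.
Qed.

Lemma harmonic_eq_Hsum (n : nat) : harmonic n = Hsum n.
Proof.
  induction n as [|n IH].
  - unfold harmonic. now rewrite sum_n_m_zero by lia.
  - unfold harmonic in *. rewrite sum_n_Sm by lia. rewrite IH.
    change (Hsum (S n)) with (Hsum n + / (INR n + 1))%R. rewrite S_INR. reflexivity.
Qed.

(** The k-th Gauss factor is ((k + 1/2)^2 - (a-b)^2) / ((k + 1/2)^2 - (a+b-1)^2), a quotient of
    cosine factors at a - b and at a + b - 1. The shift by 1 in the latter produces the minus sign.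
    Kept free of division, so that the product argument does not wait for the cosine to be
    nonzero. *)
Lemma hyp_sum_cos (a b : C) :
  (forall k : nat, a + b - 1 / 2 <> - RtoC (INR k)) -> (Re (a + b) < 1 / 2)%R ->
  hyp_sum (2 * a - 1) (2 * b - 1) (a + b - 1 / 2) * Ccos (RtoC PI * (a + b))
  = - Ccos (RtoC PI * (a - b)).
Proof.
  intros Hc Hab. set (c := a + b - 1 / 2) in *.
  assert (Hre : Re (c - (2 * a - 1) - (2 * b - 1)) = (3 / 2 - Re (a + b))%R).
  { replace (c - (2 * a - 1) - (2 * b - 1)) with (RtoC (3 / 2) - (a + b)).
    - rewrite Re_minus, re_RtoC. reflexivity.
    - unfold c. rewrite RtoC_div by lra. field. }
  assert (H1 := gauss_product (2 * a - 1) (2 * b - 1) c Hc ltac:(lra)).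
  assert (H2 := cos_product (a + b - 1)). assert (H3 := cos_product (a - b)).
  assert (E := Ccv_unique _ _ (Ccos (RtoC PI * (a - b))) (Ccv_mult _ _ _ _ H1 H2)).
  replace (RtoC PI * (a + b - 1)) with (RtoC PI * (a + b) - RtoC PI) in E by ring.
  rewrite Ccos_sub_PI in E.
  rewrite <- E; [ring|]. clear E.
  eapply Ccv_ext; [|exact H3]. intros n. induction n as [|n IH]; [simpl; ring|].
  simpl cprod. rewrite IH.
  assert (Hn := pos_INR n).
  assert (E1 : RtoC (2 * INR n + 1) <> 0) by (intros F; apply RtoC_inj in F; lra).
  assert (E2 := add_INR_neq_0 c n Hc).
  assert (E3 : c - (2 * a - 1) - (2 * b - 1) + RtoC (INR n) <> 0).
  { apply add_INR_neq_0, neq_opp_INR_of_Re_pos. lra. }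
  transitivity (cprod (gauss_factor (2 * a - 1) (2 * b - 1) c) n * cprod (cos_factor (a + b - 1)) n
    * (gauss_factor (2 * a - 1) (2 * b - 1) c n * cos_factor (a + b - 1) n)); [|ring].
  f_equal. unfold gauss_factor, cos_factor. unfold c in *.
  rewrite RtoC_plus, RtoC_mult in *. field. repeat split; auto.
  - intros F. apply E3.
    transitivity (((a + b) * 2 - 1 - (2 * a - 1) * 2 - (2 * b - 1) * 2 + RtoC (INR n) * 2) / 2);
      [field|rewrite F; field].
  - intros F. apply E2.
    transitivity (((a + b) * 2 - 1 + RtoC (INR n) * 2) / 2); [field|rewrite F; field].
Qed.

(** r(k) factors into linear terms, two above and two below, so its logarithmic derivative is a sum
    of simple fractions. They match the four digamma series, in which two plus and two minus signs
    cancel the logarithmic increments. *)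
Lemma watson_dlog_ratio (a b : C) (k : nat) :
  let A := 2 * a - 1 in let B := 2 * b - 1 in let c := a + b - 1 / 2 in
  let x := RtoC (INR k) in
  1 - a + x <> 0 -> 1 - b + x <> 0 -> 3 / 2 - a - b + x <> 0 ->
  watson_ratio A B c k <> 0 /\
  watson_dratio A B c k / watson_ratio A B c k =
    / (1 - a + x) + / (1 - b + x) - / (1 / 2 + x) - / (3 / 2 - a - b + x).
Proof.
  intros A B c x Ha Hb Hab.
  assert (Hx : 1 / 2 + x <> 0).
  { unfold x. rewrite <- RtoC_div, <- RtoC_plus by lra. intros F. apply RtoC_inj in F.
    assert (H := pos_INR k). lra. }
  assert (E : watson_ratio A B c k =
    (1 - a + x) * (1 - b + x) / ((1 / 2 + x) * (3 / 2 - a - b + x))).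
  { unfold watson_ratio. fold x.
    replace (2 * x + 1) with (2 * (1 / 2 + x)) by field.
    replace (x + 1 - c) with (3 / 2 - a - b + x) by (unfold c; field).
    unfold A, B. apply Ceq_minus.
    transitivity ((((1 / 2 + x) * (3 / 2 - a - b + x) + (2 * a - 1) * (2 * b - 1) / 4)
      - (1 - a + x) * (1 - b + x)) / ((1 / 2 + x) * (3 / 2 - a - b + x))).
    - set (p := 1 / 2 + x) in *. set (q := 3 / 2 - a - b + x) in *. field. auto.
    - replace (((1 / 2 + x) * (3 / 2 - a - b + x) + (2 * a - 1) * (2 * b - 1) / 4)
        - (1 - a + x) * (1 - b + x)) with (RtoC 0) by field.
      set (p := 1 / 2 + x) in *. set (q := 3 / 2 - a - b + x) in *. field. auto. }
  assert (E' : watson_dratio A B c k =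
    - ((2 * a - 1) * (2 * b - 1) / (4 * (1 / 2 + x) * (3 / 2 - a - b + x))
       * (/ (1 / 2 + x) + / (3 / 2 - a - b + x)))).
  { unfold watson_dratio. fold x.
    replace (2 * x + 1) with (2 * (1 / 2 + x)) by field.
    replace (x + 1 - c) with (3 / 2 - a - b + x) by (unfold c; field).
    unfold A, B. set (p := 1 / 2 + x) in *. set (q := 3 / 2 - a - b + x) in *. field. auto. }
  assert (Hr : watson_ratio A B c k <> 0).
  { rewrite E. apply Cmult_neq_0; [now apply Cmult_neq_0|].
    intros F. apply C1_nz. set (y := (1 / 2 + x) * (3 / 2 - a - b + x)) in *.
    assert (Hy : y <> 0) by (now apply Cmult_neq_0).
    rewrite <- (Cinv_l y Hy), F. ring. }
  split; auto. rewrite E, E'.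
  set (u := 1 - a + x) in *. set (v := 1 - b + x) in *. set (p := 1 / 2 + x) in *.
  (* The four linear factors obey one relation, u + v = p + q with q the fourth; eliminating it and
     writing A B = 4 (p - u)(p - v) leaves an identity in u, v, p alone. *)
  replace (3 / 2 - a - b + x) with (u + v - p) in * by (unfold u, v, p; field).
  replace ((2 * a - 1) * (2 * b - 1)) with (4 * ((p - u) * (p - v))) by (unfold u, v, p; field).
  field. auto.
Qed.

Theorem theorem3 (a b : C)
  (hab : (Re (a + b) < 1 / 2)%R)
  (* no denominator of the series vanishes; then cos (PI (a + b)) <> 0 too *)
  (hden : forall k : nat, a + b + 1 / 2 <> - RtoC (INR k))
  (* the denominators and the digamma values on the right are defined *)
  (ha1 : 2 * a - 1 <> 0) (hb1 : 2 * b - 1 <> 0)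
  (ha : forall k : nat, 1 - a <> - RtoC (INR k))
  (hb : forall k : nat, 1 - b <> - RtoC (INR k)) :
  @is_series C_AbsRing C_NormedModule
    (fun m : nat =>
       let n := S m in
       pochhammer (2 * a) n * pochhammer (2 * b) n
         / (RtoC (INR (fact n)) * pochhammer (a + b + 1 / 2) n)
       * (RtoC (harmonic n) / (RtoC (INR n) + 1)))
    ((2 * a + 2 * b - 1) * Csin (RtoC PI * a) * Csin (RtoC PI * b)
       / ((2 * a - 1) * (2 * b - 1) * Ccos (RtoC PI * (a + b)))
     * (digamma (1 / 2) + digamma (3 / 2 - a - b)
        - digamma (1 - a) - digamma (1 - b))).
Proof.
  set (A := 2 * a - 1) in *. set (B := 2 * b - 1) in *. set (c := a + b - 1 / 2).
  assert (half : Re (1 / 2) = (1 / 2)%R) by (rewrite <- RtoC_div by lra; apply re_RtoC).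
  (* [hden] keeps c + 1 off the poles; the additional case c = 0 would mean Re (a + b) = 1/2,
     against [hab]. *)
  assert (Hc : forall k : nat, c <> - RtoC (INR k)).
  { intros [|k] E.
    - assert (E0 : a + b = RtoC (1 / 2)).
      { rewrite RtoC_div by lra. replace (a + b) with (c + 1 / 2) by (unfold c; ring).
        rewrite E. simpl INR. ring. }
      rewrite E0, re_RtoC in hab. lra.
    - apply (hden k). replace (a + b + 1 / 2) with (c + 1) by (unfold c; field).
      rewrite E, RtoC_INR_S. ring. }
  assert (Hs : (1 < Re (3 / 2 - a - b))%R).
  { replace (3 / 2 - a - b) with (RtoC (3 / 2) - (a + b)) by (rewrite RtoC_div by lra; ring).
    rewrite Re_minus, re_RtoC. lra. }
  assert (Hre : (1 < Re (1 - c))%R).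
  { replace (1 - c) with (3 / 2 - a - b) by (unfold c; field). exact Hs. }
  assert (HB : B = 2 * c - 1 - A) by (unfold A, B, c; field).
  assert (Hs' := neq_opp_INR_of_Re_pos _ (Rlt_trans _ _ _ Rlt_0_1 Hs)).
  assert (Hh := neq_opp_INR_of_Re_pos (1 / 2) ltac:(lra)).
  set (P := digamma (1 / 2) + digamma (3 / 2 - a - b) - digamma (1 - a) - digamma (1 - b)).
  assert (Hdl := fun k => watson_dlog_ratio a b k (add_INR_neq_0 _ k ha)
    (add_INR_neq_0 _ k hb) (add_INR_neq_0 _ k Hs')).
  assert (HP : Ccv (csum (fun k => watson_dratio A B c k / watson_ratio A B c k)) P).
  { eapply Ccv_ext; [|exact (Ccv_minus _ _ _ _ (Ccv_minus _ _ _ _ (Ccv_plus _ _ _ _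
      (digamma_cv _ Hh) (digamma_cv _ Hs')) (digamma_cv _ ha)) (digamma_cv _ hb))].
    intros n. cbv beta. rewrite <- csum_plus, <- !csum_minus. apply csum_ext. intros k.
    unfold A, B, c. rewrite (proj2 (Hdl k)). ring. }
  assert (HD := watson_dsum_0 A B c Hc Hre HB P (fun k => proj1 (Hdl k)) HP).
  assert (HW := watson_sum_0 A B c Hc Hre HB).
  assert (HG := hyp_sum_cos a b Hc hab). fold A B c in HG.
  (* A zero means a + b = k + 1/2, where [hab] forces k < 0. Then a + b + 1/2 = k + 1 is a
     nonpositive integer, excluded by [hden] at index -k - 1. *)
  assert (Hcos : Ccos (RtoC PI * (a + b)) <> 0).
  { intros E. destruct (Ccos_zero _ E) as [k Hk]. rewrite Hk, re_RtoC in hab.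
    assert (Hk0 : (k < 0)%Z) by (apply lt_IZR; lra).
    apply (hden (Z.to_nat (- k - 1))). rewrite Hk, INR_IZR_INZ, Z2Nat.id by lia.
    rewrite minus_IZR, opp_IZR, RtoC_minus, RtoC_opp, RtoC_plus, RtoC_div by lra. field. }
  assert (Hss := Csin_mul_Csin (RtoC PI * a) (RtoC PI * b)).
  replace (RtoC PI * a - RtoC PI * b) with (RtoC PI * (a - b)) in Hss by ring.
  replace (RtoC PI * a + RtoC PI * b) with (RtoC PI * (a + b)) in Hss by ring.
  (* From W(0) = (1 + F)/2 with F = -cos PI(a-b) / cos PI(a+b), the difference of the two cosines
     becomes a product of sines. *)
  assert (HW' : watson_sum A B c 0 =
    - (Csin (RtoC PI * a) * Csin (RtoC PI * b) / Ccos (RtoC PI * (a + b)))).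
  { rewrite HW. apply Ceq_minus.
    transitivity ((Ccos (RtoC PI * (a + b)) + hyp_sum A B c * Ccos (RtoC PI * (a + b))
      + 2 * (Csin (RtoC PI * a) * Csin (RtoC PI * b))) / (2 * Ccos (RtoC PI * (a + b)))).
    - field. auto.
    - rewrite HG, Hss. field. auto. }
  apply is_series_of_Ccv.
  assert (HS := hyp_term_Hsum_cv A B c Hc Hre HB). rewrite HD, HW' in HS.
  (* The term j = 0 carries H_0 = 0 and drops out, which aligns the indices. The factor c/(A B)
     turns (A)_(n+1), (B)_(n+1), (c)_(n+1) into (2a)_n, (2b)_n, (a+b+1/2)_n, and 1/(n+1) completes
     the factorial. *)
  apply Ccv_incr in HS. apply (Ccv_scal _ (c / (A * B))) in HS.
  replace ((2 * a + 2 * b - 1) * Csin (RtoC PI * a) * Csin (RtoC PI * b)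
       / (A * B * Ccos (RtoC PI * (a + b))) * P) with
    (c / (A * B) * (- 2 * (- (Csin (RtoC PI * a) * Csin (RtoC PI * b)
      / Ccos (RtoC PI * (a + b))) * P))).
  2:{ replace (2 * a + 2 * b - 1) with (2 * c) by (unfold c; field). field. auto. }
  eapply Ccv_ext; [|exact HS]. intros n. cbv beta. rewrite csum_shift.
  change (Hsum 0) with 0%R. rewrite Cmult_0_r, Cplus_0_l, <- csum_scal.
  apply csum_ext. intros m. cbv zeta. rewrite harmonic_eq_Hsum.
  assert (H1 := pochhammer_neq_0 c (S (S m)) Hc).
  assert (H2 := fact_neq_0_C (S m)). assert (H3 := INR_S_neq_0 (S m)).
  assert (H4 : c + RtoC (INR (S m)) <> 0) by (now apply add_INR_neq_0).
  assert (H5 : c <> 0) by (rewrite <- (Cplus_0_r c); exact (add_INR_neq_0 c 0 Hc)).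
  replace (2 * a) with (A + 1) by (unfold A; ring).
  replace (2 * b) with (B + 1) by (unfold B; ring).
  replace (a + b + 1 / 2) with (c + 1) by (unfold c; field).
  assert (HA := pochhammer_shift A (S m)). assert (HBs := pochhammer_shift B (S m)).
  assert (HC := pochhammer_shift c (S m)).
  assert (Hc1 := pochhammer_neq_0 _ (S m) (add_1_neq c Hc)).
  unfold hyp_term. rewrite fact_simpl, mult_INR, RtoC_mult, RtoC_INR_S.
  change (pochhammer A (S (S m))) with (pochhammer A (S m) * (A + RtoC (INR (S m)))).
  change (pochhammer B (S (S m))) with (pochhammer B (S m) * (B + RtoC (INR (S m)))).
  change (pochhammer c (S (S m))) with (pochhammer c (S m) * (c + RtoC (INR (S m)))).
  rewrite <- HA, <- HBs, <- HC. field. repeat split; auto.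
Qed.
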